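(* Let $T>0$ be an arbitrary time horizon. Consider the infinite server queue in the random environment $Z$ described in the context, with number of active jobs $N^{\varepsilon}$, and let $N$ be the limiting process defined there. Then, as $\varepsilon\to0$, $\mathbb P_Z$-almost surely the following limit in distribution holds in $D_T$: $$\{N^{\varepsilon}(t):\,t\in[0,T]\}\xrightarrow{(\mathrm d)}\{N(t):\,t\in[0,T]\}.$$
   Context: All random elements live on a probability space $(\Omega,\mathcal F,\mathbb P)$ with expectation $\mathbb E$. Environment. $Z=\{Z_t;\,t\ge 0\}$ is an $\mathbb{R}^d$-valued stochastic process with initial distribution $\rho_0$ and a unique invariant probability measure $\pi$. It is strongly ergodic with rate $\kappa>0$ in the following sense: for the function $\psi$ below there is a finite random variable $C=C_\psi(\omega)>0$ such that, $\mathbb P$-almost surely, for all $t>0$, $\left|\frac1t\int_0^t\psi(Z_u)\,\mathrm{d}u-\bar\psi\right|\le \frac{C}{(1+t)^{\kappa}}$, where $\bar\psi=\int_{\mathbb{R}^d}\psi(z)\,\pi(\mathrm{d}z)$. Quenched probability. $\mathbb{P}_Z(\cdot)=\mathbb{P}(\cdot\mid Z)$ and $\mathbb{E}_Z[\cdot]=\mathbb{E}[\cdot\mid Z]$. ''$\mathbb P_Z$-almost surely, a limit in distribution holds'' means: for $\mathbb P$-almost every realization of $Z$, the laws under $\mathbb P_Z$ converge weakly. Arrivals. $\lambda:\mathbb{R}_+\to\mathbb{R}_+$ and $\psi:\mathbb{R}^d\to\mathbb{R}_+$ are continuous and bounded by a constant $K>0$, and $\psi$ is positive and Lipschitz. For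 each $\varepsilon>0$, conditionally on $Z$ the arrival times $\{\Gamma_k^{\varepsilon};\,k\ge1\}$ are the points of a Poisson process on $\mathbb{R}_+$ with nonhomogeneous intensity $s\mapsto\lambda(s)\psi(Z_{s/\varepsilon})$. Services. $\nu(s,\mathrm{d}r)$ is a probability kernel from $\mathbb{R}_+$ to $\mathbb{R}_+$. Conditionally on $Z$ and the arrival times, the service times $\{L_k^{\varepsilon};\,k\ge1\}$ are independent and $L_k^{\varepsilon}$ has law $\nu(\Gamma_k^{\varepsilon},\mathrm{d}r)$. The complementary cumulative distribution function $\bar F_s(r)=\int_r^\infty\nu(s,\mathrm{d}\tau)=\nu(s,(r,\infty))$, $r\ge 0$, satisfies, for some $\alpha>0$ and $c>0$: $\bar F_s(r)\le c\,(r^{-\alpha}\wedge 1)$ for all $r,s>0$, and $|\bar F_s(r)-\bar F_t(r)|\le c(1+r)^{-1-\alpha}(t-s)$ for all $0<s<t$ and $r>0$. Queue. $N^{\varepsilon}(t)=\sum_{k\ge1}\mathbf 1_{\{\Gamma_k^{\varepsilon}\le t<\Gamma_k^{\varepsilon}+L_k^{\varepsilon}\}}$. Limit. $M=\sum_{k\ge1}\delta_{(\Gamma_k,L_k)}$ is a Poisson point process on $\mathbb{R}_+\times\mathbb{R}_+$ with (deterministic) mean measure $\tilde\nu(\mathrm{d}s,\mathrm{d}r)=\bar\psi\,\lambda(s)\,\nu(s,\mathrm{d}r)\,\mathrm{d}s$, and $N(t)=\sum_{k\ge1}\mathbf 1_{\{\Gamma_k\le t<\Gamma_k+L_k\}}$;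 $N$ is independent of $N^{\varepsilon}$. Path space. $D_T$ is the space of functions $f:[0,T]\to\mathbb{R}_+$ that are right-continuous with left limits, with the Skorohod ($J_1$) topology and its Borel $\sigma$-field. *)

(* Defs.v *)
From HB Require Import structures.
From mathcomp Require Import all_boot all_order all_algebra.
From mathcomp Require Import all_classical all_reals all_analysis.
From mathcomp Require Import measurable_realfun poisson_distribution.

Set Implicit Arguments.
Unset Strict Implicit.
Unset Printing Implicit Defensive.

Import Order.TTheory GRing.Theory Num.Theory.
Import numFieldNormedType.Exports.

Local Open Scope classical_set_scope.
Local Open Scope ring_scope.

(* A function on [0, T] is encoded by its extension by 0 to the real line, so
   that equality of paths is equality on [0, T]. *)
Record skorohod (R : realType) (T : R) := Skorohod {
  skorohod_fun :> R -> R ;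
  skorohod_right_continuous : forall t : R, 0 <= t < T ->
    skorohod_fun u @[u --> t^'+] --> skorohod_fun t ;
  skorohod_left_limit : forall t : R, 0 < t <= T ->
    cvg (skorohod_fun u @[u --> t^'-]) ;
  skorohod_ge0 : forall t : R, 0 <= t <= T -> 0 <= skorohod_fun t ;
  skorohod_out : forall t : R, ~~ (0 <= t <= T) -> skorohod_fun t = 0 }.

HB.instance Definition _ (R : realType) (T : R) := gen_eqMixin (skorohod T).
HB.instance Definition _ (R : realType) (T : R) := gen_choiceMixin (skorohod T).

(* An increasing map of [0, T] onto itself is automatically a homeomorphism. *)
Definition time_change (R : realType) (T : R) (theta : R -> R) : Prop :=
  {in `[0, T] &, {homo theta : s t / s < t}} /\
  theta @` `[0, T]%classic = `[0, T]%classic.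

(* The open balls of the metric
     inf_theta max (sup_t |theta t - t|) (sup_t |f t - g (theta t)|)
   inducing the J1 topology. *)
Definition skorohod_ball (R : realType) (T : R)
    (f : skorohod T) (e : R) (g : skorohod T) : Prop :=
  exists2 theta, time_change T theta & exists2 r, r < e &
    forall t : R, t \in `[0, T] -> `|theta t - t| <= r /\ `|f t - g (theta t)| <= r.

Section skorohod_topology.
Context (R : realType) (T : R).

Let in_cl (t : R) : (t \in `[0, T]) = (`[0, T]%classic t) :> Prop.
Proof. by []. Qed.

Lemma skorohod_ball_center (f : skorohod T) (e : R) :
  0 < e -> skorohod_ball f e f.
Proof.
move=> e0; exists id; first by split => //; rewrite image_id.
by exists 0 => // t _; rewrite !subrr normr0.
Qed.

Lemma skorohod_ball_sym (f g : skorohod T) (e : R) :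
  skorohod_ball f e g -> skorohod_ball g e f.
Proof.
move=> [th [thlt thI] [r re fg]].
have thin t : t \in `[0, T] -> th t \in `[0, T].
  by move=> tI; rewrite in_cl -thI; exists t.
have thsurj u : u \in `[0, T] -> exists2 t, t \in `[0, T] & th t = u.
  by rewrite in_cl -thI => -[t tI <-]; exists t.
pose inv u := if pselect (exists t, t \in `[0, T] /\ th t = u) is left h
  then projT1 (cid h) else u.
have invP u : u \in `[0, T] -> inv u \in `[0, T] /\ th (inv u) = u.
  move=> uI; rewrite /inv; case: pselect => [h|]; first by case: cid.
  by case; have [t tI <-] := thsurj _ uI; exists t.
have thle s t : s \in `[0, T] -> t \in `[0, T] -> th s < th t -> s < t.
  move=> sI tI st; rewrite ltNge; apply/negP.
  rewrite le_eqVlt => /predU1P[ts|ts]; first by rewrite ts ltxx in st.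
  by have := lt_trans st (thlt _ _ tI sI ts); rewrite ltxx.
exists inv.
  split.
    move=> u v uI vI uv.
    have [[iu tu] [iv tv]] := (invP _ uI, invP _ vI).
    by apply: thle => //; rewrite tu tv.
  apply/seteqP; split => [_ [u uI <-]|t tI]; first by have [] := invP _ uI.
  exists (th t); first exact: thin.
  have [it tt] := invP _ (thin _ tI).
  apply/eqP; rewrite eq_le !leNgt; apply/andP; split; apply/negP.
    by move/(thlt _ _ tI it); rewrite tt ltxx.
  by move/(thlt _ _ it tI); rewrite tt ltxx.
exists r => // u uI; have [iu tu] := invP _ uI.
have [h1 h2] := fg _ iu.
by split; rewrite distrC; [move: h1|move: h2]; rewrite tu.
Qed.

Lemma skorohod_ball_triangle (f g h : skorohod T) (e1 e2 : R) :
  skorohod_ball f e1 g -> skorohod_ball g e2 h ->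
  skorohod_ball f (e1 + e2) h.
Proof.
move=> [th1 [lt1 I1] [r1 re1 fg]] [th2 [lt2 I2] [r2 re2 gh]].
have in1 t : t \in `[0, T] -> th1 t \in `[0, T].
  by move=> tI; rewrite in_cl -I1; exists t.
exists (th2 \o th1).
  split; first by move=> s t sI tI st /=; apply: lt2; [exact: in1..|exact: lt1].
  by rewrite -image_comp I1 I2.
exists (r1 + r2); first exact: ltrD.
move=> t tI /=; have [a1 b1] := fg _ tI; have [a2 b2] := gh _ (in1 _ tI).
split; last exact: le_trans (ler_distD (g (th1 t)) _ _) (lerD b1 b2).
by rewrite [leRHS]addrC; exact: le_trans (ler_distD (th1 t) _ _) (lerD a2 a1).
Qed.

HB.instance Definition _ :=
  hasNbhs.Build (skorohod T) (nbhs_ (entourage_ (@skorohod_ball R T))).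

HB.instance Definition _ := @Nbhs_isPseudoMetric.Build R (skorohod T)
  (entourage_ (@skorohod_ball R T)) erefl (@skorohod_ball R T)
  skorohod_ball_center skorohod_ball_sym skorohod_ball_triangle erefl.

End skorohod_topology.

Definition sigma_generated d d' (Omega : measurableType d)
    (E : measurableType d') (I : Type) (D : set I) (X : I -> Omega -> E) :
    set (set Omega) :=
  <<s \bigcup_(i in D) preimage_set_system setT (X i) measurable >>.

Definition independent_sigma d (Omega : measurableType d) (R : realType)
    (P : probability Omega R) (F G : set (set Omega)) : Prop :=
  forall A B, F A -> G B -> P (A `&` B) = (P A * P B)%E.

(* A regular version of the conditional probability given G. *)
Definition conditional_probability d (Omega : measurableType d) (R : realType)
    (P : probability Omega R) (G : set (set Omega))
    (PZ : Omega -> probability Omega R) : Prop :=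
  forall A, measurable A ->
    preimage_set_system setT (fun w => PZ w A) measurable `<=` G /\
    (forall B, G B -> P (A `&` B) = \int[P]_(w in B) PZ w A)%E.

Definition borel (R : realType) (n : nat) :=
  g_sigma_algebraType (@open 'rV[R]_n).

(* The law at time t of the environment started from the initial law mu is
   evol t mu; no Markov property is required. *)
Definition evolution_of d (Omega : measurableType d) (R : realType)
    (P : probability Omega R) n (Z : R -> Omega -> borel R n)
    (rho0 : probability (borel R n) R)
    (evol : R -> probability (borel R n) R -> probability (borel R n) R) :=
  (forall mu B, measurable B -> evol 0 mu B = mu B) /\
  (forall (t : R) B, 0 <= t -> measurable B -> P (Z t @^-1` B) = evol t rho0 B).

Definition invariant_law (R : realType) n
    (evol : R -> probability (borel R n) R -> probability (borel R n) R)
    (pi : probability (borel R n) R) : Prop :=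
  forall (t : R) B, 0 <= t -> measurable B -> evol t pi B = pi B.

Definition unique_invariant_law (R : realType) n
    (evol : R -> probability (borel R n) R -> probability (borel R n) R)
    (pi : probability (borel R n) R) : Prop :=
  invariant_law evol pi /\
  forall pi', invariant_law evol pi' ->
    forall B, measurable B -> pi' B = pi B.

Definition strongly_ergodic d (Omega : measurableType d) (R : realType)
    (P : probability Omega R) n (Z : R -> Omega -> borel R n)
    (pi : probability (borel R n) R) (kappa : R) (psi : 'rV[R]_n -> R) : Prop :=
  exists C : Omega -> R,
    [/\ measurable_fun setT C, forall w, 0 < C w &
      {ae P, forall w, forall t : R, 0 < t ->
        `| t^-1 * (\int[lebesgue_measure]_(u in `[0%R, t]) psi (Z u w))
           - \int[pi]_z psi z | <= C w / (1 + t) `^ kappa }].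

(* The k-th job arrives at time arrival k and needs service time service k.
   If there are only finitely many jobs, the missing ones have arrival time
   +oo and their service time is irrelevant. *)
Record jobs d (Omega : measurableType d) (R : realType) := Jobs {
  arrival : nat -> Omega -> \bar R ;
  service : nat -> Omega -> R ;
  measurable_arrival : forall k, measurable_fun setT (arrival k) ;
  measurable_service : forall k, measurable_fun setT (service k) ;
  arrival_ge0 : forall k w, (0 <= arrival k w)%E ;
  service_ge0 : forall k w, 0 <= service k w ;
  arrival_locally_finite : forall t w,
    finite_set [set k | (arrival k w <= t%:E)%E] }.

Definition queue d (Omega : measurableType d) (R : realType)
    (J : jobs Omega R) (t : R) (w : Omega) : R :=
  fine (\sum_(k <oo)
    (\1_[set u | (arrival J k w <= u%:E < arrival J k w + (service J k w)%:E)%E]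
      t)%:E).

Section queue_path.
Context d (Omega : measurableType d) (R : realType).
Variable J : jobs Omega R.
Implicit Types (t u : R) (w : Omega) (k : nat).

Let busy w k : set R :=
  [set u | (arrival J k w <= u%:E < arrival J k w + (service J k w)%:E)%E].

Lemma queue_finite_sum w (b : R) : exists n, forall u, u <= b ->
  queue J u w = \sum_(0 <= k < n) \1_(busy w k) u.
Proof.
have [n nP] : exists n, forall k, (arrival J k w <= b%:E)%E -> (k < n)%N.
  have /finite_seqP[s sE] := arrival_locally_finite J b w.
  exists (\max_(i <- s) i).+1 => k kb; rewrite ltnS.
  have : [set` s] k by rewrite -sE.
  by move=> /= ks; exact: (leq_bigmax_seq _ ks).
exists n => u ub; rewrite /queue (nneseries_split 0 n)/=; last first.
  by move=> k _; rewrite lee_fin.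
rewrite add0n eseries0 ?adde0 ?sumEFin//.
move=> k nk _; rewrite indicE memNset//= => /andP[ku _].
by have := nP k (le_trans ku _); rewrite lee_fin ub ltnNge nk => /(_ isT).
Qed.

Let cvg_sum (f : nat -> R -> R) (l : nat -> R) (F : set_system R) n :
  Filter F -> (forall k, f k u @[u --> F] --> l k) ->
  (\sum_(0 <= k < n) f k u) @[u --> F] --> \sum_(0 <= k < n) l k.
Proof.
move=> FF fl; elim: n => [|n ih].
  by under eq_fun do rewrite big_nil; rewrite big_nil; exact: cvg_cst.
under eq_fun do rewrite big_nat_recr//=; rewrite big_nat_recr//=.
exact: cvgD.
Qed.

Let busy_right w k t : \1_(busy w k) u @[u --> t^'+] --> (\1_(busy w k) t : R).
Proof.
apply: cvg_near_cst; rewrite !indicE.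
have mem u : (u \in busy w k) = (arrival J k w <= u%:E <
    arrival J k w + (service J k w)%:E)%E by apply/idP/idP => [/set_mem|/mem_set].
rewrite mem; case: (arrival J k w) (arrival_ge0 J k w) mem => [a _ mem||//].
  rewrite -EFinD lee_fin lte_fin.
  have [ta|at_] := ltP t a.
    near=> u; rewrite indicE mem -EFinD lee_fin lte_fin leNgt.
    by rewrite (_ : u < a = true)//; near: u; exact: nbhs_right_lt.
  have [tb|bt] := ltP t (a + service J k w).
    near=> u; rewrite indicE mem -EFinD lee_fin lte_fin.
    rewrite (_ : u < _ = true); last by near: u; exact: nbhs_right_lt.
    by rewrite (le_trans at_)//; near: u; exact: nbhs_right_ge.
  near=> u; rewrite indicE mem -EFinD lee_fin lte_fin [X in _ && X]ltNge.
  rewrite (le_trans bt) ?andbF//; near: u; exact: nbhs_right_ge.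
by move=> _ mem; near=> u; rewrite indicE mem.
Unshelve. all: by end_near. Qed.

Let busy_left w k t : cvg ((\1_(busy w k) u : R) @[u --> t^'-]).
Proof.
have mem u : (u \in busy w k) = (arrival J k w <= u%:E <
    arrival J k w + (service J k w)%:E)%E by apply/idP/idP => [/set_mem|/mem_set].
case: (arrival J k w) (arrival_ge0 J k w) mem => [a _ mem||//]; last first.
  by move=> _ mem; apply/cvg_ex; exists 0; apply: cvg_near_cst; near=> u;
    rewrite indicE mem.
have [ta|at_] := leP t a.
  apply/cvg_ex; exists 0; apply: cvg_near_cst; near=> u.
  rewrite indicE mem -EFinD lee_fin lte_fin leNgt.
  rewrite (_ : u < a = true)//; apply: lt_le_trans ta.
  by near: u; exact: nbhs_left_lt.
have [tb|bt] := leP t (a + service J k w).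
  apply/cvg_ex; exists 1; apply: cvg_near_cst; near=> u.
  rewrite indicE mem -EFinD lee_fin lte_fin.
  rewrite (_ : u < _ = true); last first.
    by apply: lt_le_trans tb; near: u; exact: nbhs_left_lt.
  rewrite andbT (_ : a <= u = true)//.
  by near: u; exact: nbhs_left_ge.
apply/cvg_ex; exists 0; apply: cvg_near_cst; near=> u.
rewrite indicE mem -EFinD lee_fin lte_fin [X in _ && X]ltNge.
rewrite (_ : a + service J k w <= u = true) ?andbF//.
by near: u; exact: nbhs_left_ge.
Unshelve. all: by end_near. Qed.

Definition queue_path_fun (T : R) w t : R :=
  if 0 <= t <= T then queue J t w else 0.

Lemma queue_right_continuous (T : R) w t : 0 <= t < T ->
  queue_path_fun T w u @[u --> t^'+] --> queue_path_fun T w t.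
Proof.
move=> /andP[t0 tT]; have [n nP] := queue_finite_sum w T.
have -> : queue_path_fun T w t = \sum_(0 <= k < n) \1_(busy w k) t.
  by rewrite /queue_path_fun t0 (ltW tT) /= nP// ltW.
have : \sum_(0 <= k < n) \1_(busy w k) u @[u --> t^'+]
    --> (\sum_(0 <= k < n) \1_(busy w k) t : R).
  by apply: cvg_sum => k; exact: busy_right.
apply: cvg_trans; apply: near_eq_cvg; near=> u.
have uT : u <= T by near: u; exact: nbhs_right_le.
rewrite -nP// /queue_path_fun uT (_ : 0 <= u = true)//.
by apply: le_trans t0 _; near: u; exact: nbhs_right_ge.
Unshelve. all: by end_near. Qed.

Lemma queue_left_limit (T : R) w t : 0 < t <= T ->
  cvg (queue_path_fun T w u @[u --> t^'-]).
Proof.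
move=> /andP[t0 tT]; have [n nP] := queue_finite_sum w T.
apply/cvg_ex; exists (\sum_(0 <= k < n) lim ((\1_(busy w k) u : R) @[u --> t^'-])).
have : (\sum_(0 <= k < n) \1_(busy w k) u : R) @[u --> t^'-]
    --> \sum_(0 <= k < n) lim ((\1_(busy w k) u : R) @[u --> t^'-]).
  by apply: cvg_sum => k; exact: busy_left.
apply: cvg_trans; apply: near_eq_cvg; near=> u.
have uT : u <= T.
  by apply: le_trans tT; near: u; exact: nbhs_left_le.
rewrite -nP// /queue_path_fun uT (_ : 0 <= u = true)//.
by near: u; exact: nbhs_left_ge.
Unshelve. all: by end_near. Qed.

Lemma queue_path_ge0 (T : R) w t : 0 <= t <= T -> 0 <= queue_path_fun T w t.
Proof.
move=> tT; rewrite /queue_path_fun tT; apply: fine_ge0.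
by apply: nneseries_ge0 => k _ _; rewrite lee_fin.
Qed.

Lemma queue_path_out (T : R) w t :
  ~~ (0 <= t <= T) -> queue_path_fun T w t = 0.
Proof. by rewrite /queue_path_fun => /negbTE ->. Qed.

Definition queue_path (T : R) w : skorohod T :=
  Skorohod (@queue_right_continuous T w) (@queue_left_limit T w)
    (@queue_path_ge0 T w) (@queue_path_out T w).

End queue_path.

(* The set of indices of the points falling in B. *)
Definition arrival_hits d (Omega : measurableType d) (R : realType)
    (J : jobs Omega R) (B : set R) (w : Omega) : set nat :=
  [set k | exists2 s, arrival J k w = s%:E & B s].

Definition job_hits d (Omega : measurableType d) (R : realType)
    (J : jobs Omega R) (B : set (R * R)) (w : Omega) : set nat :=
  [set k | exists2 s, arrival J k w = s%:E & B (s, service J k w)].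

(* The random variables N(B) = #|hits B| form a Poisson random measure with
   mean measure mu: over disjoint sets of finite mean they are independent, and
   N(B) has the Poisson distribution of parameter mu B (Dirac at 0 when
   mu B = 0). The second argument of poisson_prob is a dummy. *)
Definition poisson_points d (Omega : measurableType d) (R : realType)
    (Q : probability Omega R) d' (E : measurableType d')
    (hits : set E -> Omega -> set nat) (mu : set E -> \bar R) : Prop :=
  forall n (B : 'I_n -> set E) (m : 'I_n -> nat),
    (forall i, measurable (B i)) -> trivIset setT B ->
    (forall i, (mu (B i) < +oo)%E) ->
    Q [set w | forall i, (hits (B i) w #= `I_(m i))%card] =
    (\prod_(i < n) fine (poisson_prob (fine (mu (B i))) 0 [set m i]))%:E.

Definition poisson_arrivals d (Omega : measurableType d) (R : realType)
    (Q : probability Omega R) (J : jobs Omega R) (intensity : R -> R) : Prop :=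
  @poisson_points _ Omega R Q _ (measurableTypeR R) (arrival_hits J)
    (fun B => \int[lebesgue_measure]_(s in B `&` `[0%R, +oo[) (intensity s)%:E)%E.

(* Conditionally on the arrival times, the service times are independent and
   the k-th one has law nu (arrival k). *)
Definition independent_services d (Omega : measurableType d) (R : realType)
    (Q : probability Omega R) (J : jobs Omega R)
    (nu : R.-pker (measurableTypeR R) ~> (measurableTypeR R)) : Prop :=
  forall (s : seq nat) (B : nat -> set (measurableTypeR R)) (G : set Omega),
    uniq s -> (forall k, measurable (B k)) ->
    sigma_generated setT (arrival J) G ->
    (forall w k, G w -> k \in s -> (arrival J k w < +oo)%E) ->
    (Q (G `&` [set w | forall k, k \in s -> B k (service J k w)]) =
     \int[Q]_(w in G)
       (\prod_(k <- s) fine (nu (fine (arrival J k w)) (B k)))%:E)%E.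

Definition mean_measure (R : realType) (psibar : R) (lambda : R -> R)
    (nu : R.-pker (measurableTypeR R) ~> (measurableTypeR R))
    (B : set (measurableTypeR R * measurableTypeR R)) : \bar R :=
  (\int[lebesgue_measure]_(s in `[0%R, +oo[)
    ((psibar * lambda s)%:E * nu s (xsection B s)))%E.

Definition poisson_jobs d (Omega : measurableType d) (R : realType)
    (Q : probability Omega R) (J : jobs Omega R)
    (mu : set (measurableTypeR R * measurableTypeR R) -> \bar R) : Prop :=
  poisson_points Q (job_hits J) mu.

Definition ccdf_kernel (R : realType)
    (nu : R.-pker (measurableTypeR R) ~> (measurableTypeR R)) (s r : R) : R :=
  fine (nu s `]r, +oo[%classic).

(* As e decreases to 0, the law of X e under Q converges weakly to the law of
   Y under P. *)
Definition cvg_in_distribution d (Omega : measurableType d) (R : realType)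
    (S : topologicalType) (Q : probability Omega R) (X : R -> Omega -> S)
    (P : probability Omega R) (Y : Omega -> S) : Prop :=
  forall F : S -> R, continuous F -> (exists b : R, forall f, `|F f| <= b) ->
    \int[Q]_w F (X e w) @[e --> 0^'+] --> \int[P]_w F (Y w).

(* Main.v *)
Require Import Defs.
From HB Require Import structures.
From mathcomp Require Import all_boot all_order all_algebra.
From mathcomp Require Import all_classical all_reals all_analysis.
From mathcomp Require Import measurable_realfun poisson_distribution.
From mathcomp Require Import lra ring zify.

Set Implicit Arguments.
Unset Strict Implicit.
Unset Printing Implicit Defensive.

Import Order.TTheory GRing.Theory Num.Theory.
Import numFieldNormedType.Exports.

Local Open Scope classical_set_scope.
Local Open Scope ring_scope.

(** Chop the arrival times into cells of length [T/(n+1)^2] and the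
    service times into cells of length [T/(n+1)], and record, for each arrival
    cell, whether it is empty or contains exactly one job, with the service cell
    of that job. If the arrivals and departures of a configuration are well
    separated, then all configurations with the same record have queue paths
    that are close in the Skorohod metric: a piecewise linear time change matches
    their jumps. So a bounded continuous functional of the path lies between two
    functions of the record that are close to each other with high probability,
    and only the finitely many probabilities of the records have to be compared.

    For the limit, these are products of Poisson probabilities. For the quenched
    queue, the arrival counts are Poisson with means that converge by the ergodic
    theorem along [Z]; given the arrivals, a service law depends only on the
    arrival time, hence is constant on an arrival cell up to the Lipschitz
    modulus of the complementary distribution function, and the errors add up
    to [O(1/n)]. The same Lipschitz bound shows that the departures of the limit
    have bounded mean density, which excludes simultaneous events. Since the
    argument only uses a monotone integral, no measurability of the paths as
    elements of the Skorohod space is needed. *)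

(** * Integrals of bounded functions *)

(** The quenched class probabilities are estimated only from below and those of the limit only from
    above. This suffices: once a bounded functional is shifted to be nonnegative, lower bounds on
    class probabilities bound its expectation from below; the differences between the two kinds of
    bound have a small sum; and the opposite functional gives the other inequality. The arrival
    hypothesis counts points in sets, while the service hypothesis speaks of fixed job indices,
    whose order is arbitrary. A class is therefore split according to the index that occupies each
    cell. The two meshes differ because there are about [(n+1)^2 * (n+3)] pairs of cells, each with
    an error of order [h^2]: the total [(n+3) * h] vanishes only if [h] is much smaller than [1/n].
    The service mesh does not enter the Lipschitz error, which compares two arrival times at the
    same end points. The functional is merely continuous, so its oscillation over a class need not
    be uniformly small. It vanishes pointwise along the values of the limit, and dominated
    convergence is applied to a step function that records it. *)

(* The integral of a nonnegative function is a supremum over the simple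
   functions below it, so it is monotone even without measurability. *)
Lemma le_integral_total d (T : measurableType d) (R : realType)
    (mu : {measure set T -> \bar R}) (D : set T) (f g : T -> \bar R) :
  (forall x, D x -> (f x <= g x)%E) ->
  (\int[mu]_(x in D) f x <= \int[mu]_(x in D) g x)%E.
Proof.
move=> Dfg; rewrite integral_mkcond [leRHS]integral_mkcond.
have {Dfg} : forall x, ((f \_ D) x <= (g \_ D) x)%E by exact: lee_restrict.
move: (f \_ D) (g \_ D) => {}f {}g fg.
rewrite integralE [leRHS]integralE.
have mono (u v : T -> \bar R) : (forall x, (0 <= u x)%E) ->
    (forall x, (u x <= v x)%E) -> (\int[mu]_x u x <= \int[mu]_x v x)%E.
  move=> u0 uv; rewrite !ge0_integralTE//; last first.
    by move=> x; exact: le_trans (u0 x) (uv x).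
  apply: le_ereal_sup => _ [h hu <-]; exists h => // x.
  exact: le_trans (hu x) (uv x).
apply: leeB; apply: mono => x //; rewrite ?funeposE ?funenegE.
  by rewrite ge_max le_max (fg x) /= le_max lexx orbT.
by rewrite ge_max le_max leeN2 (fg x) /= le_max lexx orbT.
Qed.

Section bounded_integral.
Context d (T : measurableType d) (R : realType) (Q : probability T R).
Implicit Types (f g : T -> R) (b : R).

Lemma integral_bounded_fin_num b f :
  (forall x, `|f x| <= b) -> (\int[Q]_x (f x)%:E)%E \is a fin_num.
Proof.
move=> fb.
have up : (\int[Q]_x (f x)%:E <= b%:E)%E.
  have -> : b%:E = (\int[Q]_x cst b%:E x)%E.
    by rewrite integral_cst//= probability_setT mule1.
  by apply: le_integral_total => x _; rewrite lee_fin (le_trans (ler_norm _)).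
have lo : ((- b)%:E <= \int[Q]_x (f x)%:E)%E.
  have -> : (- b)%:E = (\int[Q]_x cst (- b)%:E x)%E.
    by rewrite integral_cst//= probability_setT mule1.
  apply: le_integral_total => x _; rewrite lee_fin lerNl.
  by rewrite (le_trans _ (fb x))// -normrN ler_norm.
by rewrite fin_numElt (lt_le_trans (ltNyr _) lo) (le_lt_trans up (ltry _)).
Qed.

Lemma le_Rintegral_bounded b f g : (forall x, `|f x| <= b) ->
  (forall x, `|g x| <= b) -> (forall x, f x <= g x) ->
  \int[Q]_x f x <= \int[Q]_x g x.
Proof.
move=> fb gb fg; apply: fine_le; [exact: integral_bounded_fin_num fb|
  exact: integral_bounded_fin_num gb|].
by apply: le_integral_total => x _; rewrite lee_fin.
Qed.

Lemma RintegralN_bounded b f : (forall x, `|f x| <= b) ->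
  \int[Q]_x (- f x) = - \int[Q]_x f x.
Proof.
move=> fb; rewrite /Rintegral.
under eq_integral do rewrite EFinN.
rewrite integralN ?fineN//; apply: fin_num_adde_defl.
rewrite fin_numN (eq_integral (fun x => (Num.max (- f x) 0)%:E)); last first.
  by move=> x _; rewrite funenegE -EFinN -EFin_max.
apply: (@integral_bounded_fin_num b) => x.
have b0 : 0 <= b by rewrite (le_trans _ (fb x)).
have := fb x; rewrite ler_norml => /andP[f1 f2].
by rewrite ger0_norm ?le_max ?lexx ?orbT// ge_max b0 lerNl f1.
Qed.

Lemma Rintegral_ge_partition (I : finType) (E : I -> set T) (a : I -> R) b f :
  (forall i, measurable (E i)) -> trivIset setT E ->
  (forall x, `|f x| <= b) -> (forall i, - b <= a i <= b) ->
  (forall i x, E i x -> a i <= f x) ->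
  - b + \sum_i (a i + b) * fine (Q (E i)) <= \int[Q]_x f x.
Proof.
move=> mE tE fb ab aE.
pose g x := - b + \sum_i (a i + b) * \1_(E i) x.
have gE i x : E i x -> g x = a i.
  move=> Ex; rewrite /g (bigD1 i)//= indicE mem_set// mulr1 big1 ?addr0.
    by rewrite addrC addrK.
  move=> j ji; rewrite indicE memNset ?mulr0// => Exj.
  by move/eqP: ji; apply; apply: tE => //; exists x.
have gN x : (forall i, ~ E i x) -> g x = - b.
  move=> Ex; rewrite /g big1 ?addr0// => i _.
  by rewrite indicE memNset ?mulr0//; exact: Ex.
have gf x : - b <= g x <= f x.
  have [[i Ei]|nE] := pselect (exists i, E i x).
    by rewrite (gE _ _ Ei) aE// andbT; case/andP: (ab i).
  rewrite gN ?lexx /=; last by move=> i Ei; apply: nE; exists i.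
  by have := fb x; rewrite ler_norml => /andP[].
have gb x : `|g x| <= b.
  have /andP[g1 g2] := gf x; have := fb x; rewrite !ler_norml => /andP[_ f2].
  by rewrite g1 (le_trans g2).
have -> : - b + \sum_i (a i + b) * fine (Q (E i)) = \int[Q]_x g x.
  rewrite /g RintegralD//=; last 2 first.
  - exact: finite_measure_integrable_cst.
  - rewrite (_ : EFin \o _ = fun x => \sum_(i <- index_enum I) ((a i + b)%:E * (\1_(E i) x)%:E)%E)%E.
      apply: integrable_sum => // i _; apply: integrableZl => //.
      exact: integrable_indic.
    by apply/funext => x /=; rewrite -sumEFin; apply: eq_bigr => i _; rewrite EFinM.
  congr (_ + _).
    by rewrite Rintegral_cst//= probability_setT mulr1.
  rewrite /Rintegral.
  rewrite (eq_integral (fun x => \sum_(i <- index_enum I) ((a i + b)%:E * (\1_(E i) x)%:E)%E)%E); last first.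
    by move=> x _; rewrite -sumEFin; apply: eq_bigr => i _; rewrite EFinM.
  rewrite integral_sum//; last first.
    by move=> i; apply: integrableZl => //; exact: integrable_indic.
  rewrite (eq_bigr (fun i => ((a i + b) * fine (Q (E i)))%:E)).
    by rewrite sumEFin.
  move=> i _; rewrite integralZl//; last exact: integrable_indic.
  by rewrite integral_indic// setIT EFinM fineK// fin_num_measure.
apply: le_Rintegral_bounded gb fb _ => x.
by case/andP: (gf x).
Qed.

End bounded_integral.

(** * Time changes *)

(* Moving finitely many separated points by little: add to the identity a tent
   of half-width [rho] at each point; the supports of the tents are disjoint. *)
Lemma time_change_moving (R : realType) (T rho : R) (I : finType) (P : pred I)
    (x y : I -> R) : 0 < rho ->
  (forall i, P i -> rho <= x i <= T - rho) ->
  (forall i, P i -> `|y i - x i| < rho / 2) ->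
  (forall i j, P i -> P j -> i != j -> 3 * rho <= `|x i - x j|) ->
  exists theta, [/\ time_change T theta,
    forall t, `|theta t - t| <= rho / 2 & forall i, P i -> theta (x i) = y i].
Proof.
move=> rho0 xT yx sep.
pose tent (q u : R) := Num.max 0 (1 - `|u - q| / rho).
have tent0 q u : rho <= `|u - q| -> tent q u = 0.
  move=> h; apply/max_idPl; rewrite subr_le0 ler_pdivlMr// mul1r//.
have tent1 q : tent q q = 1 by rewrite /tent subrr normr0 mul0r subr0 max_r.
have tent01 q u : 0 <= tent q u <= 1.
  rewrite /tent le_max lexx /= ge_max ler01 /= lerBlDr lerDl.
  by rewrite divr_ge0// ltW.
have tentL q u v : tent q u - tent q v <= `|u - v| / rho.
  have uv : `|v - q| / rho <= `|u - v| / rho + `|u - q| / rho.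
    rewrite -mulrDl ler_pM2r ?invr_gt0// (distrC u v).
    exact: ler_distD.
  have uv0 : 0 <= `|u - v| / rho by rewrite divr_ge0// ltW.
  rewrite /tent; case: (leP 0 (1 - `|u - q| / rho)); case: (leP 0 (1 - `|v - q| / rho)); lra.
pose theta u := u + \sum_(i | P i) (y i - x i) * tent (x i) u.
(* Two points less than [rho] apart meet the support of at most one tent between them: if one lies
   within [rho] of [x i], both lie within [2 * rho] of it, hence at least [rho] away from any other
   [x j]. This is the origin of the separation [3 * rho]. *)
have loc s t : `|s - t| < rho ->
    (theta s = s /\ theta t = t) \/
    (exists2 i, P i & theta s = s + (y i - x i) * tent (x i) s /\
                      theta t = t + (y i - x i) * tent (x i) t).
  move=> st.
  have [/existsP[i /andP[Pi near]]|/existsPn far] :=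
      boolP [exists i, P i && ((`|s - x i| < rho) || (`|t - x i| < rho))].
    right; exists i => //.
    have far j : P j -> j != i -> rho <= `|s - x j| /\ rho <= `|t - x j|.
      move=> Pj ji; have := sep j i Pj Pi ji => xx.
      move: st near xx; rewrite !ltNge => st near xx.
      have tri (a b c : R) : `|a - c| <= `|a - b| + `|b - c| by exact: ler_distD.
      have := tri (x j) s (x i); have := tri (x j) t (x i).
      have := tri s t (x i); have := tri t s (x i).
      have := tri (x j) s t; have := tri (x j) t s.
      rewrite (distrC (x j) s) (distrC (x j) t) (distrC t s).
      case/orP: near; rewrite -ltNge; move: st; rewrite -ltNge => h1 h2; split; lra.
    rewrite /theta (bigD1 i)//= big1; last first.
      by move=> j /andP[Pj ji]; rewrite tent0 ?mulr0//; have [] := far j Pj ji.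
    rewrite addr0; split => //; rewrite (bigD1 i)//= big1 ?addr0//.
    by move=> j /andP[Pj ji]; rewrite tent0 ?mulr0//; have [] := far j Pj ji.
  left; rewrite /theta !big1 ?addr0//.
    move=> i Pi; have := far i; rewrite Pi negb_or -!leNgt => /andP[h1 h2].
    by rewrite tent0 ?mulr0.
  move=> i Pi; have := far i; rewrite Pi negb_or -!leNgt => /andP[h1 h2].
  by rewrite tent0 ?mulr0.
have disp u : `|theta u - u| < rho / 2.
  have [|[-> _]|[i Pi [-> _]]] := @loc u u; first by rewrite subrr normr0.
    by rewrite subrr normr0 divr_gt0.
  rewrite addrAC subrr add0r normrM (ger0_norm (proj1 (andP (tent01 (x i) u)))).
  apply: le_lt_trans (yx i Pi); rewrite ler_piMr//.
  by case/andP: (tent01 (x i) u).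
(* A tent has slope at most [1 / rho] and is scaled by less than [rho / 2], so at distances below
   [rho] the perturbation changes by less than [t - s]. At larger distances each point moves by less
   than [rho / 2], which cannot reverse the order. *)
have inc s t : s < t -> theta s < theta t.
  move=> st; have [h|h] := ltP (t - s) rho.
    have [|[-> ->//]|[i Pi [-> ->]]] := @loc s t.
      by rewrite distrC gtr0_norm ?subr_gt0.
    rewrite -subr_gt0.
    have : `|(y i - x i) * (tent (x i) s - tent (x i) t)| < t - s.
      rewrite normrM.
      have ht : `|tent (x i) s - tent (x i) t| <= (t - s) / rho.
        have := tentL (x i) s t; have := tentL (x i) t s.
        rewrite (distrC s t) (gtr0_norm (x := t - s)) ?subr_gt0// => h1 h2.
        by rewrite ler_norml h2 andbT lerNl opprB.
      have h2 : `|y i - x i| * `|tent (x i) s - tent (x i) t| <=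
          rho / 2 * ((t - s) / rho).
        by apply: ler_pM => //; exact: ltW (yx i Pi).
      apply: le_lt_trans h2 _.
      have -> : rho / 2 * ((t - s) / rho) = (t - s) / 2 by field; lra.
      lra.
    rewrite ltr_norml => /andP[_ h3]; lra.
  have := disp s; have := disp t; rewrite !ltr_norml => /andP[h1 h2] /andP[h3 h4].
  lra.
have mon : {mono theta : s t / s <= t} by apply: le_mono => s t; exact: inc.
have cont : continuous theta.
  move=> u; apply: cvgD; first exact: cvg_id.
  apply: cvg_big => [|i _]; first exact: add_continuous.
  apply: cvgM; first exact: cvg_cst.
  apply: (@continuous_max _ _ (cst 0) (fun v => 1 - `|v - x i| / rho)).
    exact: cvg_cst.
  apply: cvgB; first exact: cvg_cst.
  apply: cvgM; last exact: cvg_cst.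
  apply: (@cvg_norm _ _ _ _ _ (fun w : R => w - x i)).
  by apply: cvgB; [exact: cvg_id|exact: cvg_cst].
have fix_ u : (forall i, P i -> rho <= `|u - x i|) -> theta u = u.
  by move=> h; rewrite /theta big1 ?addr0// => i Pi; rewrite tent0 ?mulr0 ?h.
exists theta; split.
(* The end points lie outside all tents, hence are fixed; surjectivity onto the interval follows
   from the intermediate value theorem. *)
- have th0 : theta 0 = 0.
    by apply: fix_ => i Pi; have /andP[h1 h2] := xT i Pi; rewrite sub0r normrN ger0_norm//; lra.
  have thT : theta T = T.
    by apply: fix_ => i Pi; have /andP[h1 h2] := xT i Pi; rewrite ger0_norm; lra.
  split; first by move=> s t _ _; exact: inc.
  apply/seteqP; split => [_ [u /= uT <-]|v /= vT].
    by move: uT; rewrite !in_itv/= -{1}(mon 0) th0 -(mon _ T) thT.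
  have [T0|T0] := leP 0 T; last first.
    by move: vT; rewrite in_itv/= => /andP[v0 vT]; move: T0; rewrite ltNge (le_trans v0 vT).
  have [||u uT <-] := @IVT _ theta 0 T v T0.
  + exact: continuous_subspaceT.
  + by rewrite th0 thT min_l// max_r// -in_itv.
  + by exists u.
- by move=> t; exact: ltW (disp t).
- move=> i Pi; rewrite /theta (bigD1 i)//= tent1 mulr1 big1.
    by rewrite addr0 addrC subrK.
  move=> j /andP[Pj ji]; rewrite tent0 ?mulr0//.
  by have := sep i j Pi Pj; rewrite eq_sym => /(_ ji); lra.
Qed.

(** [A] selects the jobs present and [D] those whose departure is a jump before [T]. The points to
    move are indexed by [I * bool], with [false] for arrivals and [true] for departures. A departure
    outside [D] needs no matching: the busy interval is empty in both configurations, or it lasts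
    beyond [T] in both. *)
Lemma time_change_busy (R : realType) (T rho : R) (I : finType) (A D : pred I)
    (a b a' b' : I -> R) : 0 < rho ->
  (forall i, A i -> rho <= a i <= T - rho /\ `|a' i - a i| < rho / 2) ->
  (forall i, A i -> D i -> rho <= b i <= T - rho /\ `|b' i - b i| < rho / 2) ->
  (forall i, A i -> ~~ D i -> (b i = a i /\ b' i = a' i) \/ (T < b i /\ T < b' i)) ->
  (forall i j, A i -> A j -> i != j -> 3 * rho <= `|a i - a j|) ->
  (forall i j, A i -> A j -> D j -> 3 * rho <= `|a i - b j|) ->
  (forall i j, A i -> D i -> A j -> D j -> i != j -> 3 * rho <= `|b i - b j|) ->
  exists theta, [/\ time_change T theta,
    forall t, `|theta t - t| <= rho / 2 &
    forall i t, A i -> t \in `[0, T] ->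
      (a i <= t < b i) = (a' i <= theta t < b' i)].
Proof.
move=> rho0 ha hb hD saa sab sbb.
pose P (q : I * bool) := A q.1 && (q.2 ==> D q.1).
pose x (q : I * bool) := if q.2 then b q.1 else a q.1.
pose y (q : I * bool) := if q.2 then b' q.1 else a' q.1.
have [|||theta [tc disp thx]] := @time_change_moving R T rho _ P x y rho0.
- move=> [i []] /andP[/= Ai Di]; first by case: (hb i Ai Di).
  by case: (ha i Ai).
- move=> [i []] /andP[/= Ai Di]; first by case: (hb i Ai Di).
  by case: (ha i Ai).
- move=> [i [|]] [j [|]] /andP[/= Ai Di] /andP[/= Aj Dj]; rewrite xpair_eqE/= ?andbT ?andbF /x /=.
  + exact: sbb.
  + by rewrite distrC => _; exact: sab.
  + by move=> _; exact: sab.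
  + exact: saa.
exists theta; split => // i t Ai tT.
have [inc im] := tc.
have mon : {in `[0, T] &, {mono theta : s t / s <= t}} by exact: le_mono_in.
have rng : theta t \in `[0, T].
  have : (theta @` `[0, T]) (theta t) by exists t.
  by rewrite im.
have [/andP[a1 a2] _] := ha i Ai.
have aT : a i \in `[0, T] by rewrite in_itv/=; lra.
have tha : theta (a i) = a' i by apply: (thx (i, false)); rewrite /P /= Ai.
rewrite -(mon _ _ aT tT) tha.
have [Di|Di] := boolP (D i).
  have [/andP[b1 b2] _] := hb i Ai Di.
  have bT : b i \in `[0, T] by rewrite in_itv/=; lra.
  have thb : theta (b i) = b' i by apply: (thx (i, true)); rewrite /P /= Ai Di.
  by rewrite -(leW_mono_in mon tT bT) thb.
have [[-> ->]|[b1 b2]] := hD i Ai Di.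
  by congr (_ && _); rewrite -tha (leW_mono_in mon tT aT).
congr (_ && _).
move: tT rng; rewrite !in_itv/= => /andP[_ t1] /andP[_ t2].
by rewrite (le_lt_trans t1 b1) (le_lt_trans t2 b2).
Qed.

(** * Cells and classes of configurations *)

Section classes.
Context d (Omega : measurableType d) (R : realType).
Variables (h delta : R) (m M : nat).
Implicit Types (J : jobs Omega R) (w : Omega).

Definition arrival_cell (i : nat) : set R := `[i%:R * h, i.+1%:R * h[%classic.

(** The cells are left-open so that the cell of index 0 isolates service time 0: such a job never
    appears in the queue, so it must not share a class with jobs of short positive service. The last
    cell is the tail, where the departure comes too late to matter. *)
Definition service_cell (j : nat) : set R :=
  if j is j'.+1 then
    if (j' < M)%N then `]j'%:R * delta, j'.+1%:R * delta]%classic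
    else `]M%:R * delta, +oo[%classic
  else `]-oo, 0]%classic.

(** A configuration with two jobs in one arrival cell belongs to no class. The classes are disjoint
    but do not exhaust the sample space. *)
Definition in_class J (c : {ffun 'I_m -> option 'I_M.+2}) : set Omega :=
  [set w | forall i, if c i is Some j then
      exists2 k, arrival_hits J (arrival_cell i) w = [set k] &
        service_cell j (service J k w)
    else arrival_hits J (arrival_cell i) w = set0].

End classes.

Section separation.
Context d (Omega : measurableType d) (R : realType).
Implicit Types (J : jobs Omega R) (w : Omega).

Definition event J w k (x : R) : Prop :=
  arrival J k w = x%:E \/
  (0 < service J k w /\ exists2 s, arrival J k w = s%:E & x = s + service J k w).

(** The first clause compares different jobs only; the distance between the arrival and the
    departure of one job is the third clause. The second clause also concerns events after [T], so
    that none can cross the horizon under a small perturbation. *)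
Definition well_separated J w (T l : R) : Prop :=
  [/\ forall k k' x y, k != k' -> event J w k x -> event J w k' y ->
        x <= T -> y <= T -> l <= `|x - y|,
      forall k x, event J w k x -> l <= x /\ l <= `|x - T| &
      forall k s, arrival J k w = s%:E -> s <= T -> 0 < service J k w ->
        l <= service J k w].

Lemma arrival_cellP (h T : R) (m : nat) (s : R) : 0 < h -> T < m%:R * h ->
  0 <= s -> s <= T -> exists i : 'I_m, arrival_cell h i s.
Proof.
move=> h0 Tm s0 sT.
have /andP[t1 t2] := truncn_itv (divr_ge0 s0 (ltW h0)).
have tm : (Num.truncn (s / h) < m)%N.
  rewrite -(ltr_nat R); apply: le_lt_trans t1 _.
  by rewrite ltr_pdivrMr//; exact: le_lt_trans Tm.
exists (Ordinal tm); rewrite /arrival_cell/= in_itv/= -ler_pdivlMr//.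
by rewrite -ltr_pdivrMr// t1 t2.
Qed.

Lemma arrival_cell_inj (h : R) (i j : nat) (s : R) : 0 < h ->
  arrival_cell h i s -> arrival_cell h j s -> i = j.
Proof.
rewrite /arrival_cell/= !in_itv/= => h0 /andP[i1 i2] /andP[j1 j2].
have := le_lt_trans i1 j2; have := le_lt_trans j1 i2.
by rewrite !ltr_pM2r// !ltr_nat !ltnS => h1 h2; apply/eqP; rewrite eqn_leq h1 h2.
Qed.

Lemma arrival_cell_dist (h : R) (i : nat) (s s' : R) :
  arrival_cell h i s -> arrival_cell h i s' -> `|s - s'| < h.
Proof.
rewrite /arrival_cell/= !in_itv/= -natr1 mulrDl mul1r => /andP[i1 i2] /andP[j1 j2].
rewrite ltr_norml; lra.
Qed.

(** Jobs whose index is outside the range of [kappa] arrive after [T], so their indicators vanish at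
    [u]. This turns the series over indices into a sum over cells, in which two configurations of
    the same class can be compared term by term. *)
Lemma queue_cells J w (T : R) (I : finType) (A : pred I) (kappa : I -> nat) :
  (forall k s, arrival J k w = s%:E -> s <= T -> exists2 i, A i & kappa i = k) ->
  {in A &, injective kappa} ->
  forall u, u <= T -> queue J u w =
    \sum_(i | A i) \1_[set u : R | (arrival J (kappa i) w <= u%:E <
      arrival J (kappa i) w + (service J (kappa i) w)%:E)%E] u.
Proof.
move=> hk inj u uT.
pose f k : R := \1_[set u : R | (arrival J k w <= u%:E <
      arrival J k w + (service J k w)%:E)%E] u.
pose n := (\max_(i | A i) kappa i).+1.
have fA k : f k != 0 -> exists2 i, A i & kappa i = k.
  rewrite /f indicE; have [|] := boolP (u \in _); last by rewrite eqxx.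
  rewrite inE/= => /andP[au _] _.
  have : arrival J k w \is a fin_num.
    by rewrite ge0_fin_numE ?arrival_ge0// (le_lt_trans au)// ltry.
  move=> /fineK ae; apply: (hk k (fine (arrival J k w))); first by rewrite ae.
  by rewrite -lee_fin ae (le_trans au)// lee_fin.
have -> : queue J u w = \sum_(0 <= k < n) f k.
  rewrite /queue (nneseries_split 0 n)/=; last by move=> k _; rewrite lee_fin.
  rewrite add0n eseries0 ?adde0 ?sumEFin// => k nk _; congr EFin.
  apply/eqP; apply: contraTT nk => /fA[i Ai <-].
  by rewrite -ltnNge ltnS; exact: leq_bigmax_cond.
rewrite big_mkord.
rewrite (eq_bigr (fun k : 'I_n => \sum_(i | A i) (f (kappa i) *+ (kappa i == k :> nat)))); last first.
  move=> k _; have [fk0|/fA[i Ai ik]] := eqVneq (f k) 0.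
    by rewrite fk0 big1// => i Ai; have [->|] := eqVneq (kappa i) k; rewrite ?fk0 ?mul0rn.
  rewrite (bigD1 i)//= ik eqxx mulr1n big1 ?addr0// => j /andP[Aj ji].
  have [jk|//] := eqVneq (kappa j) k.
  by case/eqP: ji; apply: inj => //; rewrite jk ik.
rewrite exchange_big/=; apply: eq_bigr => i Ai.
have kn : (kappa i < n)%N by rewrite ltnS; exact: leq_bigmax_cond.
rewrite (bigD1 (Ordinal kn))//= eqxx mulr1n big1 ?addr0// => j jk.
by rewrite eq_sym; have [ji|] := eqVneq (j : nat) (kappa i); [case/eqP: jk; exact: val_inj|].
Qed.

Lemma service_cell_dist (delta : R) (M j : nat) (r r' : R) : 0 < delta ->
  0 <= r -> 0 <= r' -> service_cell delta M j r -> service_cell delta M j r' ->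
  [\/ r = 0 /\ r' = 0, [/\ 0 < r, 0 < r' & `|r - r'| < delta] |
      M%:R * delta < r /\ M%:R * delta < r'].
Proof.
move=> d0 r0 r'0; case: j => [|j] /=.
  rewrite !in_itv/= => r1 r1'; constructor 1; split; lra.
case: ifP => _; rewrite /= !in_itv/= ?andbT; last by move=> *; constructor 3.
rewrite -natr1 mulrDl mul1r => /andP[r1 r2] /andP[r1' r2']; constructor 2.
have jd : 0 <= j%:R * delta by rewrite mulr_ge0// ltW.
by split; rewrite ?ltr_norml; lra.
Qed.

(** Separation is required of one configuration only. Within a class, arrivals differ by less than
    [h] and departures by less than [h + delta], which the time change can absorb; after it the two
    paths are equal, so the distance comes from the time change alone. *)
Lemma in_class_close J J' w w' (T h delta rho : R) (m M : nat)
    (c : {ffun 'I_m -> option 'I_M.+2}) :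
  0 < h -> 0 < delta -> h + delta <= rho / 2 -> T < m%:R * h <= T + h ->
  T <= M%:R * delta -> well_separated J w T (3 * rho) ->
  in_class h delta J c w -> in_class h delta J' c w' ->
  skorohod_ball (queue_path J T w) rho (queue_path J' T w').
Proof.
move=> h0 d0 hd /andP[Tm mT] TM [S1 S2 S3].
have rho0 : 0 < rho by lra.
have pick (K : jobs Omega R) v : in_class h delta K c v -> exists2 kappa : 'I_m -> nat,
    (forall i, c i != None -> arrival_hits K (arrival_cell h i) v = [set kappa i]) &
    (forall i j, c i = Some j -> service_cell delta M j (service K (kappa i) v)).
  move=> cK; have : forall i, exists k : nat, if c i is Some j then
      arrival_hits K (arrival_cell h i) v = [set k] /\
      service_cell delta M j (service K k v) else True.
    move=> i; have := cK i; case: (c i) => [j [k]|_]; first by exists k.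
    by exists 0%N.
  move=> /choice[kappa hk]; exists kappa.
    by move=> i; have := hk i; case: (c i) => [j [] //|].
  by move=> i j; have := hk i => /[swap] -> [].
have arr (K : jobs Omega R) v kappa : (forall i, c i != None ->
      arrival_hits K (arrival_cell h i) v = [set kappa i]) ->
    forall i, c i != None -> arrival K (kappa i) v = (fine (arrival K (kappa i) v))%:E /\
      arrival_cell h i (fine (arrival K (kappa i) v)).
  move=> hk i ci; have : [set kappa i] (kappa i) by [].
  by rewrite -hk// => -[s -> ?].
have que (K : jobs Omega R) v kappa : in_class h delta K c v -> (forall i, c i != None ->
      arrival_hits K (arrival_cell h i) v = [set kappa i]) ->
    forall u, u <= T -> queue K u v = \sum_(i | c i != None) \1_[set u : R |
       (arrival K (kappa i) v <= u%:E <
      arrival K (kappa i) v + (service K (kappa i) v)%:E)%E] u.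
  move=> cK hk; apply: (@queue_cells K v T _ (fun i => c i != None) kappa).
    move=> k s ks sT.
    have s0 : 0 <= s by have := arrival_ge0 K k v; rewrite ks lee_fin.
    have [i si] := arrival_cellP h0 Tm s0 sT.
    have ki : arrival_hits K (arrival_cell h i) v k by exists s.
    have ci : c i != None.
      by apply/negP => /eqP ci; have := cK i; rewrite ci => ci0; rewrite ci0 in ki.
    by exists i => //; rewrite hk// in ki.
  move=> i j ci cj kij.
  have [_ ai] := arr _ _ _ hk i ci; have [_ aj] := arr _ _ _ hk j cj.
  by apply/val_inj; rewrite kij in ai; exact: arrival_cell_inj ai aj.
move=> cJ cJ'.
have [k hk sk] := pick _ _ cJ; have [k' hk' sk'] := pick _ _ cJ'.
have ak := arr _ _ _ hk; have ak' := arr _ _ _ hk'.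
pose a i := fine (arrival J (k i) w); pose a' i := fine (arrival J' (k' i) w').
pose r i := service J (k i) w; pose r' i := service J' (k' i) w'.
pose A i := c i != None.
pose D i := (0 < r i) && (a i + r i <= T).
have evA i : A i -> event J w (k i) (a i) by move=> Ai; left; case: (ak i Ai).
have evD i : A i -> 0 < r i -> event J w (k i) (a i + r i).
  by move=> Ai ri; right; split => //; exists (a i) => //; case: (ak i Ai).
(* The cells may overshoot [T] by up to [h], but an arrival there would be closer to [T] than the
   separation allows. *)
have aT i : A i -> 3 * rho <= a i <= T - 3 * rho.
  move=> Ai; have [-> h2] := S2 _ _ (evA i Ai).
  have [_] := ak i Ai; rewrite /arrival_cell /= in_itv/= -/(a i) => /andP[_ a2].
  have : i.+1%:R * h <= m%:R * h by rewrite ler_pM2r// ler_nat ltn_ord.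
  move=> im /=; have : a i < T + h by lra.
  by case: (ler0P (a i - T)) h2 => ? ?; lra.
have aa i : A i -> `|a' i - a i| < h.
  by move=> Ai; have [_ h1] := ak i Ai; have [_ h2] := ak' i Ai; exact: arrival_cell_dist h2 h1.
have rr i : A i -> [\/ r i = 0 /\ r' i = 0, [/\ 0 < r i, 0 < r' i & `|r i - r' i| < delta] |
      M%:R * delta < r i /\ M%:R * delta < r' i].
  rewrite /A; case ci : (c i) => [j|//] _.
  by apply: service_cell_dist (sk _ _ ci) (sk' _ _ ci) => //; exact: service_ge0.
have a0' i : A i -> 0 <= a' i.
  by move=> Ai; rewrite fine_ge0// arrival_ge0.
have kne i j : A i -> A j -> i != j -> k i != k j.
  move=> Ai Aj; apply: contra_neq => kij; apply/val_inj.
  have [_ h1] := ak i Ai; have [_ h2] := ak j Aj.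
  by rewrite kij in h1; exact: arrival_cell_inj h1 h2.
have bT i : A i -> 0 < r i -> a i + r i <= T -> 3 * rho <= a i + r i <= T - 3 * rho.
  move=> Ai ri bi; have [-> h2] := S2 _ _ (evD i Ai ri).
  by move: h2; rewrite ler0_norm; lra.
have [||||||theta [tc disp thE]] := @time_change_busy R T rho _ A D a
    (fun i => a i + r i) a' (fun i => a' i + r' i) rho0.
- move=> i Ai; have := aT i Ai; have := aa i Ai; split; lra.
- move=> i Ai /andP[ri bi]; have := bT i Ai ri bi => bi'; split; first lra.
  have := aa i Ai; have [[ri0 _]|[_ _ h1]|[h1 h2]] := rr i Ai.
  + by rewrite ri0 ltxx in ri.
  + by move: h1; rewrite !ltr_norml; lra.
  + by have := aT i Ai; lra.
(* Departures that are not moved. With zero service both intervals are empty; with a departure after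
   [T], the separation from [T] carries over to the other configuration; in the tail cell the
   service alone exceeds [T]. *)
- move=> i Ai nD; have aTi := aT i Ai; have ai := aa i Ai.
  have [[-> ->]|[r1 r1' h1]|[h1 h2]] := rr i Ai.
  + by rewrite !addr0; left.
  + move: nD; rewrite /D r1/= -ltNge => bT'; right; split => //.
    have [_] := S2 _ _ (evD i Ai r1); move: h1 ai.
    by rewrite !ltr_norml gtr0_norm ?subr_gt0//; lra.
  + by right; have := a0' i Ai; split; lra.
- move=> i j Ai Aj ij; apply: (S1 (k i) (k j)); [exact: kne|exact: evA|exact: evA| |].
    by have := aT i Ai; lra.
  by have := aT j Aj; lra.
- move=> i j Ai Aj /andP[rj bj]; have [ij|ij] := eqVneq i j.
    rewrite ij opprD addNKr normrN gtr0_norm//.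
    by apply: (S3 _ (a j)) => //; [case: (ak j Aj)|have := aT j Aj; lra].
  apply: (S1 (k i) (k j)); [exact: kne|exact: evA|exact: evD| |by[]].
  by have := aT i Ai; lra.
- move=> i j Ai /andP[ri bi] Aj /andP[rj bj] ij.
  by apply: (S1 (k i) (k j)) => //; [exact: kne|exact: evD|exact: evD].
exists theta => //; exists (rho / 2); first lra.
move=> t tT; split; first exact: disp.
have thT : theta t \in `[0, T].
  have : (theta @` `[0, T]) (theta t) by exists t.
  by case: tc => _ ->.
have /andP[t0 t1] : 0 <= t <= T by move: tT; rewrite in_itv.
have /andP[u0 u1] : 0 <= theta t <= T by move: thT; rewrite in_itv.
rewrite /= /queue_path_fun t0 t1 u0 u1 /=.
rewrite (que _ _ k cJ hk)// (que _ _ k' cJ' hk')//.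
rewrite (eq_bigr (fun i => \1_[set u : R | (arrival J' (k' i) w' <= u%:E <
    arrival J' (k' i) w' + (service J' (k' i) w')%:E)%E] (theta t))).
  by rewrite subrr normr0; lra.
move=> i Ai; rewrite !indicE; congr (_%:R); congr (nat_of_bool _).
have [-> _] := ak i Ai; have [-> _] := ak' i Ai.
have := thE i t Ai tT.
have memE (u v v' : R) : (u \in [set u : R | (v%:E <= u%:E < v%:E + v'%:E)%E]) = (v <= u < v + v').
  by apply/idP/idP; rewrite inE/= -EFinD lee_fin lte_fin.
by rewrite !memE.
Qed.

End separation.

(** * Ergodic averages with a continuous weight *)

Section affine_substitution.
Context (R : realType) (a b : R).
Hypothesis a0 : 0 < a.
Let phi (x : measurableTypeR R) : measurableTypeR R := a * x + b.

Lemma preimage_affine_itv (b0 b1 : bool) (u v : R) :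
  phi @^-1` [set` Interval (BSide b0 u) (BSide b1 v)] =
  [set` Interval (BSide b0 ((u - b) / a)) (BSide b1 ((v - b) / a))].
Proof.
apply/seteqP; split => x /=; rewrite /phi (mulrC a) !in_itv/=;
  case: b0; case: b1; rewrite /= ?ler_pdivrMr ?ltr_pdivrMr
  ?ler_pdivlMr ?ltr_pdivlMr// ?lerBlDr ?ltrBlDr ?lerBrDr ?ltrBrDr //.
Qed.

Lemma measurable_affine : measurable_fun setT phi.
Proof. by apply: measurable_funD => //; exact: measurable_funM. Qed.

(** The push-forward of Lebesgue measure under the affine map, scaled by [a], agrees with Lebesgue
    measure on intervals, hence everywhere by uniqueness. *)
Lemma ge0_integral_affine (D : set (measurableTypeR R)) (f : R -> \bar R) :
  measurable D -> measurable_fun D f -> (forall x, D x -> (0 <= f x)%E) ->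
  (\int[lebesgue_measure]_(y in D) f y =
   a%:E * \int[lebesgue_measure]_(x in phi @^-1` D) f (a * x + b)%R)%E.
Proof.
move=> mD mf f0.
have sc A : measurable A -> lebesgue_measure A =
    mscale (NngNum (ltW a0)) (pushforward lebesgue_measure phi) A.
  apply: (@lebesgue_measure_unique R
    (mscale (NngNum (ltW a0)) (pushforward lebesgue_measure phi))).
  move=> _ [[u v] _ <-].
  rewrite [RHS](_ : _ = (a%:E * lebesgue_measure (phi @^-1` `]u, v]))%E)//.
  rewrite (preimage_affine_itv false false) !lebesgue_measure_itv/=.
  rewrite !lte_fin ltr_pM2r ?invr_gt0// ltrD2r; case: ifP => _; last by rewrite mule0.
  by rewrite -EFinD -EFinM; congr EFin; rewrite -mulrBl mulrC divfK ?gt_eqF// opprB addrA subrK.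
rewrite (eq_measure_integral (mscale (NngNum (ltW a0))
  (pushforward lebesgue_measure phi))).
- exact: measurable_affine.
- move=> mphi; rewrite ge0_integral_mscale//=; congr (_ * _)%E.
  by rewrite ge0_integral_pushforward// => x /set_mem; exact: f0.
- by move=> mphi A mA _; exact: (sc mphi).
Qed.

End affine_substitution.

Lemma bounded_integrable_itv (R : realType) (g : R -> R) (B a b : R) : 0 <= a ->
  measurable_fun (`[0, +oo[%classic : set (measurableTypeR R)) g ->
  (forall u, 0 <= u -> `|g u| <= B) ->
  (@lebesgue_measure R).-integrable `[a, b[ (EFin \o g).
Proof.
move=> a0 mg gB.
have sub : `[a, b[%classic `<=` `[0, +oo[%classic.
  by move=> u /=; rewrite !in_itv/= andbT => /andP[au _]; exact: le_trans au.
apply: measurable_bounded_integrable => //.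
- by rewrite /= lebesgue_measure_itv/=; case: ifP => _; rewrite ltry.
- exact: measurable_funS mg.
- exists B; split; first exact: num_real.
  move=> x Bx u /= uab; apply: le_trans (gB u _) (ltW Bx).
  by have := sub u uab; rewrite /= in_itv/= andbT.
Qed.

Lemma Rintegral_itv_cat (R : realType) (g : R -> R) (a p b : R) :
  a <= p -> p <= b -> (@lebesgue_measure R).-integrable `[a, b[ (EFin \o g) ->
  \int[lebesgue_measure]_(s in `[a, b[) g s =
  \int[lebesgue_measure]_(s in `[a, p[) g s + \int[lebesgue_measure]_(s in `[p, b[) g s.
Proof.
move=> ap pb ig; rewrite (@itv_bndbnd_setU _ _ _ (BLeft p)) ?bnd_simp//.
rewrite Rintegral_setU//=; first by rewrite -itv_bndbnd_setU ?bnd_simp.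
apply/disj_setPS => y [/=]; rewrite 2!in_itv/= => /andP[_ ya] /andP[].
by rewrite leNgt ya.
Qed.

Section time_average.
Context (R : realType) (f : R -> R) (K fbar : R).
Hypothesis mf : measurable_fun (`[0, +oo[%classic : set (measurableTypeR R)) f.
Hypothesis f0K : forall u, 0 <= u -> 0 <= f u <= K.
Hypothesis average : forall rho, 0 < rho -> exists A, forall t, A <= t ->
  `|t^-1 * (\int[lebesgue_measure]_(u in `[0%R, t]) f u) - fbar| <= rho.

Let f_norm u : 0 <= u -> `|f u| <= K.
Proof. by move=> /f0K /andP[f1 f2]; rewrite ger0_norm. Qed.

Lemma measurable_time_scale (e : R) : 0 < e ->
  measurable_fun (`[0, +oo[%classic : set (measurableTypeR R)) (fun s => f (s / e)).
Proof.
move=> e0; apply: (measurable_comp _ _ mf) => //.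
  move=> _ [u /= + <-]; rewrite !in_itv/= !andbT => u0.
  by rewrite divr_ge0// ltW.
by apply: measurable_funM.
Qed.

Let scale_norm (e : R) u : 0 < e -> 0 <= u -> `|f (u / e)| <= K.
Proof. by move=> e0 u0; rewrite f_norm// divr_ge0// ltW. Qed.

Lemma Rintegral_time_scale (e t : R) : 0 < e -> 0 < t ->
  \int[lebesgue_measure]_(s in `[0, t[) f (s / e) =
  t * ((t / e)^-1 * \int[lebesgue_measure]_(u in `[0%R, (t / e)]) f u).
Proof.
move=> e0 t0; rewrite {1}/Rintegral.
rewrite (@ge0_integral_affine _ e 0)//; last 2 first.
- apply/measurable_EFinP; apply: measurable_funS (measurable_time_scale e0) => //.
  by move=> u /=; rewrite !in_itv/= andbT => /andP[].
- move=> u /=; rewrite in_itv/= => /andP[u0 _]; rewrite lee_fin.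
  by case/andP: (f0K (divr_ge0 u0 (ltW e0))).
rewrite (preimage_affine_itv 0 e0 true true) !subr0 mul0r.
rewrite (@eq_integral _ (measurableTypeR R) R _ _ (EFin \o f)); last first.
  by move=> x _ /=; rewrite addr0 mulrC mulKf// gt_eqF.
have int : (@lebesgue_measure R).-integrable `[0, (t / e)[ (EFin \o f).
  exact: (bounded_integrable_itv (B := K)).
rewrite fineM//; last exact: integrable_fin_num.
rewrite -Rintegral_itv_bndo_bndc// /Rintegral/= mulrA; congr (_ * _).
by field; rewrite !gt_eqF.
Qed.

(** The averages from 0 to [a] and from 0 to [b] are each controlled up to [rho / 2] and then
    subtracted. *)
Lemma time_average_itv (a b rho : R) : 0 <= a -> a <= b -> 0 < rho ->
  \forall e \near 0^'+,
    `|\int[lebesgue_measure]_(s in `[a, b[) f (s / e) - (b - a) * fbar| <= rho.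
Proof.
have base (t r : R) : 0 <= t -> 0 < r -> \forall e \near 0^'+,
    `|\int[lebesgue_measure]_(s in `[0, t[) f (s / e) - t * fbar| <= r.
  rewrite le_eqVlt => /predU1P[<-|t0] r0.
    apply: nearW => e; rewrite set_itv_ge ?bnd_simp ?ltxx//.
    by rewrite Rintegral_set0 mul0r subrr normr0 ltW.
  have [A hA] := average (divr_gt0 r0 t0).
  have A1 : 0 < Num.max A 1 by rewrite lt_max ltr01 orbT.
  near=> e.
  have e0 : 0 < e by near: e; exact: nbhs_right_gt.
  rewrite Rintegral_time_scale// -mulrBr normrM gtr0_norm// mulrC -ler_pdivlMr//.
  apply: hA; apply: (@le_trans _ _ (Num.max A 1)); first by rewrite le_max lexx.
  rewrite ler_pdivlMr// mulrC -ler_pdivlMr//.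
  near: e; apply: nbhs_right_le; exact: divr_gt0.
move=> a0 ab rho0.
have r2 : 0 < rho / 2 by lra.
have b0 := le_trans a0 ab.
have arith (x y z : R) : z = x + y -> `|x - a * fbar| <= rho / 2 ->
    `|z - b * fbar| <= rho / 2 -> `|y - (b - a) * fbar| <= rho.
  by rewrite !ler_norml => ? /andP[? ?] /andP[? ?]; lra.
near=> e.
have e0 : 0 < e by near: e; exact: nbhs_right_gt.
have h1 : `|\int[lebesgue_measure]_(s in `[0, a[) f (s / e) - a * fbar| <= rho / 2.
  by near: e; exact: base.
have h2 : `|\int[lebesgue_measure]_(s in `[0, b[) f (s / e) - b * fbar| <= rho / 2.
  by near: e; exact: base.
apply: arith h1 h2; apply: Rintegral_itv_cat => //.
apply: (bounded_integrable_itv (B := K)) => //; first exact: measurable_time_scale.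
by move=> u; exact: scale_norm.
Unshelve. all: by end_near. Qed.

Variable lam : R -> R.
Hypothesis mlam : measurable_fun (`[0, +oo[%classic : set (measurableTypeR R)) lam.
Hypothesis lam0K : forall u, 0 <= u -> 0 <= lam u <= K.

Let lam_norm u : 0 <= u -> `|lam u| <= K.
Proof. by move=> /lam0K /andP[f1 f2]; rewrite ger0_norm. Qed.

Lemma measurable_weighted (e : R) : 0 < e ->
  measurable_fun (`[0, +oo[%classic : set (measurableTypeR R))
    (fun s => lam s * f (s / e)).
Proof. by move=> e0; apply: measurable_funM => //; exact: measurable_time_scale. Qed.

Let weighted_norm (e : R) u : 0 < e -> 0 <= u -> `|lam u * f (u / e)| <= K * K.
Proof.
by move=> e0 u0; rewrite normrM ler_pM//; [exact: lam_norm|exact: scale_norm].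
Qed.

Lemma integrable_weighted (e a b : R) : 0 < e -> 0 <= a ->
  (@lebesgue_measure R).-integrable `[a, b[ (EFin \o (fun s => lam s * f (s / e))).
Proof.
move=> e0 a0; apply: (bounded_integrable_itv (B := K * K)) => //.
  exact: measurable_weighted.
by move=> u; exact: weighted_norm.
Qed.

(* On a piece of the partition where [lam] oscillates by at most [eta], [lam]
   is replaced by its value at the left end point. *)
Lemma weighted_average_partition (a del eta rho : R) (n : nat) :
  0 <= a -> 0 < del -> 0 < eta -> 0 < rho ->
  (forall s s', a <= s <= a + n%:R * del -> a <= s' <= a + n%:R * del ->
     `|s - s'| <= del -> `|lam s - lam s'| <= eta) ->
  \forall e \near 0^'+,
    `|\int[lebesgue_measure]_(s in `[a, a + n%:R * del[) (lam s * f (s / e)) -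
      fbar * \int[lebesgue_measure]_(s in `[a, a + n%:R * del[) lam s|
    <= n%:R * del * eta * (K + `|fbar|) + rho.
Proof.
move=> a0 del0 eta0; elim: n rho => [|n ih] rho rho0 osc.
  apply: nearW => e; rewrite mul0r addr0 set_itv_ge ?bnd_simp ?ltxx//.
  by rewrite !Rintegral_set0 mulr0 subrr normr0 !mul0r add0r ltW.
have K0 : 0 <= K by have /andP[] := lam0K (lexx 0); exact: le_trans.
set p := a + n%:R * del; set q := a + n.+1%:R * del.
have pq : q = p + del by rewrite /q -natr1 mulrDl mul1r addrA.
have p0 : 0 <= p by rewrite addr_ge0// mulr_ge0// ltW.
have ap : a <= p by rewrite lerDl mulr_ge0// ltW.
have pq' : p <= q by rewrite pq lerDl ltW.
have q0 := le_trans p0 pq'.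
have rho2 : 0 < rho / 2 by lra.
have rhoK : 0 < rho / 2 / (K + 1) by rewrite divr_gt0//; lra.
have osc' s s' : a <= s <= p -> a <= s' <= p -> `|s - s'| <= del -> `|lam s - lam s'| <= eta.
  move=> /andP[s1 s2] /andP[s3 s4]; apply: osc; apply/andP; split => //.
    exact: le_trans s2 pq'.
  exact: le_trans s4 pq'.
have Ilam u v : 0 <= u -> (@lebesgue_measure R).-integrable `[u, v[ (EFin \o lam).
  by move=> u0; exact: (bounded_integrable_itv (B := K)).
have mpq : fine (lebesgue_measure `[p, q[%classic) = del.
  rewrite lebesgue_measure_itv/= lte_fin pq ltrDl del0/=; lra.
have lamp : 0 <= lam p <= K by exact: lam0K.
have close s : s \in `[p, q[ -> `|lam s - lam p| <= eta.
  rewrite in_itv/= => /andP[ps sq]; apply: osc.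
  - by rewrite (le_trans ap ps) ltW.
  - by rewrite ap.
  - by rewrite ger0_norm; lra.
have osc_int (g : R -> R) (B : R) : 0 <= B ->
    (@lebesgue_measure R).-integrable `[p, q[ (EFin \o g) ->
    (forall s, s \in `[p, q[ -> `|g s| <= B) ->
    `|\int[lebesgue_measure]_(s in `[p, q[) g s| <= B * del.
  move=> B0 ig gB; apply: le_trans (le_normr_Rintegral _ ig) _ => //.
  rewrite -mpq -Rintegral_cst//; apply: le_Rintegral => //.
  - exact: integrable_norm.
  - apply: (bounded_integrable_itv (B := B)) => // u _.
    by rewrite ger0_norm.
have h3 e : 0 < e -> `|\int[lebesgue_measure]_(s in `[p, q[) (lam s * f (s / e)) -
    lam p * \int[lebesgue_measure]_(s in `[p, q[) f (s / e)| <= eta * K * del.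
  move=> e0.
  have Isc : (@lebesgue_measure R).-integrable `[p, q[ (EFin \o (fun s => f (s / e))).
    apply: (bounded_integrable_itv (B := K)) => //; first exact: measurable_time_scale.
    by move=> u; exact: scale_norm.
  rewrite -RintegralZl// -RintegralB//; last 2 first.
  - exact: integrable_weighted.
  - rewrite (_ : EFin \o _ = fun s => ((lam p)%:E * (f (s / e))%:E)%E).
      exact: integrableZl.
    by apply/funext => s; rewrite /= EFinM.
  apply: osc_int; first by rewrite mulr_ge0// ltW.
    apply: (bounded_integrable_itv (B := K * K + K * K)) => //.
      apply: measurable_funB; first exact: measurable_weighted.
      by apply: measurable_funM => //; exact: measurable_time_scale.
    move=> u u0; apply: le_trans (ler_normB _ _) _; rewrite lerD ?weighted_norm//.
    by rewrite normrM ler_pM//; [exact: lam_norm|exact: scale_norm].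
  move=> s sI; rewrite -mulrBl normrM ler_pM//; first exact: close.
  by apply: scale_norm => //; apply: le_trans p0 _; move: sI; rewrite in_itv/= => /andP[].
have h4 : `|\int[lebesgue_measure]_(s in `[p, q[) lam s - lam p * del| <= eta * del.
  rewrite -mpq -Rintegral_cst// mpq -RintegralB//; last 2 first.
  - exact: Ilam.
  - by apply: (bounded_integrable_itv (B := `|lam p|)).
  apply: osc_int; first exact: ltW.
    apply: (bounded_integrable_itv (B := K + K)) => //.
      by apply: measurable_funB.
    move=> u u0; apply: le_trans (ler_normB _ _) _.
    by rewrite lerD ?lam_norm.
  exact: close.
have arith (A1 L1 A2 L2 F X : R) :
    `|A1 - fbar * L1| <= X + rho / 2 -> `|F - (q - p) * fbar| <= rho / 2 / (K + 1) ->
    `|A2 - lam p * F| <= eta * K * del -> `|L2 - lam p * del| <= eta * del ->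
    `|A1 + A2 - fbar * (L1 + L2)| <= X + del * eta * (K + `|fbar|) + rho.
  move=> g1 g2 g3 g4; rewrite pq (addrC p) addrK in g2.
  (* On the new piece the error splits into three: freezing [lam] at [p] under the integral with
     [f], averaging [f] alone, and freezing [lam] at [p] in its own integral. *)
  have -> : A1 + A2 - fbar * (L1 + L2) = (A1 - fbar * L1) +
      ((A2 - lam p * F) + (lam p * (F - del * fbar) + - (fbar * (L2 - lam p * del)))) by ring.
  have g5 : `|lam p * (F - del * fbar)| <= rho / 2.
    rewrite normrM (ger0_norm (proj1 (andP lamp))).
    have : lam p * `|F - del * fbar| <= K * (rho / 2 / (K + 1)).
      by apply: ler_pM => //; case/andP: lamp.
    move=> /le_trans; apply; rewrite mulrCA ler_piMr//; first lra.
    by rewrite ler_pdivrMr; lra.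
  have g6 : `|fbar * (L2 - lam p * del)| <= `|fbar| * (eta * del).
    by rewrite normrM ler_wpM2l.
  apply: le_trans (ler_normD _ _) _.
  have := ler_normD (A2 - lam p * F) (lam p * (F - del * fbar) + - (fbar * (L2 - lam p * del))).
  have := ler_normD (lam p * (F - del * fbar)) (- (fbar * (L2 - lam p * del))).
  rewrite [`|- _|]normrN.
  have -> : del * eta * (K + `|fbar|) = eta * K * del + `|fbar| * (eta * del) by ring.
  by lra.
near=> e.
have e0 : 0 < e by near: e; exact: nbhs_right_gt.
have h1 : `|\int[lebesgue_measure]_(s in `[a, p[) (lam s * f (s / e)) -
      fbar * \int[lebesgue_measure]_(s in `[a, p[) lam s|
    <= n%:R * del * eta * (K + `|fbar|) + rho / 2.
  by near: e; exact: ih.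
have h2 : `|\int[lebesgue_measure]_(s in `[p, q[) f (s / e) - (q - p) * fbar| <=
    rho / 2 / (K + 1).
  by near: e; exact: time_average_itv.
rewrite (Rintegral_itv_cat ap pq' (integrable_weighted q e0 a0)).
rewrite (Rintegral_itv_cat ap pq' (Ilam a q a0)).
have := arith _ _ _ _ _ _ h1 h2 (h3 e e0) h4.
by rewrite -natr1 !mulrDl !mul1r.
Unshelve. all: by end_near. Qed.

End time_average.

(** Heine's theorem, through the near-covering form of compactness. *)
Lemma uniform_continuity_itv (R : realType) (lam : R -> R) (a b eta : R) :
  {within `[a, b]%classic, continuous lam} -> 0 < eta ->
  exists2 del, 0 < del & forall s s', a <= s <= b -> a <= s' <= b ->
    `|s - s'| <= del -> `|lam s - lam s'| <= eta.
Proof.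
move=> /subspace_continuousP cl eta0.
pose P (del : R) (s : R) := a <= s <= b -> forall s', a <= s' <= b ->
  `|s - s'| <= del -> `|lam s - lam s'| <= eta.
have : \forall del \near 0^'+, `[a, b]%classic `<=` P del.
  apply: (proj1 (compact_near_coveringP _) (@segment_compact R a b)).
  move=> x xab.
  have /cvgrPdist_lt/(_ (eta / 2)) := cl x xab.
  move=> /(_ (divr_gt0 eta0 (ltr0n _ 2)))[r /= r0 hr].
  have {}hr s : a <= s <= b -> `|x - s| < r -> `|lam x - lam s| < eta / 2.
    by move=> sab xs; apply: hr => //=; rewrite in_itv.
  near=> s del => sab s' sab' ss'.
  have xs : `|x - s| < r / 2 by near: s; apply: cvgr_dist_lt => //; exact: divr_gt0.
  have dr : del < r / 2 by near: del; apply: nbhs_right_lt; exact: divr_gt0.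
  have : `|x - s| < r /\ `|x - s'| < r.
    split; first by apply: lt_trans xs _; rewrite ltr_pdivrMr// ltr_pMr// ltr1n.
    apply: le_lt_trans (ler_distD s _ _) _; rewrite [r]splitr ltrD//.
    exact: le_lt_trans dr.
  move=> [/(hr _ sab) h1 /(hr _ sab') h2].
  apply: le_trans (ler_distD (lam x) _ _) _; rewrite [eta]splitr lerD//.
    by rewrite distrC ltW.
  exact: ltW.
move=> near_del.
have [del [del0 hd]] : exists del, 0 < del /\ `[a, b]%classic `<=` P del.
  suff : \forall del \near 0^'+, 0 < del /\ `[a, b]%classic `<=` P del.
    by move=> /filter_ex.
  near=> del; split; first by near: del; exact: nbhs_right_gt.
  by near: del.
by exists del => // s s' sab; apply: hd => //=; rewrite in_itv.
Unshelve. all: by end_near. Qed.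

Section weighted_average.
Context (R : realType) (f lam : R -> R) (K fbar : R).
Hypothesis mf : measurable_fun (`[0, +oo[%classic : set (measurableTypeR R)) f.
Hypothesis f0K : forall u, 0 <= u -> 0 <= f u <= K.
Hypothesis average : forall rho, 0 < rho -> exists A, forall t, A <= t ->
  `|t^-1 * (\int[lebesgue_measure]_(u in `[0%R, t]) f u) - fbar| <= rho.
Hypothesis clam : {within `[0, +oo[%classic, continuous lam}.
Hypothesis lam0K : forall u, 0 <= u -> 0 <= lam u <= K.

Lemma weighted_average (a b : R) : 0 <= a -> a < b ->
  \int[lebesgue_measure]_(s in `[a, b[) (lam s * f (s / e)) @[e --> 0^'+] -->
  fbar * \int[lebesgue_measure]_(s in `[a, b[) lam s.
Proof.
move=> a0 ab.
have mlam : measurable_fun (`[0, +oo[%classic : set (measurableTypeR R)) lam.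
  exact: subspace_continuous_measurable_fun.
have K0 : 0 <= K by have /andP[] := lam0K (lexx 0); exact: le_trans.
have cab : {within `[a, b]%classic, continuous lam}.
  apply: continuous_subspaceW clam => u /=; rewrite !in_itv/= andbT => /andP[au _].
  exact: le_trans au.
apply/cvgrPdist_le => rho rho0.
have C0 : 0 < (b - a) * (K + `|fbar| + 1).
  by rewrite mulr_gt0 ?subr_gt0// ltr_wpDl// addr_ge0.
have rho2 : 0 < rho / 2 by rewrite divr_gt0.
(* Chosen so that the oscillation error [(b - a) * eta * (K + |fbar|)] is at most [rho / 2]; the
   summand 1 keeps the denominator positive. *)
pose eta := rho / 2 / ((b - a) * (K + `|fbar| + 1)).
have eta0 : 0 < eta by rewrite divr_gt0.
have [del del0 osc] := uniform_continuity_itv cab eta0.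
pose n := (Num.truncn ((b - a) / del)).+1.
pose del' := (b - a) / n%:R.
have del'0 : 0 < del' by rewrite divr_gt0 ?subr_gt0.
have nd : n%:R * del' = b - a by rewrite mulrC divfK// pnatr_eq0.
have dd : del' <= del.
  rewrite ler_pdivrMr// mulrC -ler_pdivrMr//.
  have ba0 : 0 < b - a by rewrite subr_gt0.
  by have /andP[_ /ltW] := truncn_itv (divr_ge0 (ltW ba0) (ltW del0)).
have osc' s s' : a <= s <= a + n%:R * del' -> a <= s' <= a + n%:R * del' ->
     `|s - s'| <= del' -> `|lam s - lam s'| <= eta.
  by rewrite nd addrC subrK => sab sab' ss'; apply: osc => //; exact: le_trans dd.
have := weighted_average_partition mf f0K average mlam lam0K a0 del'0 eta0 rho2 osc'.
rewrite nd (addrC a) subrK => hn.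
have bnd : (b - a) * eta * (K + `|fbar|) + rho / 2 <= rho.
  rewrite [leRHS]splitr lerD2r /eta.
  have -> : (b - a) * (rho / 2 / ((b - a) * (K + `|fbar| + 1))) * (K + `|fbar|) =
    (rho / 2) * ((K + `|fbar|) / (K + `|fbar| + 1)).
    have c0 : K + `|fbar| + 1 != 0 by rewrite gt_eqF// ltr_wpDl// addr_ge0.
    have ba0 : b - a != 0 by rewrite gt_eqF// subr_gt0.
    by field; rewrite c0 ba0.
  rewrite ler_piMr//; first exact: ltW.
  rewrite ler_pdivrMr ?mul1r ?lerDl//.
  by rewrite ltr_wpDl// addr_ge0.
near=> e; rewrite distrC; apply: le_trans bnd.
by near: e.
Unshelve. all: by end_near. Qed.

End weighted_average.

(** * Probabilities of classes *)

(** At parameter 0 the distribution is a Dirac mass by definition; it obeys the same formula because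
    [0 ^+ 0 = 1]. *)
Lemma poisson_prob1 (R : realType) (x : R) k : 0 <= x ->
  fine (poisson_prob x 0 [set k]) = x ^+ k / k`!%:R * expR (- x).
Proof.
rewrite le_eqVlt => /predU1P[<-|x0].
  rewrite /poisson_prob ltxx diracE oppr0 expR0 mulr1.
  case: k => [|k]; first by rewrite mem_set//= expr0 fact0 divr1.
  by rewrite memNset//= expr0n mul0r.
by rewrite /poisson_prob x0 esum_set1 ?lee_fin ?poisson_pmf_ge0//= /poisson_pmf x0.
Qed.

Lemma card_I0P T (A : set T) : (A #= `I_0)%card <-> A = set0.
Proof.
rewrite II0 card_eq0; split => [/eqP//|->//].
Qed.

Lemma card_I1P T (A : set T) : (A #= `I_1)%card <-> exists x, A = [set x].
Proof.
split => [/eq_cardSP[x Ax]|[x ->]]; last exact: card_set1.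
move=> /card_I0P/seteqP[+ _] => Ax0; exists x; apply/seteqP; split => [y Ay|_ ->//].
by apply: contrapT => yx; exact: (Ax0 y).
Qed.

Lemma measurable_fin_forall d (T : measurableType d) (I : finType)
    (P : I -> T -> Prop) :
  (forall i, measurable [set w | P i w]) -> measurable [set w | forall i, P i w].
Proof.
move=> mP; rewrite (_ : [set w | _] = \bigcap_(i in [set: I]) [set w | P i w]).
  by apply: fin_bigcap_measurable.
by apply/seteqP; split => [w Pw i _|w Pw i]; exact: Pw.
Qed.

Section counting_measurability.
Context d (T : measurableType d).
Variable hits : T -> set nat.
Hypothesis mhits : forall k, measurable [set w | hits w k].

Lemma measurable_hits0 : measurable [set w | hits w = set0].
Proof.
rewrite (_ : [set w | _] = \bigcap_k ~` [set w | hits w k]).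
  by apply: bigcapT_measurable => k; exact: measurableC.
apply/seteqP; split => [w /= hw k _ /=|w /= hw]; first by rewrite hw.
by rewrite -subset0 => k hk; exact: (hw k I).
Qed.

Lemma measurable_hits1 k : measurable [set w | hits w = [set k]].
Proof.
rewrite (_ : [set w | _] = [set w | hits w k] `&`
    \bigcap_(l in [set l | l != k]) ~` [set w | hits w l]).
  apply: measurableI => //; apply: bigcap_measurableType => l _.
  exact: measurableC.
apply/seteqP; split => [w /= hw|w [/= hk hw]].
  by rewrite hw; split => // l /= /eqP lk; rewrite hw.
apply/seteqP; split => [l hl /=|_ -> //].
by apply: contrapT => /eqP lk; exact: (hw l lk).
Qed.

Lemma measurable_hits_card1 : measurable [set w | exists k, hits w = [set k]].
Proof.
rewrite (_ : [set w | _] = \bigcup_k [set w | hits w = [set k]]).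
  by apply: bigcupT_measurable => k; exact: measurable_hits1.
by apply/seteqP; split => [w [k hk]|w [k _ hk]]; exists k.
Qed.

End counting_measurability.

Section jobs_measurability.
Context d (Omega : measurableType d) (R : realType) (J : jobs Omega R).

Lemma arrival_hitE (B : set R) k :
  [set w | arrival_hits J B w k] = arrival J k @^-1` (EFin @` B).
Proof.
by apply/seteqP; split => [w [s ws Bs]|w [s Bs ws]]; [exists s|exists s].
Qed.

Lemma measurable_arrival_hit (B : set (measurableTypeR R)) k :
  measurable B -> measurable [set w | arrival_hits J B w k].
Proof.
move=> mB; rewrite arrival_hitE -[X in measurable X]setTI.
exact: measurable_arrival (measurable_image_EFin mB).
Qed.

(* As a measurable type, so that the closure lemmas for [measurable] apply. *)
Definition arrival_algebra := g_sigma_algebraType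
  (\bigcup_(k in [set: nat]) preimage_set_system setT (arrival J k) measurable).

Lemma arrival_algebra_hit (B : set (measurableTypeR R)) k :
  measurable B -> measurable ([set w | arrival_hits J B w k] : set arrival_algebra).
Proof.
move=> mB; apply: sub_sigma_algebra; exists k => //; exists (EFin @` B).
  exact: measurable_image_EFin.
by rewrite setTI arrival_hitE.
Qed.

Lemma measurable_service_in (B : set (measurableTypeR R)) k :
  measurable B -> measurable [set w | B (service J k w)].
Proof.
move=> mB; rewrite -[X in measurable X]setTI.
exact: measurable_service.
Qed.

Lemma measurable_job_hit (B : set (measurableTypeR R * measurableTypeR R)) k :
  measurable B -> measurable [set w | job_hits J B w k].
Proof.
move=> mB; pose g w := (fine (arrival J k w), service J k w).
rewrite (_ : [set w | _] = (arrival J k @^-1` (EFin @` [set: R])) `&` (g @^-1` B)).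
  apply: measurableI; rewrite -[X in measurable X]setTI.
    exact: (measurable_arrival J k measurableT (measurable_image_EFin measurableT)).
  have mg : measurable_fun setT g.
    apply: measurable_fun_pair; last exact: measurable_service.
    by apply: measurableT_comp => //; exact: measurable_arrival.
  exact: (mg measurableT _ mB).
apply/seteqP; split => [w [s ws Bs]|w [[s _ ws] /=]].
  by split; [exists s|rewrite /g /= ws].
by rewrite /g -ws /= => Bs; exists s.
Qed.

Variables (h delta : R) (m M : nat).

Lemma measurable_arrival_cell i : measurable (arrival_cell h i : set (measurableTypeR R)).
Proof. exact: measurable_itv. Qed.

Lemma measurable_service_cell j :
  measurable (service_cell delta M j : set (measurableTypeR R)).
Proof. by rewrite /service_cell; case: j => [|j]; [|case: ifP]. Qed.

Lemma measurable_in_class (c : {ffun 'I_m -> option 'I_M.+2}) :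
  measurable (in_class h delta J c).
Proof.
have hit (i : 'I_m) k : measurable [set w | arrival_hits J (arrival_cell h i) w k].
  by apply: measurable_arrival_hit; exact: measurable_arrival_cell.
apply: measurable_fin_forall => i; case: (c i) => [j|]; last exact: measurable_hits0.
rewrite (_ : [set w | _] = \bigcup_k ([set w | arrival_hits J (arrival_cell h i) w = [set k]] `&`
   [set w | service_cell delta M j (service J k w)])).
  apply: bigcupT_measurable => k; apply: measurableI; first exact: measurable_hits1.
  by apply: measurable_service_in; exact: measurable_service_cell.
by apply/seteqP; split => [w [k h1 h2]|w [k _ [h1 h2]]]; exists k.
Qed.

(** The bound on the indices matters: every index above [M] denotes the same tail cell. *)
Lemma service_cell_inj (delta_gt0 : 0 < delta) (j j' : 'I_M.+2) r :
  service_cell delta M j r -> service_cell delta M j' r -> j = j'.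
Proof.
have pos (i : nat) : 0 <= i%:R * delta by rewrite mulr_ge0// ltW.
have lt (i i' : nat) : i%:R * delta < i'%:R * delta -> (i < i')%N.
  by rewrite ltr_pM2r// ltr_nat.
case: j j' => [[|j] jM] [[|j'] jM'] /=.
- by move=> *; exact/val_inj.
- rewrite in_itv/= => r0; case: ifP => _ /=; rewrite in_itv/= ?andbT.
    by move=> /andP[r1 _]; have p0 := pos j'; exfalso; lra.
  by move=> r1; have p0 := pos M; exfalso; lra.
- case: ifP => _ /=; rewrite !in_itv/= ?andbT.
    by move=> /andP[r1 _] r0; have p0 := pos j; exfalso; lra.
  by move=> r1 r0; have p0 := pos M; exfalso; lra.
case: ifP => jm; case: ifP => jm' /=; rewrite !in_itv/= ?andbT.
- move=> /andP[r1 r2] /andP[r1' r2']; apply/val_inj => /=; congr S.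
  have := lt _ _ (lt_le_trans r1 r2'); have := lt _ _ (lt_le_trans r1' r2).
  by rewrite !ltnS => h1 h2; apply/eqP; rewrite eqn_leq h1 h2.
- move=> /andP[r1 r2] r1'; have := lt _ _ (lt_le_trans r1' r2).
  by rewrite ltnS leqNgt jm.
- move=> r1' /andP[r1 r2]; have := lt _ _ (lt_le_trans r1' r2).
  by rewrite ltnS leqNgt jm'.
- move=> _ _; apply/val_inj => /=; congr S; apply/eqP; rewrite eqn_leq.
  move: (jM) (jM'); rewrite !ltnS => j1 j2.
  by rewrite (leq_trans j1) ?(leq_trans j2)// leqNgt ?jm ?jm'.
Qed.

Lemma service_cell_cover (delta_gt0 : 0 < delta) r :
  exists j : 'I_M.+2, service_cell delta M j r.
Proof.
have [r0|r0] := leP r 0; first by exists ord0; rewrite /= in_itv.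
have [rM|rM] := ltP (M%:R * delta) r.
  by exists ord_max; rewrite /= ltnn /= in_itv/= rM.
have ex : exists n : nat, r <= n.+1%:R * delta.
  have /andP[_ /ltW t] := truncn_itv (divr_ge0 (ltW r0) (ltW delta_gt0)).
  by exists (Num.truncn (r / delta)); rewrite -ler_pdivrMr.
case: (ex_minnP ex) => n rn nmin.
have nM : (n < M)%N.
  rewrite ltnNge; apply/negP => Mn.
  case: M rM Mn => [|M']; first by rewrite mul0r; lra.
  by move=> rM' M'n; have := nmin _ rM'; rewrite leqNgt M'n.
have nM2 : (n.+1 < M.+2)%N by rewrite ltnS ltnW// ltnS.
exists (Ordinal nM2); rewrite /= nM /= in_itv/= rn andbT ltNge; apply/negP => rn'.
case: n rn nmin nM nM2 rn' => [|n] rn nmin nM nM2 rn'; first by move: rn'; rewrite mul0r; lra.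
by have := nmin n rn'; rewrite ltnn.
Qed.

Lemma trivIset_in_class : 0 < h -> 0 < delta ->
  trivIset setT (fun c : {ffun 'I_m -> option 'I_M.+2} => in_class h delta J c).
Proof.
move=> h0 d0 c c' _ _ [w [wc wc']]; apply/ffunP => i.
have := wc i; have := wc' i.
have ne (k : nat) : [set k] <> set0 by move=> /seteqP[+ _] => /(_ k); exact.
case: (c i) => [j|]; case: (c' i) => [j'|] //.
- move=> [k' -> s'] [k kk s]; congr Some.
  have kk' : k' = k by have : [set k'] k' by []; rewrite kk.
  by apply: service_cell_inj d0 _ _ _ s _; rewrite -kk'.
- by move=> -> [k /esym/ne].
- by move=> [k -> _] /ne.
Qed.

End jobs_measurability.

Section class_probability_bound.
Context d (Omega : measurableType d) (R : realType) (Q : probability Omega R).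
Variables (J : jobs Omega R) (nu : R.-pker (measurableTypeR R) ~> (measurableTypeR R)).
Variables (h delta : R) (m M : nat) (c : {ffun 'I_m -> option 'I_M.+2}).
Variable v : 'I_m -> 'I_M.+2 -> R.
Hypothesis h_gt0 : 0 < h.
Hypothesis services : independent_services Q J nu.
Hypothesis v_ge0 : forall i j, 0 <= v i j.
Hypothesis v_le : forall (i : 'I_m) (j : 'I_M.+2) s, arrival_cell h i s ->
  v i j <= fine (nu s (service_cell delta M j)).

Let weight : R := \prod_i (if c i is Some j then v i j else 1).

Let weight_ge0 : 0 <= weight.
Proof. by apply: prodr_ge0 => i _; case: (c i). Qed.

Implicit Types kappa : {ffun 'I_m -> nat}.

(** Fixes the job index in each occupied cell. This event depends on the arrivals only and makes the
    relevant indices deterministic, as the independence of the services demands. *)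
Let labelled kappa : set Omega :=
  [set w | forall i : 'I_m, arrival_hits J (arrival_cell h i) w =
     if c i is Some _ then [set kappa i] else set0].

Let served kappa : set Omega :=
  [set w | forall i : 'I_m, if c i is Some j then
     service_cell delta M j (service J (kappa i) w) else True].

Let measurable_labelled kappa : measurable (labelled kappa).
Proof.
apply: measurable_fin_forall => i.
have hit k : measurable [set w | arrival_hits J (arrival_cell h i) w k].
  by apply: measurable_arrival_hit; exact: measurable_arrival_cell.
by case: (c i) => [j|]; [exact: measurable_hits1|exact: measurable_hits0].
Qed.

Let arrival_labelled kappa :
  sigma_generated setT (arrival J) (labelled kappa).
Proof.
apply: (@measurable_fin_forall _ (arrival_algebra J)) => i.
have hit k : measurable
    ([set w | arrival_hits J (arrival_cell h i) w k] : set (arrival_algebra J)).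
  by apply: arrival_algebra_hit; exact: measurable_arrival_cell.
by case: (c i) => [j|]; [exact: measurable_hits1|exact: measurable_hits0].
Qed.

Let measurable_served kappa : measurable (served kappa).
Proof.
apply: measurable_fin_forall => i; case: (c i) => [j|].
  by apply: measurable_service_in; exact: measurable_service_cell.
rewrite (_ : [set _ | _] = setT); first exact: measurableT.
by apply/seteqP; split.
Qed.

(** The arrival cells are disjoint, so the labels of occupied cells are distinct and the product
    formula for the services applies. On the labelled event each factor is at least [v], uniformly
    over the position of the arrival in its cell. *)
Let labelled_served kappa :
  (weight%:E * Q (labelled kappa) <= Q (labelled kappa `&` served kappa))%E.
Proof.
have [->|/set0P[w0 w0k]] := eqVneq (labelled kappa) set0.
  by rewrite set0I measure0 mule0.
have arr i w : labelled kappa w -> c i != None ->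
    exists2 s, arrival J (kappa i) w = s%:E & arrival_cell h i s.
  move=> wk ci; have : [set kappa i] (kappa i) by [].
  by have := wk i; case: (c i) ci => // j _ <-.
have inj i i' : c i != None -> c i' != None -> kappa i = kappa i' -> i = i'.
  move=> ci ci' ii'.
  have [s ws si] := arr i w0 w0k ci; have [s' ws' si'] := arr i' w0 w0k ci'.
  move: ws; rewrite ii' ws' => -[ss]; apply/val_inj.
  by rewrite -ss in si; exact: arrival_cell_inj si si'.
pose s := [seq kappa i | i <- enum [pred i | c i != None]].
(* A set is needed for every index: it is the prescribed service cell at the label of an occupied
   cell and the whole line at indices that label none. *)
pose B k : set (measurableTypeR R) := [set r | forall i : 'I_m,
  if c i is Some j then kappa i = k -> service_cell delta M j r else True].
have us : uniq s.
  rewrite map_inj_in_uniq ?enum_uniq// => i i'.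
  by rewrite !mem_enum => ci ci'; exact: inj.
have BE i j : c i = Some j -> B (kappa i) = service_cell delta M j.
  move=> ci; apply/seteqP; split => [r /(_ i)|r rj i'].
    by rewrite ci; exact.
  case ci' : (c i') => [j'|//] ii'.
  have e : i' = i by apply: inj; rewrite ?ci ?ci'.
  by move: ci'; rewrite e ci => -[<-].
have mB k : measurable (B k).
  apply: measurable_fin_forall => i; case: (c i) => [j|].
    have [ik|ik] := pselect (kappa i = k).
      rewrite (_ : [set _ | _] = service_cell delta M j).
        exact: measurable_service_cell.
      by apply/seteqP; split => r //=; exact.
    rewrite (_ : [set _ | _] = setT); first exact: measurableT.
    by apply/seteqP; split => // r _ /ik.
  rewrite (_ : [set _ | _] = setT); first exact: measurableT.
  by apply/seteqP; split.
have fin_arr w k : labelled kappa w -> k \in s -> (arrival J k w < +oo)%E.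
  move=> wk /mapP[i]; rewrite mem_enum => ci ->.
  by have [t -> _] := arr i w wk ci; rewrite ltry.
have := services us mB (arrival_labelled kappa) fin_arr.
have -> : [set w | forall k, k \in s -> B k (service J k w)] = served kappa.
  apply/seteqP; split => [w sw i|w sw k /mapP[i]].
    case ci : (c i) => [j|//]; rewrite -(BE i j ci); apply: sw.
    by apply/mapP; exists i => //; rewrite mem_enum inE ci.
  rewrite mem_enum inE => ci ->.
  by have := sw i; case ci' : (c i) ci => [j|//] _; rewrite (BE i j ci').
move=> ->; rewrite -integral_cst//=.
apply: le_integral_total => w wk; rewrite lee_fin /weight.
rewrite big_map big_enum_cond/= [leLHS](bigID (fun i => c i != None))/=.
rewrite [X in _ * X <= _]big1 ?mulr1; last by move=> i; case: (c i).
rewrite [leRHS](eq_bigl (fun i => c i != None)); last by move=> i; rewrite inE andbT.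
apply: ler_prod => i; case ci : (c i) => [j|//] _.
rewrite v_ge0 (BE i j ci)/=.
have [|t -> tc] := arr i w wk; first by rewrite ci.
exact: v_le.
Qed.

(** The bound for a fixed labelling carries the same factor whatever the labels, so it can be summed
    over the countably many labellings of the occupied cells. *)
Lemma in_class_ge :
  weight * fine (Q [set w | forall i : 'I_m, (arrival_hits J (arrival_cell h i) w
    #= `I_(c i != None))%card]) <= fine (Q (in_class h delta J c)).
Proof.
(* Labels of empty cells carry no information; forcing them to be 0 makes the events of different
   labellings disjoint. Labellings are enumerated by their codes, and a number that codes none gives
   the empty set. *)
pose supported kappa := [forall i, (c i == None) ==> (kappa i == 0%N)].
pose F n : set Omega := if @pickle_inv {ffun 'I_m -> nat} n is Some kappa then
  if supported kappa then labelled kappa else set0 else set0.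
have FP n w : F n w -> exists kappa, [/\ @pickle_inv {ffun 'I_m -> nat} n = Some kappa,
    supported kappa & labelled kappa w].
  rewrite /F; case: (pickle_inv n) => [kappa|//]; case: ifP => // sk wk.
  by exists kappa.
have mF n : measurable (F n).
  by rewrite /F; case: (pickle_inv n) => [kappa|//]; case: ifP.
have tF : trivIset setT F.
  move=> n n' _ _ [w [/FP[k [nk sk wk]] /FP[k' [nk' sk' wk']]]].
  suff kk' : k = k'.
    have := @pickle_invK {ffun 'I_m -> nat} n; have := @pickle_invK {ffun 'I_m -> nat} n'.
    by rewrite nk nk' /= kk' => -> ->.
  apply/ffunP => i; have := wk i; have := wk' i.
  have := forallP sk i; have := forallP sk' i.
  case: (c i) => [j|/= /eqP-> /eqP-> //] _ _ -> /seteqP[+ _].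
  by move=> /(_ (k' i)) ->.
set G := [set w | _].
have GE : G = \bigcup_n F n.
  apply/seteqP; split => [w Gw|w [n _ /FP[k [nk sk wk]]] i]; last first.
    rewrite wk; case: (c i) => [j|]; first by apply/card_I1P; exists (k i).
    exact/card_I0P.
  have /choice[k kP] : forall i : 'I_m, exists k : nat,
      (c i = None -> k = 0%N) /\ arrival_hits J (arrival_cell h i) w =
      (if c i is Some _ then [set k] else set0).
    move=> i; have := Gw i; case: (c i) => [j /= /card_I1P[k ?]|/= /card_I0P ?].
      by exists k.
    by exists 0%N.
  exists (pickle (finfun k)) => //; rewrite /F pickleK_inv ifT//.
    by move=> i /=; rewrite ffunE; have [] := kP i.
  apply/forallP => i; apply/implyP => /eqP ci.
  by rewrite ffunE; have [->] := kP i.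
have mG : measurable G by rewrite GE; exact: bigcupT_measurable.
have mE := measurable_in_class J h delta c.
rewrite -lee_fin EFinM !fineK ?fin_num_measure//.
apply: (@le_trans _ _ (Q (\bigcup_n (F n `&` in_class h delta J c)))); last first.
  apply: le_measure; rewrite ?inE//.
    by apply: bigcupT_measurable => n; exact: measurableI.
  by move=> w [n _ []].
rewrite GE measure_semi_bigcup//; last exact: bigcupT_measurable.
rewrite [leRHS]measure_semi_bigcup//; last 3 first.
- by move=> n; exact: measurableI.
- by apply: trivIset_setIr.
- by apply: bigcupT_measurable => n; exact: measurableI.
rewrite -nneseriesZl//; apply: lee_nneseries => n _.
  by rewrite mule_ge0// lee_fin.
rewrite {1 2}/F; case: (pickle_inv n) => [k|]; last by rewrite measure0 mule0.
case: ifP => _; last by rewrite measure0 mule0.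
apply: le_trans (labelled_served k) _.
apply: le_measure; rewrite ?inE; [exact: measurableI|exact: measurableI|].
move=> w [wk sw]; split => // i; have := wk i; have := sw i.
by case: (c i) => [j|//] h1 h2; exists (k i).
Qed.

End class_probability_bound.

Lemma poisson_points_fin d (Omega : measurableType d) (R : realType)
    (Q : probability Omega R) d' (E : measurableType d')
    (hits : set E -> Omega -> set nat) (mu : set E -> \bar R)
    (I : finType) (B : I -> set E) (n : I -> nat) :
  poisson_points Q hits mu -> (forall i, measurable (B i)) -> trivIset setT B ->
  (forall i, (mu (B i) < +oo)%E) ->
  Q [set w | forall i, (hits (B i) w #= `I_(n i))%card] =
  (\prod_i fine (poisson_prob (fine (mu (B i))) 0 [set n i]))%:E.
Proof.
move=> hp mB tB fB.
have -> : [set w | forall i, (hits (B i) w #= `I_(n i))%card] =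
    [set w | forall k : 'I_#|I|,
      (hits ((B \o enum_val) k) w #= `I_((n \o enum_val) k))%card].
  apply/seteqP; split => [w hw k|w hw i]; first exact: hw.
  by rewrite -(enum_rankK i); exact: hw.
rewrite hp//.
- congr EFin; rewrite [RHS](reindex (@enum_val I predT))//=.
  by exists enum_rank => i _; [exact: enum_valK|exact: enum_rankK].
- by move=> k; exact: mB.
- by move=> k k' _ _ kk'; apply: enum_val_inj; exact: tB.
- by move=> k; exact: fB.
Qed.

Lemma trivIset_arrival_cell (R : realType) (h : R) (m : nat) : 0 < h ->
  trivIset setT (fun i : 'I_m => arrival_cell h i).
Proof.
by move=> h0 i i' _ _ [s [si si']]; apply/val_inj; exact: arrival_cell_inj si si'.
Qed.

Section arrival_counts.
Context d (Omega : measurableType d) (R : realType) (Q : probability Omega R).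
Variables (J : jobs Omega R) (inten : R -> R) (h : R) (m : nat).
Hypothesis h_gt0 : 0 < h.
Hypothesis pois : poisson_arrivals Q J inten.
Hypothesis inten_ge0 : forall s, 0 <= s -> 0 <= inten s.
Hypothesis inten_int : forall i : nat,
  (@lebesgue_measure R).-integrable (arrival_cell h i) (EFin \o inten).

Lemma arrival_counts (n : 'I_m -> bool) :
  fine (Q [set w | forall i : 'I_m,
    (arrival_hits J (arrival_cell h i) w #= `I_(n i))%card]) =
  \prod_(i < m) (let x := \int[lebesgue_measure]_(s in arrival_cell h i) inten s in
    expR (- x) * (if n i then x else 1)).
Proof.
have cellI i : arrival_cell h i `&` `[0, +oo[%classic = arrival_cell h i.
  apply/setIidPl => s; rewrite /arrival_cell /= !in_itv/= andbT => /andP[si _].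
  by apply: le_trans si; rewrite mulr_ge0// ltW.
rewrite (poisson_points_fin _ (E := measurableTypeR R) pois)//=.
- apply: eq_bigr => i _; rewrite cellI -/(Rintegral _ _ _) poisson_prob1.
    rewrite mulrC; congr (_ * _).
    by case: (n i); rewrite /= ?expr1 ?expr0 ?factS ?fact0 divr1.
  apply: Rintegral_ge0 => s; rewrite /arrival_cell /= in_itv/= => /andP[si _].
  by apply: inten_ge0; apply: le_trans si; rewrite mulr_ge0// ltW.
- by move=> i; exact: measurable_arrival_cell.
- exact: trivIset_arrival_cell.
- move=> i; rewrite cellI; have := integrable_fin_num _ (inten_int i).
  by move=> /(_ (measurable_arrival_cell _ _)); rewrite fin_numElt => /andP[].
Qed.

End arrival_counts.

(** Telescoping: factors are exchanged one at a time while the others stay in [[0, 1]]. *)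
Lemma ler_prod_diff (R : realDomainType) (I : finType) (a b : I -> R) :
  (forall i, 0 <= b i <= a i) -> (forall i, a i <= 1) ->
  \prod_i a i - \prod_i b i <= \sum_i (a i - b i).
Proof.
move=> ba a1.
suff : forall s : seq I, [/\ 0 <= \prod_(i <- s) b i, \prod_(i <- s) b i <= 1 &
    \prod_(i <- s) a i - \prod_(i <- s) b i <= \sum_(i <- s) (a i - b i)].
  by move=> /(_ (index_enum I))[].
elim => [|i s [p0 p1 ih]]; first by rewrite !big_nil subrr; split; rewrite ?ler01.
rewrite !big_cons; have /andP[b0 bai] := ba i; have ai := a1 i; split.
- exact: mulr_ge0.
- by rewrite mulr_ile1//; exact: le_trans ai.
have -> : a i * \prod_(j <- s) a j - b i * \prod_(j <- s) b j =
  a i * (\prod_(j <- s) a j - \prod_(j <- s) b j) + (a i - b i) * \prod_(j <- s) b j.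
  by rewrite mulrBr mulrBl addrA subrK.
rewrite addrC lerD//; first by rewrite ler_piMr// subr_ge0.
have a0 : 0 <= a i by exact: le_trans bai.
have [d0|d0] := leP 0 (\prod_(j <- s) a j - \prod_(j <- s) b j).
  by apply: le_trans ih; rewrite ler_piMl.
apply: (@le_trans _ _ 0); first by rewrite mulr_ge0_le0// ltW.
by apply: sumr_ge0 => j _; rewrite subr_ge0; case/andP: (ba j).
Qed.

Lemma big_option (R : realDomainType) (J : finType) (F : option J -> R) :
  \sum_(o : option J) F o = F None + \sum_j F (Some j).
Proof.
rewrite (bigD1 None)//=; congr (_ + _).
rewrite (reindex_omap Some id)/=; last by case.
by apply: eq_bigl => j; rewrite eqxx.
Qed.

(* Summing over all classes turns the error between the two product weights
   into a difference of products of masses (one per arrival cell). *)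
Lemma class_weights_diff (R : realType) (I J : finType) (L : I -> R)
    (mu v : I -> J -> R) :
  (forall i, 0 <= L i) -> (forall i j, 0 <= v i j) ->
  (forall i j, L i * v i j <= mu i j) -> (forall i, \sum_j mu i j = L i) ->
  \sum_(c : {ffun I -> option J})
    (\prod_i (expR (- L i) * (if c i is Some j then mu i j else 1)) -
     \prod_i (expR (- L i) * (if c i is Some j then L i * v i j else 1)))
  <= \sum_i \sum_j (mu i j - L i * v i j).
Proof.
move=> L0 v0 vmu muL; rewrite sumrB.
pose F (g : I -> J -> R) i (o : option J) :=
  expR (- L i) * (if o is Some j then g i j else 1).
have distr (g : I -> J -> R) : \sum_(c : {ffun I -> option J}) \prod_i F g i (c i) =
    \prod_i (expR (- L i) * (1 + \sum_j g i j)).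
  rewrite -bigA_distr_bigA; apply: eq_bigr => i _.
  by rewrite -mulr_sumr big_option.
rewrite (distr mu) (distr (fun i j => L i * v i j)).
apply: le_trans (ler_prod_diff _ _) _.
- move=> i; rewrite mulr_ge0 ?expR_ge0//=; last first.
    by rewrite addr_ge0// sumr_ge0// => j _; rewrite mulr_ge0.
  by rewrite ler_wpM2l ?expR_ge0// lerD2l ler_sum.
(* Each factor is a Poisson probability of having at most one job in the cell, hence at most 1:
   [1 + L i <= expR (L i)]. *)
- move=> i; rewrite muL; apply: (@le_trans _ _ (expR (- L i) * expR (L i))).
    by rewrite ler_wpM2l ?expR_ge0// expR_ge1Dx.
  by rewrite -expRD addNr expR0.
apply: ler_sum => i _; rewrite -mulrBr opprD addrACA subrr add0r -sumrB.
rewrite ler_piMl ?sumr_ge0//; first by move=> j _; rewrite subr_ge0.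
by rewrite -expR0 ler_expR oppr_le0.
Qed.

Lemma Rintegral_sum d (T : measurableType d) (R : realType)
    (mu : {measure set T -> \bar R}) (D : set T) (I : finType) (f : I -> T -> R) :
  measurable D -> (forall i, mu.-integrable D (EFin \o f i)) ->
  \int[mu]_(x in D) (\sum_i f i x) = \sum_i \int[mu]_(x in D) f i x.
Proof.
move=> mD fint; rewrite /Rintegral.
under eq_integral do rewrite -sumEFin.
rewrite integral_sum//.
rewrite (eq_bigr (fun i => (fine (\int[mu]_(x in D) (f i x)%:E))%:E)) ?sumEFin//.
by move=> i _; rewrite fineK; [|exact: (integrable_fin_num mD (fint i))].
Qed.

Section probability_kernel.
Context (R : realType) (nu : R.-pker (measurableTypeR R) ~> (measurableTypeR R)).
Implicit Types B : set (measurableTypeR R).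

Lemma pkernel_le1 s B : measurable B -> (nu s B <= 1)%E.
Proof.
by move=> mB; rewrite -(prob_kernel (s := nu) s); apply: le_measure; rewrite ?inE.
Qed.

Lemma pkernel_fin_num s B : measurable B -> nu s B \is a fin_num.
Proof.
by move=> mB; rewrite ge0_fin_numE// (le_lt_trans (pkernel_le1 s mB))// ltry.
Qed.

Lemma fine_pkernel_ge0 s B : 0 <= fine (nu s B).
Proof. exact: fine_ge0. Qed.

Lemma fine_pkernel_le1 s B : measurable B -> fine (nu s B) <= 1.
Proof.
by move=> mB; rewrite -lee_fin fineK ?pkernel_fin_num// pkernel_le1.
Qed.

Lemma measurable_fine_pkernel B : measurable B ->
  measurable_fun setT (fun s => fine (nu s B)).
Proof.
by move=> mB; apply: measurableT_comp => //; exact: measurable_kernel.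
Qed.

Lemma sum_service_cells (delta : R) (M : nat) s : 0 < delta ->
  \sum_(j < M.+2) fine (nu s (service_cell delta M j)) = 1.
Proof.
move=> d0.
have mc (j : 'I_M.+2) : measurable (service_cell delta M j : set (measurableTypeR R)).
  exact: measurable_service_cell.
apply: EFin_inj; rewrite -sumEFin.
rewrite (eq_bigr (fun j : 'I_M.+2 => nu s (service_cell delta M j))); last first.
  by move=> j _; rewrite fineK// pkernel_fin_num.
rewrite -measure_bigsetU_ord//; last first.
  by move=> j j' _ _ [r [r1 r2]]; exact: service_cell_inj d0 _ _ _ r1 r2.
rewrite -(prob_kernel (s := nu) s); congr (nu s _).
apply/seteqP; split => // r _; have [j rj] := service_cell_cover M d0 r.
by rewrite -(bigcup_mkord M.+2 (service_cell delta M)); exists j => /=.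
Qed.

End probability_kernel.

Section limit_classes.
Context (R : realType) (nu : R.-pker (measurableTypeR R) ~> (measurableTypeR R)).
Variables (lam : R -> R) (K psib : R).
Hypothesis mlam : measurable_fun (`[0, +oo[%classic : set (measurableTypeR R)) lam.
Hypothesis lam0K : forall u, 0 <= u -> 0 <= lam u <= K.
Hypothesis psib_ge0 : 0 <= psib.

Lemma bounded_mass (a b : R) (B : set (measurableTypeR R)) : 0 <= a -> measurable B ->
  (@lebesgue_measure R).-integrable `[a, b[
    (EFin \o (fun s => psib * lam s * fine (nu s B))).
Proof.
move=> a0 mB; apply: (bounded_integrable_itv (B := psib * K)) => //.
  apply: measurable_funM; first exact: measurable_funM.
  by apply: measurable_funTS; exact: measurable_fine_pkernel.
move=> u u0; have /andP[l0 lK] := lam0K u0.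
rewrite ger0_norm ?mulr_ge0 ?fine_pkernel_ge0//.
apply: (@le_trans _ _ (psib * lam u)); last exact: ler_wpM2l.
by rewrite ler_piMr ?fine_pkernel_le1// mulr_ge0.
Qed.

Lemma mean_measure_rectangle (a b : R) (B : set (measurableTypeR R)) :
  0 <= a -> measurable B ->
  mean_measure psib lam nu (`[a, b[%classic `*` B) =
  (\int[lebesgue_measure]_(s in `[a, b[) (psib * lam s * fine (nu s B)))%:E.
Proof.
move=> a0 mB; rewrite /Rintegral fineK; last first.
  by apply: integrable_fin_num => //; exact: bounded_mass.
rewrite /mean_measure.
have abE : `[a, b[%classic = `[0, +oo[%classic `&` `[a, b[%classic :> set (measurableTypeR R).
  apply/esym/setIidPr => s /=; rewrite !in_itv/= andbT => /andP[si _].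
  exact: le_trans si.
rewrite [in RHS]abE integral_mkcondr; apply: eq_integral => s _.
rewrite patchE; case: ifPn => sA.
  by rewrite in_xsectionX// (EFinM _ (fine _)) fineK// pkernel_fin_num.
by rewrite notin_xsectionX// measure0 mule0.
Qed.

Variables (h delta : R) (m M : nat).
Hypotheses (h_gt0 : 0 < h) (delta_gt0 : 0 < delta).

Definition cell_mass (i : nat) : R :=
  \int[lebesgue_measure]_(s in arrival_cell h i) (psib * lam s).

Definition rectangle_mass (i j : nat) : R :=
  \int[lebesgue_measure]_(s in arrival_cell h i)
    (psib * lam s * fine (nu s (service_cell delta M j))).

Let cell_ge0 (i : nat) : 0 <= i%:R * h.
Proof. by rewrite mulr_ge0// ltW. Qed.

Lemma rectangle_mass_ge0 i j : 0 <= rectangle_mass i j.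
Proof.
apply: Rintegral_ge0 => s; rewrite /arrival_cell /= in_itv/= => /andP[si _].
have /andP[l0 _] := lam0K (le_trans (cell_ge0 i) si).
by rewrite !mulr_ge0 ?fine_pkernel_ge0.
Qed.

Lemma sum_rectangle_mass i : \sum_(j < M.+2) rectangle_mass i j = cell_mass i.
Proof.
rewrite /rectangle_mass -Rintegral_sum.
- by apply: eq_Rintegral => s _; rewrite -mulr_sumr sum_service_cells// mulr1.
- exact: measurable_arrival_cell.
- by move=> j; apply: bounded_mass; [exact: cell_ge0|exact: measurable_service_cell].
Qed.

(** A configuration of class [c] has a prescribed count, 0 or 1, in each of the disjoint rectangles,
    and these counts are independent Poisson variables. The exponentials over one arrival cell
    multiply to that of [cell_mass], since the service cells partition the line. *)
Lemma in_class_lim_le d (Omega : measurableType d) (P : probability Omega R)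
    (J : jobs Omega R) (c : {ffun 'I_m -> option 'I_M.+2}) :
  poisson_jobs P J (mean_measure psib lam nu) ->
  fine (P (in_class h delta J c)) <=
  \prod_(i < m) (expR (- cell_mass i) * (if c i is Some j then rectangle_mass i j else 1)).
Proof.
move=> hp.
pose B (q : 'I_m * 'I_M.+2) : set (measurableTypeR R * measurableTypeR R) :=
  arrival_cell h q.1 `*` service_cell delta M q.2.
pose n (q : 'I_m * 'I_M.+2) : nat := c q.1 == Some q.2.
have mB q : measurable (B q).
  by apply: measurableX; [exact: measurable_arrival_cell|exact: measurable_service_cell].
have BE q : mean_measure psib lam nu (B q) = (rectangle_mass q.1 q.2)%:E.
  by apply: mean_measure_rectangle => //; exact: measurable_service_cell.
have tB : trivIset setT B.
  move=> [i j] [i' j'] _ _ [[s r] [[/= s1 r1] [/= s2 r2]]].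
  have ii' : i = i' by apply/val_inj; exact: arrival_cell_inj s1 s2.
  by rewrite ii' (service_cell_inj delta_gt0 r1 r2).
have mhit q k : measurable [set w | job_hits J (B q) w k].
  exact: measurable_job_hit.
have pE : P [set w | forall q, (job_hits J (B q) w #= `I_(n q))%card] =
    (\prod_(q : 'I_m * 'I_M.+2) fine (poisson_prob (rectangle_mass q.1 q.2) 0 [set n q]))%:E.
  have fB q : (mean_measure psib lam nu (B q) < +oo)%E by rewrite BE ltry.
  rewrite (poisson_points_fin n hp mB tB fB).
  by congr EFin; apply: eq_bigr => q _; rewrite BE.
apply: (@le_trans _ _ (\prod_(q : 'I_m * 'I_M.+2) fine (poisson_prob (rectangle_mass q.1 q.2) 0 [set n q]))).
  rewrite -lee_fin -pE fineK ?fin_num_measure//; last exact: measurable_in_class.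
  apply: le_measure; rewrite ?inE.
  - exact: measurable_in_class.
  - apply: measurable_fin_forall => q; rewrite /n; case: (_ == _).
      rewrite (_ : [set w | _] = [set w | exists k, job_hits J (B q) w = [set k]]).
        exact: measurable_hits_card1.
      by apply/seteqP; split => w /= /card_I1P.
    rewrite (_ : [set w | _] = [set w | job_hits J (B q) w = set0]).
      exact: measurable_hits0.
    by apply/seteqP; split => w /= /card_I0P.
  move=> w cw [i j]; have := cw i; rewrite /n /=.
  case ci : (c i) => [j'|]; last first.
    move=> arr0; apply/card_I0P; rewrite -subset0 => k [s ks [/= si _]].
    have : arrival_hits J (arrival_cell h i) w k by exists s.
    by rewrite arr0.
  move=> [k arrk servk].
  have hit l : arrival_hits J (arrival_cell h i) w l -> l = k by rewrite arrk.
  have [jj|jj] := eqVneq (Some j') (Some j).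
    apply/card_I1P; exists k; apply/seteqP; split => [l [s ls [/= si _]]|_ ->].
      by apply: hit; exists s.
    have : [set k] k by [].
    rewrite -arrk => -[s ks si]; exists s => //; split => //=.
    by case: jj => <-.
  apply/card_I0P; rewrite -subset0 => l [s ls [/= si sj]].
  have lk : l = k by apply: hit; exists s.
  rewrite lk in sj; case/eqP: jj; congr Some.
  exact: service_cell_inj delta_gt0 _ _ _ servk sj.
rewrite -(pair_bigA _ (fun (i : 'I_m) (j : 'I_M.+2) => fine (poisson_prob (rectangle_mass i j) 0 [set n (i, j)])))/=.
apply: ler_prod => i _; apply/andP; split.
  by apply: prodr_ge0 => j _; rewrite fine_ge0.
rewrite (eq_bigr (fun j : 'I_M.+2 => expR (- rectangle_mass i j) *
    (if c i == Some j then rectangle_mass i j else 1))); last first.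
  move=> j _; rewrite poisson_prob1 ?rectangle_mass_ge0// mulrC; congr (_ * _).
  by rewrite /n/=; case: ifP => _; rewrite ?expr1 ?expr0 /= ?factS ?fact0 divr1.
rewrite big_split/= -expR_sum sumrN sum_rectangle_mass.
rewrite ler_wpM2l ?expR_ge0//.
case: (c i) => [j|]; last by rewrite big1.
by rewrite (bigD1 j)//= eqxx big1 ?mulr1// => j' jj'; rewrite eqE /= eq_sym (negbTE jj').
Qed.

End limit_classes.

(** * Separation of the events of the limit *)

Section ccdf.
Context (R : realType) (nu : R.-pker (measurableTypeR R) ~> (measurableTypeR R)).
Variables (alpha c : R).
Hypotheses (alpha_gt0 : 0 < alpha) (c_gt0 : 0 < c).
Hypothesis nu_lipschitz : forall s t r : R, 0 < s -> s < t -> 0 < r ->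
  `|ccdf_kernel nu s r - ccdf_kernel nu t r| <= c * (1 + r) `^ (-1 - alpha) * (t - s).

Let ccdf_lip_pos (s t r : R) : 0 < s -> s < t -> 0 < r ->
  `|ccdf_kernel nu s r - ccdf_kernel nu t r| <= c * (t - s).
Proof.
move=> s0 st r0; apply: le_trans (nu_lipschitz s0 st r0) _.
rewrite ler_pM2r ?subr_gt0// ler_piMr ?(ltW c_gt0)//.
have -> : -1 - alpha = - (1 + alpha) by rewrite opprD.
rewrite powRN invf_le1 ?powR_gt0//; last by rewrite addr_gt0.
rewrite -[X in X <= _](powRr0 (1 + r)) ler_powR//.
  by rewrite lerDl ltW.
by rewrite addr_ge0 ?ltW.
Qed.

(** The Lipschitz hypothesis is stated for positive [r]; this limit extends it to 0, where the mass
    of the cell of zero services is read off. *)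
Lemma ccdf_right_continuous0 s :
  ccdf_kernel nu s n.+1%:R^-1 @[n --> \oo] --> ccdf_kernel nu s 0.
Proof.
apply: fine_cvg; rewrite fineK; last by apply: pkernel_fin_num.
have -> : `]0%R, +oo[%classic = \bigcup_n `](n.+1%:R^-1 : R), +oo[%classic.
  apply/seteqP; split => [r|r [n _]] /=; rewrite !in_itv/= !andbT; last first.
    by apply: le_lt_trans; rewrite invr_ge0.
  move=> r0; exists (Num.truncn r^-1) => //=; rewrite in_itv/= andbT.
  have r1 : 0 <= r^-1 by rewrite invr_ge0 ltW.
  have /andP[_ h] := truncn_itv r1.
  by rewrite invf_plt ?posrE.
apply: nondecreasing_cvg_mu => //; first by apply: bigcupT_measurable.
move=> n k nk; apply/subsetPset => r /=; rewrite !in_itv/= !andbT.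
by apply: le_lt_trans; rewrite lef_pV2 ?posrE// ler_nat ltnS.
Qed.

Lemma ccdf_lipschitz (s t r : R) : 0 < s -> s < t -> 0 <= r ->
  `|ccdf_kernel nu s r - ccdf_kernel nu t r| <= c * (t - s).
Proof.
move=> s0 st; rewrite le_eqVlt => /predU1P[<-|]; last exact: ccdf_lip_pos.
have h : `|ccdf_kernel nu s n.+1%:R^-1 - ccdf_kernel nu t n.+1%:R^-1| @[n --> \oo]
    --> `|ccdf_kernel nu s 0 - ccdf_kernel nu t 0|.
  by apply: cvg_norm; apply: cvgB; exact: ccdf_right_continuous0.
rewrite -(cvg_lim _ h)//; apply: limr_le; first by apply/cvg_ex; eexists; exact: h.
by apply: nearW => n; apply: ccdf_lip_pos; rewrite ?invr_gt0.
Qed.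

Lemma ccdf_lipschitz_dist (s t r : R) : 0 < s -> 0 < t -> 0 <= r ->
  `|ccdf_kernel nu s r - ccdf_kernel nu t r| <= c * `|t - s|.
Proof.
move=> s0 t0 r0; have [st|ts|->] := ltgtP s t.
- apply: le_trans (ccdf_lipschitz s0 st r0) _.
  by rewrite ler_wpM2l ?ler_norm// ltW.
- rewrite distrC (distrC t); apply: le_trans (ccdf_lipschitz t0 ts r0) _.
  by rewrite ler_wpM2l ?ler_norm// ltW.
- by rewrite !subrr normr0 mulr0.
Qed.

Lemma ccdf_ge0 s r : 0 <= ccdf_kernel nu s r.
Proof. exact: fine_ge0. Qed.

Lemma ccdf_le1 s r : ccdf_kernel nu s r <= 1.
Proof. exact: fine_pkernel_le1. Qed.

Lemma kernel_itv s (r r' : R) : r <= r' ->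
  fine (nu s `]r, r']%classic) = ccdf_kernel nu s r - ccdf_kernel nu s r'.
Proof.
move=> rr'; rewrite /ccdf_kernel.
have -> : `]r, +oo[%classic = `]r, r']%classic `|` `]r', +oo[%classic :> set (measurableTypeR R).
  by rewrite -(@itv_bndbnd_setU _ _ _ (BRight r')) ?bnd_simp.
rewrite measureU//; last first.
  by apply/seteqP; split => // u [/=]; rewrite !in_itv/= andbT => /andP[_ /le_gtF ->].
by rewrite fineD ?pkernel_fin_num// addrK.
Qed.

(** The mass of a cell is a combination of at most two values of the complementary distribution
    function at end points that do not depend on the arrival time. Hence the constant [2 * c],
    independent of the mesh. *)
Lemma kernel_service_cell_dist (delta : R) (M j : nat) s t : 0 < delta -> 0 < s -> 0 < t ->
  `|fine (nu s (service_cell delta M j)) - fine (nu t (service_cell delta M j))| <=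
  2 * c * `|t - s|.
Proof.
move=> d0 s0 t0.
have cts : 0 <= c * `|t - s| by rewrite mulr_ge0// ltW.
have pos (i : nat) : 0 <= i%:R * delta by rewrite mulr_ge0// ltW.
case: j => [|j] /=.
  have e u : fine (nu u `]-oo, 0%R]%classic) = 1 - ccdf_kernel nu u 0.
    have := prob_kernel (s := nu) u.
    have -> : [set: measurableTypeR R] = `]-oo, 0%R]%classic `|` `]0%R, +oo[%classic.
      by rewrite -(@itv_bndbnd_setU _ _ _ (BRight 0))// set_itvE.
    rewrite measureU//; last first.
      by apply/seteqP; split => // v [/=]; rewrite !in_itv/= andbT => /le_gtF ->.
    move=> /(congr1 fine); rewrite fineD ?pkernel_fin_num//= => <-.
    by rewrite /ccdf_kernel addrK.
  rewrite !e; have := ccdf_lipschitz_dist s0 t0 (lexx 0).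
  by rewrite !ler_norml; lra.
case: ifP => _; last first.
  by have := ccdf_lipschitz_dist s0 t0 (pos M); rewrite /ccdf_kernel; lra.
have jj : j%:R * delta <= j.+1%:R * delta by rewrite ler_pM2r// ler_nat.
rewrite !kernel_itv//.
have := ccdf_lipschitz_dist s0 t0 (pos j); have := ccdf_lipschitz_dist s0 t0 (pos j.+1).
by rewrite !ler_norml; lra.
Qed.

End ccdf.

Section event_mass.
Context (R : realType) (nu : R.-pker (measurableTypeR R) ~> (measurableTypeR R)).
Variables (c : R).
Hypothesis c_gt0 : 0 < c.
Hypothesis ccdf_lip : forall s t r : R, 0 < s -> 0 < t -> 0 <= r ->
  `|ccdf_kernel nu s r - ccdf_kernel nu t r| <= c * `|t - s|.

Definition event_strip (S x l : R) : set (measurableTypeR R * measurableTypeR R) :=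
  [set q | 0 <= q.1 < S /\
    (x <= q.1 < x + l \/ (0 < q.2 /\ x <= q.1 + q.2 < x + l))].

Let departure : measurableTypeR R * measurableTypeR R -> measurableTypeR R :=
  fun q => q.1 + q.2.

Let measurable_departure : measurable_fun setT departure.
Proof.
exact: (measurable_funD (@measurable_fst _ _ (measurableTypeR R) (measurableTypeR R))
  (@measurable_snd _ _ (measurableTypeR R) (measurableTypeR R))).
Qed.

Let measurable_strip (f : measurableTypeR R * measurableTypeR R -> measurableTypeR R)
    (i : interval R) :
  measurable_fun setT f -> measurable (f @^-1` [set` i]).
Proof.
by move=> mf; rewrite -[X in measurable X]setTI; apply: mf.
Qed.

Lemma measurable_event_strip S x l : measurable (event_strip S x l).
Proof.
have -> : event_strip S x l = (fst @^-1` [set` `[0, S[]) `&`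
   ((fst @^-1` [set` `[x, x + l[]) `|`
    ((snd @^-1` [set` `]0, +oo[]) `&` (departure @^-1` [set` `[x, x + l[]))).
  apply/seteqP; split => q /=; rewrite !in_itv/= ?andbT //.
apply: measurableI; first by apply: measurable_strip; exact: measurable_fst.
apply: measurableU; first by apply: measurable_strip; exact: measurable_fst.
apply: measurableI; first by apply: measurable_strip; exact: measurable_snd.
exact: measurable_strip.
Qed.

(** The probability that a job arriving at [s] has positive service and departs after [y]; the
    maximum covers arrivals later than [y]. *)
Let tail (y s : R) : R := ccdf_kernel nu s (Num.max 0 (y - s)).

Let tail01 y s : 0 <= tail y s <= 1.
Proof. by rewrite ccdf_ge0 ccdf_le1. Qed.

Let tail_norm y s : `|tail y s| <= 1.
Proof. by have /andP[? ?] := tail01 y s; rewrite ger0_norm. Qed.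

Let measurable_tail y : measurable_fun setT (tail y : measurableTypeR R -> R).
Proof.
pose B : set (measurableTypeR R * measurableTypeR R) :=
  (snd @^-1` [set` `]0, +oo[]) `&` (departure @^-1` [set` `]y, +oo[]).
have mB : measurable B.
  apply: measurableI; first by apply: measurable_strip; exact: measurable_snd.
  exact: measurable_strip.
rewrite (_ : tail y = fun s => fine (nu s (xsection B s))).
  apply: measurableT_comp => //.
  exact: (measurable_fun_xsection_finite_kernel nu (mem_set mB)).
apply/funext => s; rewrite /tail /ccdf_kernel; congr (fine (nu s _)).
apply/seteqP; split => r /=; rewrite /xsection /= inE /B /departure /= !in_itv/= !andbT gt_max.
  by move=> /andP[r0 yr]; split => //; rewrite -ltrBlDl.
by move=> [-> yr]; rewrite /= ltrBlDl.
Qed.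

Let tail_integrable (a b y : R) : 0 <= a ->
  (@lebesgue_measure R).-integrable `[a, b[ (EFin \o tail y).
Proof.
move=> a0; apply: (bounded_integrable_itv (B := 1)) => //.
by apply: measurable_funTS; exact: measurable_tail.
Qed.

Let itv_length (a b : R) : a <= b -> fine (lebesgue_measure `[a, b[%classic) = b - a.
Proof.
move=> ab; rewrite lebesgue_measure_itv/= lte_fin; case: ltP => // ba.
by rewrite (le_anti (_ : a <= b <= a)) ?subrr// ab.
Qed.

(* Substituting [s + l] for [s] in the subtracted integral, the two integrands
   have the same second argument and differ by at most [c * l]. *)
Lemma tail_increment (S y l : R) : 0 < S -> 0 < l ->
  \int[lebesgue_measure]_(s in `[0, S[) (tail y s - tail (y + l) s) <= (1 + c * S) * l.
Proof.
move=> S0 l0; rewrite RintegralB//; [|exact: tail_integrable|exact: tail_integrable].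
have cSl : 0 <= c * S * l by rewrite !mulr_ge0// ltW.
have le_len (a b z : R) : 0 <= a -> a <= b -> \int[lebesgue_measure]_(s in `[a, b[) tail z s <= b - a.
  move=> a0 ab; rewrite -(itv_length ab) -[leRHS]mul1r -Rintegral_cst//.
  apply: le_Rintegral => //; first exact: tail_integrable.
    by apply: (bounded_integrable_itv (B := 1)) => // u _; rewrite normr1.
  by move=> s _; case/andP: (tail01 z s).
have ge_0 (a b z : R) : 0 <= \int[lebesgue_measure]_(s in `[a, b[) tail z s.
  by apply: Rintegral_ge0 => s _; case/andP: (tail01 z s).
have [Sl|lS] := leP S l.
  have arith (A B : R) : A <= S - 0 -> 0 <= B -> A - B <= (1 + c * S) * l by lra.
  by apply: arith; [apply: le_len => //; exact: ltW|exact: ge_0].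
have Sl0 : 0 <= S - l by lra.
have SlS : S - l <= S by lra.
have arith (A A' B B' : R) : A' <= S - (S - l) -> 0 <= B -> A - B' <= c * l * (S - l) ->
    A + A' - (B + B') <= (1 + c * S) * l.
  have : c * l * (S - l) <= c * S * l.
    by rewrite mulrBr mulrAC lerBlDr lerDl mulr_ge0// ?mulr_ge0// ltW.
  lra.
(* The first integral is cut at [S - l] and the second at [l]: the pieces [[0, S - l[] and [[l, S[]
   match under the shift, and of the two others, of length [l], only the first contributes an
   error. *)
rewrite (Rintegral_itv_cat Sl0 SlS (tail_integrable S y (lexx 0))).
rewrite (Rintegral_itv_cat (ltW l0) (ltW lS) (tail_integrable S (y + l) (lexx 0))).
have shift : \int[lebesgue_measure]_(s in `[l, S[) tail (y + l) s =
    \int[lebesgue_measure]_(s in `[0, S - l[) tail (y + l) (s + l).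
  rewrite /Rintegral (@ge0_integral_affine R 1 l ltr01)//=.
  - rewrite (preimage_affine_itv l ltr01 true true) !divr1 subrr mul1e.
    by congr fine; apply: eq_integral => s _; rewrite mul1r.
  - by apply/measurable_EFinP; exact: measurable_funTS.
  - by move=> s _; rewrite lee_fin; case/andP: (tail01 (y + l) s).
have mshift : measurable_fun setT (fun s : measurableTypeR R => tail (y + l) (s + l)).
  apply: (measurableT_comp (measurable_tail (y + l))).
  exact: measurable_funD.
have ishift : (@lebesgue_measure R).-integrable `[0, S - l[
    (EFin \o (fun s => tail (y + l) (s + l))).
  by apply: (bounded_integrable_itv (B := 1)) => //; exact: measurable_funTS.
have h3 : \int[lebesgue_measure]_(s in `[0, S - l[) (tail y s - tail (y + l) (s + l)) <=
    c * l * (S - l).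
  have idiff : (@lebesgue_measure R).-integrable `[0, S - l[
      (EFin \o (fun s => tail y s - tail (y + l) (s + l))).
    apply: (bounded_integrable_itv (B := 1 + 1)) => //.
      by apply: measurable_funTS; exact: measurable_funB.
    by move=> u _; apply: le_trans (ler_normB _ _) _; rewrite lerD.
  have icst : (@lebesgue_measure R).-integrable `[0, S - l[ (EFin \o cst (c * l)).
    by apply: (bounded_integrable_itv (B := `|c * l|)).
  rewrite -[X in _ * X](subr0 (S - l)) -(itv_length Sl0) -Rintegral_cst//.
  (* The Lipschitz bound holds for positive arrival times, so the null set [{0}] is removed
     first. *)
  have sub : (`]0, (S - l)[%classic : set R) `<=` `[0, (S - l)[%classic.
    by apply: subset_itvr; rewrite bnd_simp.
  rewrite -Rintegral_itv_obnd_cbnd; last by apply: integrableS idiff.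
  rewrite -[leRHS]Rintegral_itv_obnd_cbnd; last by apply: integrableS icst.
  apply: le_Rintegral => //; [exact: integrableS idiff|exact: integrableS icst|].
  move=> s /=; rewrite in_itv/= => /andP[s0 _].
  have -> : tail (y + l) (s + l) = ccdf_kernel nu (s + l) (Num.max 0 (y - s)).
    by rewrite /tail; congr (ccdf_kernel nu _ (Num.max 0 _)); ring.
  have s1 : 0 < s + l by exact: addr_gt0.
  have := ccdf_lip s0 s1 (_ : 0 <= Num.max 0 (y - s)).
  rewrite le_max lexx => /(_ isT); rewrite (_ : s + l - s = l); last by ring.
  by rewrite (gtr0_norm l0); apply: le_trans; exact: ler_norm.
apply: arith; [exact: le_len|exact: ge_0|].
by rewrite shift -RintegralB//; exact: tail_integrable.
Qed.

Variables (lam : R -> R) (K psib : R).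
Hypothesis lam0K : forall u, 0 <= u -> 0 <= lam u <= K.
Hypothesis psib_ge0 : 0 <= psib.

Lemma mean_event_strip (S x l : R) : 0 < S -> 0 < l ->
  (mean_measure psib lam nu (event_strip S x l) <=
   (psib * K * (l + (1 + c * S) * (2 * l)))%:E)%E.
Proof.
(* A difference of two values of [tail] measures left-open departure windows, whereas the strip is
   closed on the left; it is enlarged to the window from [x - l] to [x + l], whence the factor
   [2 * l]. *)
move=> S0 l0; set y := x - l.
have K0 : 0 <= K by have /andP[] := lam0K (lexx 0); exact: le_trans.
pose W := `[x, x + l[%classic : set (measurableTypeR R).
pose g s := \1_W s + (tail y s - tail (y + 2 * l) s).
have tail_mono s : tail (y + 2 * l) s <= tail y s.
  rewrite -subr_ge0 /tail /ccdf_kernel; rewrite subr_ge0 fine_le ?pkernel_fin_num//.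
  apply: le_measure; rewrite ?inE// => r /=; rewrite !in_itv/= !andbT !gt_max.
  by move=> /andP[-> h]; rewrite (lt_trans _ h)//; lra.
have gi : (@lebesgue_measure R).-integrable `[0, S[ (EFin \o g).
  apply: (bounded_integrable_itv (B := 1 + (1 + 1))) => //.
    apply: measurable_funTS; apply: measurable_funD; last exact: measurable_funB.
    by apply: measurable_indic; exact: measurable_itv.
  move=> u _; apply: le_trans (ler_normD _ _) _; rewrite lerD//.
    by rewrite indicE; case: (_ \in _); rewrite ?normr1 ?normr0.
  by apply: le_trans (ler_normB _ _) _; rewrite lerD.
have section_le s : 0 <= s -> s < S ->
    (nu s (xsection (event_strip S x l) s) <= (g s)%:E)%E.
  move=> s0 sS; have d0 : 0 <= tail y s - tail (y + 2 * l) s by rewrite subr_ge0.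
  have mX : measurable (xsection (event_strip S x l) s).
    by apply: measurable_xsection; exact: measurable_event_strip.
  rewrite /g indicE; have [sW|sW] := boolP (s \in W).
    by apply: le_trans (pkernel_le1 nu s mX) _; rewrite lee_fin lerDl.
  rewrite add0r /tail -kernel_itv; last first.
    by rewrite ge_max !le_max lexx /=; apply/orP; right; lra.
  rewrite fineK ?pkernel_fin_num//; apply: le_measure; rewrite ?inE//.
  move=> r; rewrite /xsection /= inE => -[_ [sx|[r0 /andP[r1 r2]]]].
    by move: sW; rewrite notin_setE /W /= in_itv/= sx.
  move: r0 r1 r2 => /= r0 r1 r2.
  rewrite in_itv/= gt_max le_max r0 /=; apply/andP; split; first by rewrite /y; lra.
  by apply/orP; right; rewrite /y; lra.
pose F s := psib * K * g s.
have Fi : (@lebesgue_measure R).-integrable `[0, S[ (EFin \o F).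
  rewrite (_ : EFin \o F = fun s => ((psib * K)%:E * (g s)%:E)%E).
    exact: integrableZl.
  by apply/funext => s; rewrite /= EFinM.
pose bound : \bar R := (\int[@lebesgue_measure R]_(s in `[0%R, +oo[) ((EFin \o F) \_ `[0%R, S[) s)%E.
apply: (@le_trans _ _ bound).
  apply: le_integral_total => s; rewrite /= in_itv/= andbT => s0.
  have /andP[l1 lK] := lam0K s0.
  rewrite patchE; case: ifPn => [|sS].
    rewrite inE /= in_itv/= => /andP[_ sS].
    rewrite /= /F (EFinM (psib * K)); apply: lee_pmul => //; first by rewrite lee_fin mulr_ge0.
      by rewrite lee_fin ler_wpM2l.
    exact: section_le.
  rewrite (_ : xsection _ _ = set0) ?measure0 ?mule0//.
  rewrite -subset0 => r; rewrite /xsection /= inE => -[/= sS' _].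
  by move: sS; rewrite notin_setE /= in_itv/= sS'.
rewrite /bound -integral_mkcondr.
have -> : `[0, +oo[%classic `&` `[0, S[%classic = `[0, S[%classic :> set (measurableTypeR R).
  by apply/setIidPr => s /=; rewrite !in_itv/= andbT => /andP[].
rewrite -[X in (X <= _)%E]fineK; last exact: integrable_fin_num.
rewrite lee_fin -/(Rintegral _ _ F) /F RintegralZl// ler_wpM2l ?mulr_ge0//.
rewrite /g RintegralD//; last 2 first.
- apply: (bounded_integrable_itv (B := 1)) => //; first by apply: measurable_indic; exact: measurable_itv.
  by move=> u _; rewrite indicE; case: (_ \in _); rewrite ?normr1 ?normr0.
- apply: (bounded_integrable_itv (B := 1 + 1)) => //.
    by apply: measurable_funTS; exact: measurable_funB.
  by move=> u _; apply: le_trans (ler_normB _ _) _; rewrite lerD.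
apply: lerD; last by apply: tail_increment => //; rewrite mulr_gt0.
have mW : measurable W by exact: measurable_itv.
rewrite /Rintegral integral_indic//.
apply: (@le_trans _ _ (fine (lebesgue_measure W))).
  have Wfin : (lebesgue_measure W < +oo)%E.
    by rewrite /W lebesgue_measure_itv/=; case: ifP => _; rewrite ltry.
  have WS : (lebesgue_measure (W `&` `[0%R, S[%classic) <= lebesgue_measure W)%E.
    by apply: measureIl; exact: measurable_itv.
  apply: fine_le => //; rewrite ge0_fin_numE//.
  exact: le_lt_trans WS Wfin.
by rewrite itv_length; lra.
Qed.

End event_mass.

Section poisson_tails.
Context d (Omega : measurableType d) (R : realType) (P : probability Omega R).
Variables (J : jobs Omega R)
  (mu : set (measurableTypeR R * measurableTypeR R) -> \bar R).
Hypothesis pois : poisson_jobs P J mu.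
Variables (B : set (measurableTypeR R * measurableTypeR R)) (x : R).
Hypotheses (mB : measurable B) (muB : (0 <= mu B <= x%:E)%E).

Definition some_hit : set Omega := [set w | exists k, job_hits J B w k].

Definition two_hits : set Omega :=
  [set w | exists k l, [/\ k != l, job_hits J B w k & job_hits J B w l]].

Let hit k : measurable [set w | job_hits J B w k].
Proof. exact: measurable_job_hit. Qed.

Lemma measurable_some_hit : measurable some_hit.
Proof.
rewrite (_ : some_hit = \bigcup_k [set w | job_hits J B w k]).
  exact: bigcupT_measurable.
by apply/seteqP; split => [w [k wk]|w [k _ wk]]; exists k.
Qed.

Lemma measurable_two_hits : measurable two_hits.
Proof.
rewrite (_ : two_hits = \bigcup_k \bigcup_(l in [set l | k != l])
    ([set w | job_hits J B w k] `&` [set w | job_hits J B w l])).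
  apply: bigcupT_measurable => k; apply: bigcup_measurable => l _.
  exact: measurableI.
apply/seteqP; split => [w [k [l [kl wk wl]]]|w [k _ [l /= kl [wk wl]]]].
  by exists k => //; exists l.
by exists k, l.
Qed.

Let y := fine (mu B).

Let muBE : mu B = y%:E.
Proof.
have /andP[m0 mx] := muB.
by rewrite fineK// ge0_fin_numE// (le_lt_trans mx)// ltry.
Qed.

Let y0x : 0 <= y <= x.
Proof. by move: muB; rewrite muBE !lee_fin. Qed.

Let poisson1 n : P [set w | (job_hits J B w #= `I_n)%card] =
  (y ^+ n / n`!%:R * expR (- y))%:E.
Proof.
have fB (i : unit) : (mu B < +oo)%E by rewrite muBE ltry.
have tB : trivIset [set: unit] (fun _ => B) by move=> [] [].
have := poisson_points_fin (fun _ : unit => n) pois (fun _ => mB) tB fB.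
rewrite big_enum_val /= card_unit big_ord1 muBE /= poisson_prob1; last by case/andP: y0x.
move=> <-; congr (P _).
by apply/seteqP; split => [w ? []|w /(_ tt)].
Qed.

Let P0 : P [set w | job_hits J B w = set0] = (expR (- y))%:E.
Proof.
rewrite (_ : [set w | _] = [set w | (job_hits J B w #= `I_0)%card]).
  by rewrite poisson1 expr0 fact0 divr1 mul1r.
by apply/seteqP; split => w /card_I0P.
Qed.

Let P1 : P [set w | exists k, job_hits J B w = [set k]] = (y * expR (- y))%:E.
Proof.
rewrite (_ : [set w | _] = [set w | (job_hits J B w #= `I_1)%card]).
  by rewrite poisson1 expr1 factS fact0 divr1.
by apply/seteqP; split => w /card_I1P.
Qed.

Let exp_ge : 1 - y <= expR (- y).
Proof. exact: expR_ge1Dx. Qed.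

(** From [1 - expR (- y) <= y]. *)
Lemma some_hit_le : (P some_hit <= x%:E)%E.
Proof.
have -> : some_hit = ~` [set w | job_hits J B w = set0].
  apply/seteqP; split => [w [k wk] /= w0|w /= w0]; first by rewrite w0 in wk.
  by apply/set0P/eqP.
rewrite probability_setC ?P0; last exact: measurable_hits0.
by rewrite -EFinB lee_fin; have /andP[_ yx] := y0x; move: exp_ge; lra.
Qed.

(** From [1 - (1 + y) * expR (- y) <= 1 - (1 + y) * (1 - y) = y ^+ 2]. The quadratic order beats the
    number of windows, which is of order [1 / l]. *)
Lemma two_hits_le : (P two_hits <= (x ^+ 2)%:E)%E.
Proof.
have -> : two_hits = ~` ([set w | job_hits J B w = set0] `|`
    [set w | exists k, job_hits J B w = [set k]]).
  apply/seteqP; split => [w [k [l [kl wk wl]]] /= [w0|[k' wk']]|w /= w01].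
  - by rewrite w0 in wk.
  - by move: wk wl kl; rewrite wk' => -> ->; rewrite eqxx.
  have /set0P[k wk] : job_hits J B w != set0.
    by apply/eqP => w0; apply: w01; left.
  apply: contrapT => w2; apply: w01; right; exists k; apply/seteqP; split => [l wl|_ -> //].
  by apply: contrapT => /eqP lk; apply: w2; exists l, k.
have m0 := measurable_hits0 hit; have m1 := measurable_hits_card1 hit.
rewrite probability_setC; last exact: measurableU.
rewrite measureU//; last first.
  apply/seteqP; split => // w /= [w0 [k wk]].
  have : [set k] k by [].
  by rewrite -wk w0.
rewrite [X in (_ - (X + _))%E]P0 [X in (_ - (_ + X))%E]P1 -(EFinD (expR (- y))) -EFinB lee_fin.
have /andP[y0 yx] := y0x.
have h : (1 - y) * (1 + y) <= expR (- y) * (1 + y).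
  by rewrite ler_wpM2r// addr_ge0.
have : y ^+ 2 <= x ^+ 2 by rewrite ler_pXn2r// nnegrE// (le_trans y0).
by rewrite !expr2 in h *; lra.
Qed.

End poisson_tails.

Section separation_probability.
Context d (Omega : measurableType d) (R : realType) (P : probability Omega R).
Variables (J : jobs Omega R) (T : R).
Hypothesis T_gt0 : 0 < T.

Definition short_service (l : R) : set Omega :=
  [set w | exists k, (arrival J k w <= T%:E)%E /\ 0 < service J k w < l].

Lemma measurable_short_service l : measurable (short_service l).
Proof.
rewrite (_ : short_service l = \bigcup_k ((arrival J k @^-1` [set a | (a <= T%:E)%E]) `&`
    [set w | (`]0, l[%classic : set (measurableTypeR R)) (service J k w)])).
  apply: bigcupT_measurable => k; apply: measurableI; last first.
    by apply: measurable_service_in; exact: measurable_itv.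
  rewrite -[X in measurable X]setTI; apply: measurable_arrival => //.
  rewrite (_ : [set a | _] = `]-oo, T%:E]%classic); first exact: emeasurable_itv.
  by apply/seteqP; split => a /=; rewrite in_itv.
apply/seteqP; split => w; first by move=> [k [ka kl]]; exists k => //; split; rewrite /= ?in_itv.
by move=> [k _ [ka /=]]; rewrite in_itv/= => kl; exists k.
Qed.

(** The Lipschitz bound in the arrival time does not prevent mass near service time 0, so no rate is
    sought: finitely many jobs arrive before [T], their positive service times have a positive
    minimum, and the events decrease to the empty set. *)
Lemma short_service_vanish :
  P (short_service n.+1%:R^-1) @[n --> \oo] --> 0%E.
Proof.
rewrite -(measure0 P).
have -> : set0 = \bigcap_n short_service n.+1%:R^-1.
  apply/esym; rewrite -subset0 => w sw.
  have /finite_seqP[s sE] := arrival_locally_finite J T w.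
  have [r r0 rP] : exists2 r : R, 0 < r & forall k, k \in s -> 0 < service J k w ->
      r <= service J k w.
    elim: s {sE} => [|k s [r r0 rP]]; first by exists 1.
    have [k0|k0] := leP (service J k w) 0.
      exists r => // l; rewrite inE => /predU1P[->|/rP//].
      by rewrite ltNge k0.
    exists (Num.min r (service J k w)); first by rewrite lt_min r0.
    move=> l; rewrite inE => /predU1P[->|/rP h] sl; rewrite ge_min ?lexx ?orbT//.
    by rewrite h.
  have r1 : 0 <= r^-1 by rewrite invr_ge0 ltW.
  have h : (Num.truncn r^-1).+1%:R^-1 < r.
    by have /andP[_ ?] := truncn_itv r1; rewrite invf_plt ?posrE.
  have [k [ka /andP[k0 kr]]] := sw (Num.truncn r^-1) I.
  have ks : k \in s by have : [set` s] k by rewrite -sE.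
  by have := lt_trans kr h; rewrite ltNge rP.
apply: nonincreasing_cvg_mu.
- by rewrite (le_lt_trans (probability_le1 _ _)) ?ltry//; exact: measurable_short_service.
- by move=> n; exact: measurable_short_service.
- by apply: bigcapT_measurable => n; exact: measurable_short_service.
move=> n k nk; apply/subsetPset => w [i [ia /andP[i0 il]]]; exists i; split => //.
by rewrite i0 (lt_le_trans il)// lef_pV2 ?posrE// ler_nat ltnS.
Qed.

Variables (C : R) (mu : set (measurableTypeR R * measurableTypeR R) -> \bar R).
Hypothesis C_ge0 : 0 <= C.
Hypothesis pois : poisson_jobs P J mu.
Hypothesis mass_strip : forall x l, 0 < l ->
  (0 <= mu (event_strip (2 * T) x l) <= (C * l)%:E)%E.

(** Consecutive windows overlap by half, so two events less than [l] apart share one. Arrivals are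
    followed up to [2 * T] because the events within [l <= T] after [T] count too, and their jobs
    may arrive after [T]. *)
Let window (l : R) (a : nat) := event_strip (2 * T) (a%:R * l) (2 * l).

Definition not_separated (l : R) : set Omega :=
  (\bigcup_(a < (Num.truncn (T / l)).+1) two_hits J (window l a)) `|`
  (some_hit J (event_strip (2 * T) 0 l) `|`
   (some_hit J (event_strip (2 * T) (T - l) (2 * l)) `|` short_service l)).

Lemma event_arrival w k x : event J w k x ->
  exists2 s, arrival J k w = s%:E & 0 <= s <= x /\
    (s = x \/ (0 < service J k w /\ s + service J k w = x)).
Proof.
have s0 s : arrival J k w = s%:E -> 0 <= s.
  by move=> ks; have := arrival_ge0 J k w; rewrite ks lee_fin.
move=> [ks|[kp [s ks ->]]].
  by exists x => //; rewrite lexx (s0 x)//; split => //; left.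
by exists s => //; rewrite (s0 s)// lerDl ltW//; split => //; right.
Qed.

Lemma event_hit w k x u l : event J w k x -> x < 2 * T -> u <= x < u + l ->
  job_hits J (event_strip (2 * T) u l) w k.
Proof.
move=> /event_arrival[s ks [/andP[s0 sx] sE]] xT xu; exists s => //; split => /=.
  by rewrite s0 (le_lt_trans sx).
by case: sE => [->|[kp ->]]; [left|right].
Qed.

Lemma not_separatedP l w : 0 < l <= T -> ~ not_separated l w -> well_separated J w T l.
Proof.
move=> /andP[l0 lT] nw.
have window_hit k k' x y : k != k' -> event J w k x -> event J w k' y ->
    x <= y -> x <= T -> y <= T -> l <= y - x.
  move=> kk' ex ey xy xT yT; rewrite leNgt; apply/negP => xyl; apply: nw; left.
  have [s _ [/andP[s0 sx] _]] := event_arrival ex.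
  have x0 : 0 <= x := le_trans s0 sx.
  have /andP[t1 t2] := truncn_itv (divr_ge0 x0 (ltW l0)).
  rewrite ler_pdivlMr// in t1; rewrite ltr_pdivrMr// -natr1 mulrDl mul1r in t2.
  (* With [a] this index, [a * l <= x < (a + 1) * l], so [y < x + l] is still below
     [(a + 2) * l]. *)
  exists (Num.truncn (x / l)).
    by rewrite /= ltnS le_truncn// ler_pM2r// invr_gt0.
  exists k, k'; split => //.
    by apply: (event_hit ex); [lra|apply/andP; split; lra].
  by apply: (event_hit ey); [lra|apply/andP; split; lra].
split.
- move=> k k' x y kk' ex ey xT yT; have [xy|/ltW yx] := leP x y.
    by rewrite distrC ger0_norm ?subr_ge0// (window_hit k k').
  by rewrite ger0_norm ?subr_ge0// (window_hit k' k)// eq_sym.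
- move=> k x ex; have [s _ [/andP[s0 sx] _]] := event_arrival ex.
  have x0 : 0 <= x := le_trans s0 sx.
  split; rewrite leNgt; apply/negP => h; apply: nw; right.
    left; exists k; apply: event_hit ex _ _; first lra.
    by rewrite add0r x0.
  right; left; exists k; move: h; rewrite ltr_norml => /andP[h1 h2].
  by apply: event_hit ex _ _; [lra|apply/andP; split; lra].
- move=> k s ks sT k0; rewrite leNgt; apply/negP => kl; apply: nw; do 3 right.
  by exists k; rewrite ks lee_fin sT k0.
Qed.

Lemma measurable_not_separated l : measurable (not_separated l).
Proof.
apply: measurableU.
  apply: bigcup_measurable => a _; apply: measurable_two_hits.
  exact: measurable_event_strip.
apply: measurableU; first by apply: measurable_some_hit; exact: measurable_event_strip.
apply: measurableU; last exact: measurable_short_service.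
by apply: measurable_some_hit; exact: measurable_event_strip.
Qed.

(** At most [2 * T / l] windows, each with two hits with probability at most [(2 * C * l) ^+ 2],
    give [8 * T * C ^+ 2 * l]; the strips at 0 and around [T] give [C * l] and [2 * C * l]. *)
Lemma not_separated_le l : 0 < l <= T ->
  (P (not_separated l) <= ((8 * T * C ^+ 2 + 3 * C) * l)%:E + P (short_service l))%E.
Proof.
move=> /andP[l0 lT]; have l20 : 0 < 2 * l by lra.
have ms x z := measurable_event_strip (2 * T) x z.
have mtwo a : measurable (two_hits J (window l a)) by exact: measurable_two_hits (ms _ _).
have msome x z : measurable (some_hit J (event_strip (2 * T) x z)).
  exact: measurable_some_hit (ms _ _).
set N := (Num.truncn (T / l)).+1.
have NlT : N%:R * l <= 2 * T.
  have /andP[t1 _] := truncn_itv (divr_ge0 (ltW T_gt0) (ltW l0)).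
  by rewrite ler_pdivlMr// in t1; rewrite /N -natr1 mulrDl mul1r; lra.
have b1 : (P (\bigcup_(a < N) two_hits J (window l a)) <= (8 * T * C ^+ 2 * l)%:E)%E.
  rewrite bigcup_mkord; apply: le_trans
    (@Boole_inequality _ _ _ P (fun a => two_hits J (window l a)) N _) _ => //.
  apply: (@le_trans _ _ (\sum_(a < N) ((C * (2 * l)) ^+ 2)%:E)%E).
    by apply: lee_sum => a _; apply: (two_hits_le pois (ms _ _)); exact: mass_strip.
  rewrite sumEFin lee_fin big_const_ord iter_addr_0 -[leLHS]mulr_natl.
  have : 4 * C ^+ 2 * l * (N%:R * l) <= 4 * C ^+ 2 * l * (2 * T).
    by rewrite ler_wpM2l// !mulr_ge0// ?sqr_ge0// ltW.
  by rewrite !expr2; lra.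
have b2 : (P (some_hit J (event_strip (2 * T) 0 l)) <= (C * l)%:E)%E.
  by apply: (some_hit_le pois (ms _ _)); exact: mass_strip.
have b3 : (P (some_hit J (event_strip (2 * T) (T - l) (2 * l))) <= (C * (2 * l))%:E)%E.
  by apply: (some_hit_le pois (ms _ _)); exact: mass_strip.
have U2 (A B : set Omega) : measurable A -> measurable B -> (P (A `|` B) <= P A + P B)%E.
  by move=> mA mB; exact: measureU2.
have mshort := measurable_short_service l.
apply: le_trans (U2 _ _ _ _) _.
- by apply: bigcup_measurable.
- by do 2 apply: measurableU => //.
have -> : ((8 * T * C ^+ 2 + 3 * C) * l)%:E =
    ((8 * T * C ^+ 2 * l)%:E + ((C * l)%:E + (C * (2 * l))%:E))%E :> \bar R.
  by rewrite -!EFinD; congr EFin; ring.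
rewrite -addeA; apply: leeD => //; rewrite -addeA.
apply: le_trans (U2 _ _ _ _) _ => //; first exact: measurableU.
by apply: leeD => //; apply: le_trans (U2 _ _ _ _) _ => //; exact: leeD.
Qed.

Lemma separated_likely eta : 0 < eta -> exists2 l0 : R, 0 < l0 &
  forall l, 0 < l <= l0 -> exists U, [/\ measurable U, (P U <= eta%:E)%E &
    forall w, ~ U w -> well_separated J w T l].
Proof.
move=> eta0; set D := 8 * T * C ^+ 2 + 3 * C.
have D0 : 0 <= D by rewrite addr_ge0// !mulr_ge0// ?sqr_ge0// ltW.
have [n Pn] : exists n, (P (short_service n.+1%:R^-1) <= (eta / 2)%:E)%E.
  have e2 : 0 < eta / 2 by lra.
  have := short_service_vanish => /fine_cvgP[_ /cvgrPdist_le/(_ _ e2)[n _ hn]].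
  exists n; have := hn n (leqnn n); rewrite /= sub0r normrN ger0_norm ?fine_ge0// => h.
  by rewrite -[leLHS]fineK ?fin_num_measure//; exact: measurable_short_service.
exists (Num.min T (Num.min n.+1%:R^-1 (eta / 2 / (D + 1)))).
  by rewrite !lt_min T_gt0 invr_gt0 ltr0Sn /= divr_gt0//; lra.
move=> l /andP[l0]; rewrite !le_min => /and3P[lT ln lD].
exists (not_separated l); split; first exact: measurable_not_separated.
  apply: le_trans (not_separated_le _) _; first by rewrite l0.
  have -> : eta%:E = ((eta / 2)%:E + (eta / 2)%:E)%E :> \bar R.
    by rewrite -EFinD; congr EFin; field.
  apply: leeD.
    rewrite lee_fin -/D; rewrite ler_pdivlMr in lD; last lra.
    by apply: le_trans lD; rewrite mulrDr mulr1 mulrC lerDl ltW.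
  apply: le_trans Pn; apply: le_measure; rewrite ?inE; [exact: measurable_short_service..|].
  by move=> w [k [ka /andP[k0 kl]]]; exists k; rewrite k0 (lt_le_trans kl).
by move=> w; apply: not_separatedP; rewrite l0.
Qed.

End separation_probability.

(** * Convergence in distribution through finite classes *)

Lemma probability_bigsetU_le d (Omega : measurableType d) (R : realType)
    (P : probability Omega R) (I : finType) (p : pred I) (E : I -> set Omega) :
  (forall i, measurable (E i)) ->
  fine (P (\big[setU/set0]_(i | p i) E i)) <= \sum_(i | p i) fine (P (E i)).
Proof.
move=> mE.
suff : measurable (\big[setU/set0]_(i | p i) E i) /\
    fine (P (\big[setU/set0]_(i | p i) E i)) <= \sum_(i | p i) fine (P (E i)) by case.
apply: (big_ind2 (fun A x => measurable A /\ fine (P A) <= x)).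
- by split => //; rewrite measure0.
- move=> A x B y [mA Ax] [mB By]; split; first exact: measurableU.
  apply: le_trans (lerD Ax By); rewrite -lee_fin EFinD !fineK ?fin_num_measure//.
    exact: measureU2.
  exact: measurableU.
- by move=> i _; split.
Qed.

(* The laws of [X e] and [Y] are compared through finitely many classes of
   sample points: [A n c] contains all the values in class [c], and these
   values are close to each other when the class is [tight]. *)
Section weak_convergence.
Context d (Omega : measurableType d) (R : realType) (P Q : probability Omega R).
Context (S : pseudoMetricType R).
Variables (X : R -> Omega -> S) (Y : Omega -> S).
Variables (I : nat -> finType) (E : forall n, I n -> set Omega)
  (E' : forall n, R -> I n -> set Omega) (A : forall n, I n -> set S).
Arguments E {n}.
Arguments E' {n}.
Arguments A {n}.
Variables (low upp : forall n, I n -> R) (qlow : forall n, R -> I n -> R) (r : nat -> R).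
Arguments low {n}.
Arguments upp {n}.
Arguments qlow {n}.
Hypothesis mE : forall n (c : I n), measurable (E c).
Hypothesis mE' : forall n e (c : I n), measurable (E' e c).
Hypothesis tE : forall n, trivIset setT (@E n).
Hypothesis tE' : forall n e, trivIset setT (@E' n e).
Hypothesis EA : forall n (c : I n) w, E c w -> A c (Y w).
Hypothesis E'A : forall n e (c : I n) w, E' e c w -> A c (X e w).
Hypothesis low_upp : forall n (c : I n), low c <= upp c.
Hypothesis E_upp : forall n (c : I n), fine (P (E c)) <= upp c.
Hypothesis gap : forall eta, 0 < eta ->
  \forall n \near \oo, \sum_(c : I n) (upp c - low c) <= eta.
Hypothesis qlow_le : forall n e (c : I n), 0 < e -> qlow e c <= fine (Q (E' e c)).
Hypothesis qlow_cvg : forall n (c : I n), qlow e c @[e --> 0^'+] --> low c.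
Hypothesis r_cvg0 : forall eps, 0 < eps -> \forall n \near \oo, r n <= eps.

Let tight n (c : I n) : Prop := forall f g, A c f -> A c g -> ball f (r n) g.

Hypothesis likely : forall eta, 0 < eta -> \forall n \near \oo,
  exists U, [/\ measurable U, (P U <= eta%:E)%E &
    forall w, ~ U w -> exists2 c : I n, E c w & tight c].

Section lower_bound.
Variables (F : S -> R) (b : R).
Hypothesis cF : continuous F.
Hypothesis Fb : forall f, `|F f| <= b.

(** Nonemptiness makes the infimum and supremum below meaningful. On other classes the defaults
    [- b] and [b] are the trivial bounds, for which both [lowF c + b] and [b - uppF c] vanish. *)
Let usable n (c : I n) : bool := `[< tight c /\ A c !=set0 >].

Let lowF n (c : I n) : R := if usable c then inf (F @` A c) else - b.
Let uppF n (c : I n) : R := if usable c then sup (F @` A c) else b.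

Let b_ge0 : 0 <= b.
Proof. exact: le_trans (Fb (Y point)). Qed.

Let Fbb f : - b <= F f <= b.
Proof. by have := Fb f; rewrite ler_norml. Qed.

Let FA_bounds n (c : I n) : has_lbound (F @` A c) /\ has_ubound (F @` A c).
Proof.
by split; [exists (- b)|exists b] => _ [f _ <-]; case/andP: (Fbb f).
Qed.

Let lowF_le n (c : I n) f : A c f -> lowF c <= F f.
Proof.
move=> Acf; rewrite /lowF; case: ifP => _; last by case/andP: (Fbb f).
by apply: ge_inf; [case: (FA_bounds c)|exists f].
Qed.

Let uppF_ge n (c : I n) f : A c f -> F f <= uppF c.
Proof.
move=> Acf; rewrite /uppF; case: ifP => _; last by case/andP: (Fbb f).
by apply: ub_le_sup; [case: (FA_bounds c)|exists f].
Qed.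

Let lowF_bound n (c : I n) : - b <= lowF c <= b.
Proof.
rewrite /lowF; case: ifPn => [/asboolP[_ [f Acf]]|_]; last by rewrite lexx ge0_cp.
apply/andP; split.
  by apply: lb_le_inf; [exists (F f), f|move=> _ [g _ <-]; case/andP: (Fbb g)].
have /andP[_] := Fbb f; apply: le_trans.
by apply: ge_inf; [case: (FA_bounds c)|exists f].
Qed.

Let uppF_bound n (c : I n) : - b <= uppF c <= b.
Proof.
rewrite /uppF; case: ifPn => [/asboolP[_ [f Acf]]|_]; last by rewrite lexx ge0_cp.
apply/andP; split.
  have /andP[+ _] := Fbb f; move=> /le_trans; apply.
  by apply: ub_le_sup; [case: (FA_bounds c)|exists f].
by apply: ge_sup; [exists (F f), f|move=> _ [g _ <-]; case/andP: (Fbb g)].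
Qed.

Let osc n (c : I n) : R := if usable c then uppF c - lowF c else 0.

Let osc_bound n (c : I n) : `|osc c| <= 2 * b.
Proof.
rewrite /osc; case: ifP => _; last by rewrite normr0 mulr_ge0.
have /andP[? ?] := lowF_bound c; have /andP[? ?] := uppF_bound c.
by rewrite ler_norml; lra.
Qed.

Let osc_fun n (w : Omega) : R := \sum_(c : I n) osc c * \1_(E c) w.

Let osc_funE n (c : I n) w : E c w -> osc_fun n w = osc c.
Proof.
move=> Ew; rewrite /osc_fun (bigD1 c)//= indicE mem_set// mulr1 big1 ?addr0// => c' cc'.
rewrite indicE memNset ?mulr0// => Ew'.
by move/eqP: cc'; apply; apply: tE => //; exists w.
Qed.

Let osc_fun0 n w : (forall c : I n, ~ E c w) -> osc_fun n w = 0.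
Proof.
by move=> Ew; rewrite /osc_fun big1// => c _; rewrite indicE memNset ?mulr0//; exact: Ew.
Qed.

Let osc_fun_bound n w : `|osc_fun n w| <= 2 * b.
Proof.
have [[c Ec]|nE] := pselect (exists c : I n, E c w).
  by rewrite (osc_funE Ec) osc_bound.
rewrite osc_fun0 ?normr0 ?mulr_ge0// => c Ec.
by apply: nE; exists c.
Qed.

(** Continuity of [F] at the single point [Y w] suffices: a tight class that contains [Y w] lies in
    a ball of radius [r n] around it. *)
Let osc_fun_cvg w : osc_fun n w @[n --> \oo] --> 0.
Proof.
apply/cvgrPdist_le => eps eps0.
have e2 : 0 < eps / 2 by rewrite divr_gt0.
have [del /= del0 hdel] : exists2 del : R, 0 < del &
    forall g, ball (Y w) del g -> `|F (Y w) - F g| < eps / 2.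
  have /cvgrPdist_lt/(_ _ e2)/nbhs_ballP[del /= del0 hdel] : F @ nbhs (Y w) --> F (Y w).
    exact: cF.
  by exists del.
have arith (x y : R) : `|x - y| < eps / 2 -> y <= x + eps / 2 /\ x - eps / 2 <= y.
  by rewrite ltr_norml => /andP[? ?]; split; lra.
near=> n.
have rn : r n <= del by near: n; exact: r_cvg0.
rewrite sub0r normrN.
have [[c Ec]|nE] := pselect (exists c : I n, E c w); last first.
  rewrite osc_fun0 ?normr0 ?ltW// => c Ec.
  by apply: nE; exists c.
rewrite (osc_funE Ec) /osc /lowF /uppF; case: (boolP (usable c)) => [/asboolP[tc [f Acf]]|_]; last first.
  by rewrite normr0 ltW.
have AY := EA Ec.
have near_F g : A c g -> `|F (Y w) - F g| < eps / 2.
  by move=> Acg; apply: hdel; apply: le_ball rn _ _; exact: tc.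
have s1 : sup (F @` A c) <= F (Y w) + eps / 2.
  apply: ge_sup; first by exists (F f), f.
  by move=> _ [g Acg <-]; have [] := arith _ _ (near_F g Acg).
have s2 : F (Y w) - eps / 2 <= inf (F @` A c).
  apply: lb_le_inf; first by exists (F f), f.
  by move=> _ [g Acg <-]; have [] := arith _ _ (near_F g Acg).
have s3 : inf (F @` A c) <= F (Y w) by apply: ge_inf; [case: (FA_bounds c)|exists (Y w)].
have s4 : F (Y w) <= sup (F @` A c) by apply: ub_le_sup; [case: (FA_bounds c)|exists (Y w)].
have s0 : 0 <= sup (F @` A c) - inf (F @` A c) by rewrite subr_ge0; exact: le_trans s3 s4.
rewrite (ger0_norm s0).
rewrite [eps]splitr; apply: le_trans (lerB s1 s2) _.
by rewrite opprB addrC addrA subrK.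
Unshelve. all: by end_near. Qed.

Let osc_mass n : \sum_(c : I n) osc c * fine (P (E c)) = \int[P]_w osc_fun n w.
Proof.
rewrite /osc_fun Rintegral_sum//; last first.
  move=> c; rewrite (_ : EFin \o _ = fun w => ((osc c)%:E * (\1_(E c) w)%:E)%E).
    by apply: integrableZl => //; exact: integrable_indic.
  by apply/funext => w /=; rewrite EFinM.
apply: eq_bigr => c _; rewrite RintegralZl//; last exact: integrable_indic.
by rewrite /Rintegral integral_indic// setIT.
Qed.

Let osc_mass_cvg : \sum_(c : I n) osc c * fine (P (E c)) @[n --> \oo] --> 0.
Proof.
rewrite (_ : (fun n => _) = fun n => \int[P]_w osc_fun n w); last first.
  by apply/funext => n; exact: osc_mass.
have mosc n : measurable_fun setT (osc_fun n).
  apply: measurable_sum => c; apply: measurable_funM; first exact: measurable_cst.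
  by apply: measurable_indic; exact: mE.
have [|||||_ _ h] := @dominated_convergence _ Omega R P setT measurableT
  (fun n w => (osc_fun n w)%:E) (cst 0%E) (cst (2 * b)%:E).
- by move=> n; exact/measurable_EFinP.
- exact: measurable_cst.
- apply: aeW => w _ /=; apply: cvg_EFin; last exact: osc_fun_cvg.
  exact: nearW.
- exact: finite_measure_integrable_cst.
- by apply: aeW => w n _ /=; rewrite lee_fin; exact: osc_fun_bound.
by rewrite integral0 in h; exact: fine_cvg h.
Qed.

Lemma expectation_liminf eta : 0 < eta ->
  \forall e \near 0^'+, \int[P]_w F (Y w) - eta <= \int[Q]_w F (X e w).
Proof.
move=> eta0.
have e4 : 0 < eta / 4 by lra.
(* Four errors of at most [eta / 4] each: the gap between the bounds and the mass of unusable
   classes both cost [2 * b * k]; the other two are the oscillation and the limit in [e]. *)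
pose k := eta / 4 / (2 * b + 1).
have k0 : 0 < k by rewrite divr_gt0//; have := b_ge0; lra.
have kb : 2 * b * k <= eta / 4.
  have b0 := b_ge0; have b1 : 2 * b + 1 != 0 by rewrite gt_eqF//; lra.
  have : k * (2 * b + 1) = eta / 4 by rewrite /k divfK.
  by move: k0; lra.
have [n [[U [mU PU hU]] gap_n osc_n]] : exists n, [/\ exists U, [/\ measurable U,
    (P U <= k%:E)%E & forall w, ~ U w -> exists2 c : I n, E c w & tight c],
    \sum_(c : I n) (upp c - low c) <= k &
    `|\sum_(c : I n) osc c * fine (P (E c))| <= eta / 4].
  suff : \forall n \near \oo, [/\ exists U, [/\ measurable U,
    (P U <= k%:E)%E & forall w, ~ U w -> exists2 c : I n, E c w & tight c],
    \sum_(c : I n) (upp c - low c) <= k &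
    `|\sum_(c : I n) osc c * fine (P (E c))| <= eta / 4] by move=> /filter_ex.
  have /cvgrPdist_le/(_ _ e4) h3 := osc_mass_cvg.
  near=> n; split.
  - by near: n; exact: likely.
  - by near: n; exact: gap.
  - by near: n; apply: filterS h3 => n; rewrite sub0r normrN.
pose p c := fine (P (@E n c)).
have p0 (c : I n) : 0 <= p c by exact: fine_ge0.
have upF : \int[P]_w F (Y w) <= b - \sum_(c : I n) (b - uppF c) * p c.
  have := @Rintegral_ge_partition _ _ _ P (I n) (@E n) (fun c => - uppF c) b
    (fun w => - F (Y w)) (@mE n) (@tE n).
  have h1 w : `|- F (Y w)| <= b by rewrite normrN.
  move=> /(_ h1); have h2 (c : I n) : - b <= - uppF c <= b.
    by have /andP[? ?] := @uppF_bound n c; lra.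
  move=> /(_ h2); have h3 (c : I n) w : E c w -> - uppF c <= - F (Y w).
    by move=> /EA AY; rewrite lerN2 uppF_ge.
  move=> /(_ h3); rewrite (RintegralN_bounded P (fun w => Fb (Y w))).
  rewrite lerNr opprD opprK => h; apply: le_trans h _.
  by rewrite lerD2l lerN2; under eq_bigr do rewrite addrC.
have used : 1 - k <= \sum_(c : I n | usable c) p c.
  apply: le_trans (@probability_bigsetU_le _ _ _ P (I n) (fun c => usable c) _ (@mE n)).
  rewrite -lee_fin fineK ?fin_num_measure//; last exact: bigsetU_measurable.
  apply: (@le_trans _ _ (P (~` U))).
    by rewrite probability_setC// EFinB leeB.
  apply: le_measure; rewrite ?inE; [exact: measurableC|exact: bigsetU_measurable|].
  move=> w Uw; have [c Ec tc] := hU w Uw.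
  rewrite (bigD1 c)/=; first by left.
  by apply/asboolP; split => //; exists (Y w); exact: EA.
have main : \int[P]_w F (Y w) - 3 * (eta / 4) <=
    - b + \sum_(c : I n) (lowF c + b) * low c.
  (* Only [p c <= upp c] is available, not a comparison of [p c] with [low c]; the coefficients lie
     between 0 and [2 * b]. *)
  have g1 : \sum_(c : I n) (lowF c + b) * p c - \sum_(c : I n) (lowF c + b) * low c <= 2 * b * k.
    rewrite -sumrB; apply: (@le_trans _ _ (\sum_(c : I n) 2 * b * (upp c - low c))).
      apply: ler_sum => c _; rewrite -mulrBr.
      have /andP[l1 l2] := lowF_bound c.
      apply: (@le_trans _ _ ((lowF c + b) * (upp c - low c))).
        by apply: ler_wpM2l; [lra|rewrite lerD2r; exact: E_upp].
      by apply: ler_wpM2r; [rewrite subr_ge0|lra].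
    by rewrite -mulr_sumr ler_wpM2l// mulr_ge0.
  have g2 : \sum_(c : I n) (b - uppF c) * p c + \sum_(c : I n) (lowF c + b) * p c =
     2 * b * \sum_(c : I n | usable c) p c - \sum_(c : I n) osc c * p c.
    rewrite mulr_sumr [X in _ = X - _]big_mkcond /= -sumrB -big_split/=.
    apply: eq_bigr => c _; rewrite /osc /lowF /uppF; case: ifP => _; ring.
  have g3 : 2 * b * (1 - k) <= 2 * b * \sum_(c : I n | usable c) p c.
    by rewrite ler_wpM2l// mulr_ge0.
  have g4 := le_trans (ler_norm _) osc_n.
  rewrite -/(p _) in g4; move: g4; rewrite (eq_bigr (fun c => osc c * p c))// => g4.
  lra.
have lim : - b + \sum_(c : I n) (lowF c + b) * qlow e c @[e --> 0^'+] -->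
    - b + \sum_(c : I n) (lowF c + b) * low c.
  apply: cvgD; first exact: cvg_cst.
  apply: cvg_big => [|c _]; first exact: add_continuous.
  by apply: cvgM; [exact: cvg_cst|exact: qlow_cvg].
have /cvgrPdist_le/(_ _ e4) near_lim := lim.
have arith (x y z : R) : x - 3 * (eta / 4) <= y -> `|y - z| <= eta / 4 -> x - eta <= z.
  by rewrite ler_norml => ? /andP[? ?]; lra.
near=> e.
have e0 : 0 < e by near: e; exact: nbhs_right_gt.
have close : `|- b + \sum_(c : I n) (lowF c + b) * low c -
  (- b + \sum_(c : I n) (lowF c + b) * qlow e c)| <= eta / 4 by near: e.
apply: le_trans (arith _ _ _ main close) _.
apply: (@le_trans _ _ (- b + \sum_(c : I n) (lowF c + b) * fine (Q (E' e c)))).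
  rewrite lerD2l; apply: ler_sum => c _; rewrite ler_wpM2l ?qlow_le//.
  by have /andP[l1 _] := lowF_bound c; rewrite -lerBlDr sub0r.
apply: Rintegral_ge_partition => //.
- by move=> c w /E'A AX; exact: lowF_le.
Unshelve. all: by end_near. Qed.

End lower_bound.

Theorem cvg_in_distribution_classes : cvg_in_distribution Q X P Y.
Proof.
move=> F cF [b Fb]; apply/cvgrPdist_le => eta eta0.
have cN : continuous (fun f => - F f) by move=> f; apply: cvgN; exact: cF.
have Nb f : `|- F f| <= b by rewrite normrN.
have h1 := expectation_liminf cF Fb eta0.
have h2 := expectation_liminf cN Nb eta0.
have arith (x y : R) : x - eta <= y -> - x - eta <= - y -> `|x - y| <= eta.
  by move=> ? ?; rewrite ler_norml; lra.
near=> e.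
have l1 : \int[P]_w F (Y w) - eta <= \int[Q]_w F (X e w) by near: e.
have l2 : \int[P]_w - F (Y w) - eta <= \int[Q]_w - F (X e w) by near: e.
rewrite (RintegralN_bounded P (fun w => Fb (Y w))) in l2.
rewrite (RintegralN_bounded Q (fun w => Fb (X e w))) in l2.
exact: arith l1 l2.
Unshelve. all: by end_near. Qed.

End weak_convergence.

(** * The queue *)

Lemma continuous_borel_measurable (R : realType) n (psi : 'rV[R]_n -> R) :
  continuous psi -> measurable_fun setT (psi : borel R n -> R).
Proof.
move=> /continuousP cpsi; apply: (measurability _ (RGenOpens.measurableE R)).
move=> _ [_ [a [b ->] <-]]; rewrite setTI; apply: sub_sigma_algebra.
exact/cpsi/interval_open.
Qed.

Lemma ergodic_average (R : realType) (f : R -> R) (C kappa fbar : R) :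
  0 < C -> 0 < kappa ->
  (forall t, 0 < t -> `|t^-1 * (\int[lebesgue_measure]_(u in `[0%R, t]) f u) - fbar|
     <= C / (1 + t) `^ kappa) ->
  forall rho, 0 < rho -> exists A, forall t, A <= t ->
    `|t^-1 * (\int[lebesgue_measure]_(u in `[0%R, t]) f u) - fbar| <= rho.
Proof.
move=> C0 k0 erg rho rho0; exists (1 + (C / rho) `^ kappa^-1) => t At.
have pw0 : 0 <= (C / rho) `^ kappa^-1 by exact: powR_ge0.
have t0 : 0 < t by lra.
apply: le_trans (erg t t0) _.
rewrite ler_pdivrMr ?powR_gt0//; last lra.
rewrite -ler_pdivrMl// mulrC.
have -> : C / rho = ((C / rho) `^ kappa^-1) `^ kappa.
  by rewrite -powRrM mulVf ?gt_eqF// powRr1// divr_ge0// ltW.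
by rewrite ge0_ler_powR ?nnegrE//; [exact: ltW|lra|lra].
Qed.

(** Arrivals further apart than the mesh cannot share a cell. In the cell that overshoots [T] there
    is no arrival after [T], since such an arrival would be at distance less than [l] from [T]. *)
Lemma class_exists d (Omega : measurableType d) (R : realType) (J : jobs Omega R) w
    (T h delta l : R) (m M : nat) :
  0 < h -> 0 < delta -> h < l -> m%:R * h <= T + h -> well_separated J w T l ->
  exists c : {ffun 'I_m -> option 'I_M.+2}, in_class h delta J c w.
Proof.
move=> h0 d0 hl mT [S1 S2 S3].
have uniq_hit (i : 'I_m) k k' : arrival_hits J (arrival_cell h i) w k ->
    arrival_hits J (arrival_cell h i) w k' -> k = k'.
  have le_T k0 s : arrival J k0 w = s%:E -> arrival_cell h i s -> s <= T.
    move=> ks; rewrite /arrival_cell/= in_itv/= => /andP[_ si].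
    have im : i.+1%:R * h <= m%:R * h by rewrite ler_pM2r// ler_nat ltn_ord.
    have [_ sT] := S2 k0 s (or_introl ks); rewrite leNgt; apply/negP => Ts.
    by move: sT; rewrite gtr0_norm ?subr_gt0//; lra.
  move=> [s ks si] [s' ks' si']; apply/eqP; apply: contraT => kk'.
  have := S1 k k' s s' kk' (or_introl ks) (or_introl ks') (le_T _ _ ks si) (le_T _ _ ks' si').
  by have := arrival_cell_dist si si'; lra.
have /choice[cl clP] : forall i : 'I_m, exists cl : option 'I_M.+2,
    if cl is Some j then
      exists2 k, arrival_hits J (arrival_cell h i) w = [set k] &
        service_cell delta M j (service J k w)
    else arrival_hits J (arrival_cell h i) w = set0.
  move=> i; have [->|/set0P[k ik]] := eqVneq (arrival_hits J (arrival_cell h i) w) set0.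
    by exists None.
  have [j kj] := service_cell_cover M d0 (service J k w).
  exists (Some j), k => //; apply/seteqP; split => [k' ik'|_ -> //].
  exact: uniq_hit ik' ik.
by exists (finfun cl) => i; rewrite ffunE; exact: clP.
Qed.

Section rectangle_masses.
Context (R : realType) (nu : R.-pker (measurableTypeR R) ~> (measurableTypeR R)).
Variables (lam : R -> R) (K psib c : R).
Hypothesis mlam : measurable_fun (`[0, +oo[%classic : set (measurableTypeR R)) lam.
Hypothesis lam0K : forall u, 0 <= u -> 0 <= lam u <= K.
Hypothesis psib_ge0 : 0 <= psib.
Hypothesis c_gt0 : 0 < c.
Variables (h delta : R) (M : nat).
Hypotheses (h_gt0 : 0 < h) (delta_gt0 : 0 < delta).
Hypothesis cell_dist : forall s t j, 0 < s -> 0 < t ->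
  `|fine (nu s (service_cell delta M j)) - fine (nu t (service_cell delta M j))| <=
  2 * c * `|t - s|.

(* Nothing is known about [nu 0], hence the trivial bound in the cell
   containing 0. *)
Definition service_weight (i j : nat) : R :=
  if i is 0%N then 0
  else Num.max 0 (fine (nu (i%:R * h) (service_cell delta M j)) - 2 * c * h).

Lemma service_weight_ge0 i j : 0 <= service_weight i j.
Proof. by rewrite /service_weight; case: i => // i; rewrite le_max lexx. Qed.

Let cell_close i j s : arrival_cell h i.+1 s ->
  `|fine (nu (i.+1%:R * h) (service_cell delta M j)) -
    fine (nu s (service_cell delta M j))| <= 2 * c * h.
Proof.
move=> si; have i0 : 0 < i.+1%:R * h by rewrite mulr_gt0.
have s0 : 0 < s.
  by apply: lt_le_trans i0 _; move: si; rewrite /arrival_cell/= in_itv/= => /andP[].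
have c2 : 0 <= 2 * c by rewrite mulr_ge0// ltW.
apply: le_trans (cell_dist _ i0 s0) _; apply: ler_wpM2l => //; apply: ltW.
apply: (arrival_cell_dist si).
by rewrite /arrival_cell/= in_itv/= lexx ltr_pM2r// ltr_nat ltnSn.
Qed.

Lemma service_weight_le i j s : arrival_cell h i s ->
  service_weight i j <= fine (nu s (service_cell delta M j)).
Proof.
case: i => [|i] si /=; first exact: fine_pkernel_ge0.
rewrite ge_max fine_pkernel_ge0/=.
by have := cell_close j si; rewrite ler_norml; lra.
Qed.

Let cell_ge0 (i : nat) s : arrival_cell h i s -> 0 <= s.
Proof.
rewrite /arrival_cell/= in_itv/= => /andP[si _]; apply: le_trans si.
by rewrite mulr_ge0// ltW.
Qed.

Let ih0 (i : nat) : 0 <= i%:R * h.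
Proof. by rewrite mulr_ge0// ltW. Qed.

Lemma integrable_cell_mass i :
  (@lebesgue_measure R).-integrable (arrival_cell h i) (EFin \o (fun s => psib * lam s)).
Proof.
apply: (bounded_integrable_itv (B := psib * K)) => //; first exact: measurable_funM.
move=> u u0; have /andP[l0 lK] := lam0K u0.
by rewrite ger0_norm ?mulr_ge0// ler_wpM2l.
Qed.

Lemma cell_mass_ge0 i : 0 <= cell_mass lam psib h i.
Proof.
apply: Rintegral_ge0 => s si; have /andP[l0 _] := lam0K (cell_ge0 si).
exact: mulr_ge0.
Qed.

Lemma cell_mass_le i : cell_mass lam psib h i <= psib * K * h.
Proof.
have e : fine (lebesgue_measure (arrival_cell h i)) = h.
  rewrite /arrival_cell lebesgue_measure_itv/= lte_fin ltr_pM2r// ltr_nat ltnSn/=.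
  by rewrite -mulrBl -natrB// subSnn mul1r.
rewrite -[in leRHS]e -Rintegral_cst//; last exact: measurable_itv.
apply: le_Rintegral; [exact: measurable_itv|exact: integrable_cell_mass| |].
  by apply: (bounded_integrable_itv (B := `|psib * K|)).
by move=> s si; have /andP[_ lK] := lam0K (cell_ge0 si); exact: ler_wpM2l.
Qed.

Let integrable_rectangle i j :
  (@lebesgue_measure R).-integrable (arrival_cell h i)
    (EFin \o (fun s => psib * lam s * fine (nu s (service_cell delta M j)))).
Proof. exact: (bounded_mass nu mlam lam0K psib_ge0 _ (ih0 i) (measurable_service_cell _ _ _)). Qed.

Let integrable_scaled i x : (@lebesgue_measure R).-integrable (arrival_cell h i)
    (EFin \o (fun s => psib * lam s * x)).
Proof.
rewrite (_ : EFin \o _ = fun s => ((psib * lam s)%:E * x%:E)%E).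
  by apply: integrableZr => //; [exact: measurable_itv|exact: integrable_cell_mass].
by apply/funext => s; rewrite /= EFinM.
Qed.

Let mcell i : measurable (arrival_cell h i : set (measurableTypeR R)).
Proof. exact: measurable_itv. Qed.

Lemma rectangle_mass_ge i j :
  cell_mass lam psib h i * service_weight i j <= rectangle_mass nu lam psib h delta M i j.
Proof.
rewrite /cell_mass -RintegralZr//; last exact: integrable_cell_mass.
apply: le_Rintegral => //.
move=> s si; have /andP[l0 _] := lam0K (cell_ge0 si).
by rewrite ler_wpM2l ?mulr_ge0// service_weight_le.
Qed.

(** Of [4 * c * h], one half was subtracted in the definition of [service_weight] and the other is
    the variation of the kernel over the cell. *)
Lemma rectangle_mass_le i j : rectangle_mass nu lam psib h delta M i.+1 j <=
  cell_mass lam psib h i.+1 * (service_weight i.+1 j + 4 * c * h).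
Proof.
rewrite /cell_mass -RintegralZr//; last exact: integrable_cell_mass.
apply: le_Rintegral => //.
move=> s si; have /andP[l0 _] := lam0K (cell_ge0 si).
rewrite ler_wpM2l ?mulr_ge0//.
have : fine (nu (i.+1%:R * h) (service_cell delta M j)) - 2 * c * h <= service_weight i.+1 j.
  by rewrite /= le_max lexx orbT.
by have := cell_close j si; rewrite ler_norml; lra.
Qed.

(** The first cell has weight 0 and loses its whole mass, at most [psib * K * h]; each of the [m]
    others loses at most a fraction [4 * c * h] of its mass for each service cell. *)
Lemma rectangle_mass_gap (m : nat) :
  \sum_(i < m.+1) \sum_(j < M.+2) (rectangle_mass nu lam psib h delta M i j -
    cell_mass lam psib h i * service_weight i j) <=
  psib * K * h * (1 + m%:R * (M.+2%:R * (4 * c * h))).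
Proof.
have K0 : 0 <= K by have /andP[] := lam0K (lexx 0); exact: le_trans.
rewrite big_ord_recl mulrDr mulr1 lerD//.
  under eq_bigr do rewrite /= mulr0 subr0.
  by rewrite (sum_rectangle_mass nu mlam lam0K)// cell_mass_le.
apply: (@le_trans _ _ (\sum_(i < m) psib * K * h * (M.+2%:R * (4 * c * h)))); last first.
  by rewrite sumr_const card_ord -[leLHS]mulr_natl mulrCA.
apply: ler_sum => i _; rewrite lift0.
apply: (@le_trans _ _ (\sum_(j < M.+2) cell_mass lam psib h i.+1 * (4 * c * h))).
  apply: ler_sum => j _; have := rectangle_mass_le i j; rewrite mulrDr; lra.
rewrite sumr_const card_ord -[leLHS]mulr_natl mulrCA.
rewrite ler_wpM2r ?cell_mass_le// !mulr_ge0// ltW//.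
Qed.

End rectangle_masses.

Theorem theorem4p6 (R : realType)
  (dO : measure_display) (Omega : measurableType dO) (P : probability Omega R)
  (d : nat) (Z : R -> Omega -> borel R d)
  (rho0 pi : probability (borel R d) R)
  (evol : R -> probability (borel R d) R -> probability (borel R d) R)
  (kappa K : R) (psi : 'rV[R]_d -> R)
  (Z_measurable : forall t : R, 0 <= t -> measurable_fun setT (Z t))
  (Z_path_measurable :
    {ae P, forall w, measurable_fun (`[0, +oo[%classic : set (measurableTypeR R)) (Z^~ w)})
  (Z_evolution : evolution_of P Z rho0 evol)
  (pi_unique_invariant : unique_invariant_law evol pi)
  (kappa_gt0 : 0 < kappa)
  (Z_ergodic : strongly_ergodic P Z pi kappa psi)
  (PZ : Omega -> probability Omega R)
  (PZ_conditional :
    conditional_probability P (sigma_generated `[0, +oo[%classic Z) PZ)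
  (lambda : R -> R)
  (K_gt0 : 0 < K)
  (lambda_continuous : {within `[0, +oo[%classic, continuous lambda})
  (lambda_bounded : forall s : R, 0 <= s -> 0 <= lambda s <= K)
  (psi_continuous : continuous psi)
  (psi_bounded : forall z, 0 < psi z <= K)
  (psi_lipschitz : exists l : R, l.-lipschitz psi)
  (jobs_eps : R -> jobs Omega R)
  (arrivals_poisson : {ae P, forall w, forall e : R, 0 < e ->
    poisson_arrivals (PZ w) (jobs_eps e)
      (fun s => lambda s * psi (Z (s / e) w))})
  (nu : R.-pker (measurableTypeR R) ~> (measurableTypeR R))
  (alpha c : R)
  (nu_nonnegative : forall s : R, 0 <= s -> nu s `[0, +oo[%classic = 1%E)
  (alpha_gt0 : 0 < alpha) (c_gt0 : 0 < c)
  (nu_tail : forall r s : R, 0 < r -> 0 < s ->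
    ccdf_kernel nu s r <= c * Num.min (r `^ (- alpha)) 1)
  (nu_lipschitz : forall s t r : R, 0 < s -> s < t -> 0 < r ->
    `|ccdf_kernel nu s r - ccdf_kernel nu t r|
      <= c * (1 + r) `^ (-1 - alpha) * (t - s))
  (services_independent : {ae P, forall w, forall e : R, 0 < e ->
    independent_services (PZ w) (jobs_eps e) nu})
  (jobs_lim : jobs Omega R)
  (jobs_lim_poisson :
    poisson_jobs P jobs_lim (mean_measure (\int[pi]_z psi z) lambda nu))
  (queues_independent : forall e : R, 0 < e -> independent_sigma P
    (sigma_generated `[0, +oo[%classic
      (queue jobs_lim : R -> Omega -> measurableTypeR R))
    (sigma_generated `[0, +oo[%classic
      (queue (jobs_eps e) : R -> Omega -> measurableTypeR R)))
  (T : R) (T_gt0 : 0 < T) :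
  {ae P, forall w,
    cvg_in_distribution (PZ w) (fun e => queue_path (jobs_eps e) T)
      P (queue_path jobs_lim T)}.
Proof.
set psib := \int[pi]_z psi z.
have psib_ge0 : 0 <= psib.
  by apply: Rintegral_ge0 => z _; case/andP: (psi_bounded z) => /ltW.
have mlam : measurable_fun (`[0, +oo[%classic : set (measurableTypeR R)) lambda.
  exact: subspace_continuous_measurable_fun.
have [C [_ C_gt0 ergodic]] := Z_ergodic.
have cell_dist delta M : 0 < delta -> forall s t j, 0 < s -> 0 < t ->
    `|fine (nu s (service_cell delta M j)) - fine (nu t (service_cell delta M j))| <=
    2 * c * `|t - s|.
  by move=> d0 s t j; exact: (kernel_service_cell_dist alpha_gt0 c_gt0 nu_lipschitz).
have ccdf_lip := ccdf_lipschitz_dist alpha_gt0 c_gt0 nu_lipschitz.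
(* The exceptional null set is fixed here, before the functional and the discretization are chosen;
   from now on the realization of [Z] is deterministic. *)
suff main w : measurable_fun (`[0, +oo[%classic : set (measurableTypeR R)) (Z^~ w) ->
    (forall t : R, 0 < t -> `| t^-1 * (\int[lebesgue_measure]_(u in `[0%R, t]) psi (Z u w))
        - psib | <= C w / (1 + t) `^ kappa) ->
    (forall e : R, 0 < e -> poisson_arrivals (PZ w) (jobs_eps e)
      (fun s => lambda s * psi (Z (s / e) w))) ->
    (forall e : R, 0 < e -> independent_services (PZ w) (jobs_eps e) nu) ->
    cvg_in_distribution (PZ w) (fun e => queue_path (jobs_eps e) T)
      P (queue_path jobs_lim T).
  near=> w; apply: main; near: w.
  - exact: Z_path_measurable.
  - exact: ergodic.
  - exact: arrivals_poisson.
  - exact: services_independent.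
move=> mZ erg pois serv.
pose f u := psi (Z u w).
have mf : measurable_fun (`[0, +oo[%classic : set (measurableTypeR R)) f.
  by apply: (measurableT_comp (continuous_borel_measurable psi_continuous)).
have f0K u : 0 <= u -> 0 <= f u <= K.
  by move=> _; have /andP[/ltW -> ->] := psi_bounded (Z u w).
have average := ergodic_average (C_gt0 w) kappa_gt0 erg.
pose delta n : R := T / n.+1%:R.
pose h n : R := T / (n.+1 ^ 2)%:R.
pose m n := (n.+1 ^ 2)%N.
have delta_gt0 n : 0 < delta n by rewrite divr_gt0.
have h_gt0 n : 0 < h n by rewrite divr_gt0// ltr0n expn_gt0.
(* One cell more than needed to tile [[0, T[], because right-open cells would miss [T] itself. *)
have mh n : (m n).+1%:R * h n = T + h n.
  by rewrite -natr1 mulrDl mul1r /h /m mulrC divfK// pnatr_eq0 expn_eq0.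
have Md n : n.+1%:R * delta n = T by rewrite mulrC divfK// pnatr_eq0.
have h_delta n : h n <= delta n.
  rewrite /h /delta ler_pM2l// lef_pV2 ?posrE ?ltr0n ?expn_gt0// ler_nat.
  by rewrite expnS expn1 leq_pmulr.
have delta_small eps : 0 < eps -> \forall n \near \oo, delta n <= eps.
  move=> eps0; near=> n; rewrite /delta ler_pdivrMr// mulrC -ler_pdivrMr//.
  apply: (@le_trans _ _ n%:R); last by rewrite ler_nat.
  by near: n; exact: nbhs_infty_ger.
pose I n : finType := {ffun 'I_(m n).+1 -> option 'I_n.+1.+2}.
pose E n (cl : I n) := in_class (h n) (delta n) jobs_lim cl.
pose E' n e (cl : I n) := in_class (h n) (delta n) (jobs_eps e) cl.
pose A n (cl : I n) : set (skorohod T) := [set p | exists (J : jobs Omega R) v,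
  in_class (h n) (delta n) J cl v /\ p = queue_path J T v].
pose L n (i : 'I_(m n).+1) := cell_mass lambda psib (h n) i.
pose rect n (i : 'I_(m n).+1) (j : 'I_n.+1.+2) :=
  rectangle_mass nu lambda psib (h n) (delta n) n.+1 i j.
pose v n (i : 'I_(m n).+1) (j : 'I_n.+1.+2) :=
  service_weight nu c (h n) (delta n) n.+1 i j.
pose low n (cl : I n) : R := \prod_i (expR (- L n i) *
  (if cl i is Some j then L n i * v n i j else 1)).
pose upp n (cl : I n) : R := \prod_i (expR (- L n i) *
  (if cl i is Some j then rect n i j else 1)).
pose x n e (i : nat) := \int[lebesgue_measure]_(s in arrival_cell (h n) i)
  (lambda s * f (s / e)).
pose qlow n e (cl : I n) : R := (\prod_i (if cl i is Some j then v n i j else 1)) *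
  \prod_(i < (m n).+1) (expR (- x n e i) * (if cl i != None then x n e i else 1)).
have cellD n := cell_dist (delta n) n.+1 (delta_gt0 n).
have L0 n i : 0 <= L n i by exact: (cell_mass_ge0 lambda_bounded psib_ge0 (h_gt0 n)).
have v0 n i j : 0 <= v n i j by exact: service_weight_ge0.
have Lv n i j : L n i * v n i j <= rect n i j.
  exact: (rectangle_mass_ge mlam lambda_bounded psib_ge0 c_gt0 (h_gt0 n) (cellD n)).
have rectL n i : \sum_j rect n i j = L n i.
  exact: (sum_rectangle_mass nu mlam lambda_bounded psib_ge0 n.+1 (h_gt0 n) (delta_gt0 n)).
have x_cvg n i : x n e i @[e --> 0^'+] --> cell_mass lambda psib (h n) i.
  have -> : cell_mass lambda psib (h n) i =
      psib * \int[lebesgue_measure]_(s in arrival_cell (h n) i) lambda s.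
    rewrite /cell_mass RintegralZl//; first exact: measurable_arrival_cell.
    apply: (bounded_integrable_itv (B := K)) => //; first by rewrite mulr_ge0// ltW.
    by move=> u u0; have /andP[? ?] := lambda_bounded u u0; rewrite ger0_norm.
  apply: (weighted_average mf f0K average) => //; first by rewrite mulr_ge0// ltW.
  by rewrite ltr_pM2r// ltr_nat.
apply: (@cvg_in_distribution_classes _ Omega R P (PZ w) (skorohod T)
  (fun e => queue_path (jobs_eps e) T) (queue_path jobs_lim T) I E E' A low upp qlow
  (fun n => 10 * delta n)).
- by move=> n cl; exact: measurable_in_class.
- by move=> n e cl; exact: measurable_in_class.
- by move=> n; exact: trivIset_in_class.
- by move=> n e; exact: trivIset_in_class.
- by move=> n cl u Eu; exists jobs_lim, u.
- by move=> n e cl u Eu; exists (jobs_eps e), u.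
- move=> n cl; apply: ler_prod => i _; apply/andP; split.
    by rewrite mulr_ge0 ?expR_ge0//; case: (cl i) => [j|//]; exact: mulr_ge0.
  by rewrite ler_wpM2l ?expR_ge0//; case: (cl i).
- move=> n cl.
  exact: (in_class_lim_le mlam lambda_bounded psib_ge0 (h_gt0 n) (delta_gt0 n)).
(* From [m * h = T], [h <= delta] and [(n + 3) * h <= 3 * delta]: the first cell contributes 1 and
   the others [4 * c * T * 3]. *)
- move=> eta eta0; pose B := psib * K * (1 + 12 * c * T).
  have K0 : 0 <= K by exact: ltW.
  have B0 : 0 <= B by rewrite !mulr_ge0// addr_ge0// !mulr_ge0// ltW.
  have bound n : \sum_(cl : I n) (upp n cl - low n cl) <= B * delta n.
    apply: le_trans (class_weights_diff (L0 n) (v0 n) (Lv n) (rectL n)) _.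
    apply: le_trans (rectangle_mass_gap mlam lambda_bounded psib_ge0 c_gt0
      (h_gt0 n) (delta_gt0 n) (cellD n) (m n)) _.
    have mhT : (m n)%:R * h n = T by have := mh n; rewrite -natr1 mulrDl mul1r; lra.
    have nh : n.+3%:R * h n <= 3 * delta n.
      have -> : delta n = n.+1%:R * h n.
        have div_sq (k : R) : k != 0 -> T / k = k * (T / k ^+ 2) by move=> k0; field.
        by rewrite /delta /h natrX -div_sq// pnatr_eq0.
      rewrite mulrA ler_pM2r// -natrM ler_nat; lia.
    have -> : psib * K * h n * (1 + (m n)%:R * (n.+3%:R * (4 * c * h n))) =
       psib * K * (h n + 4 * c * ((m n)%:R * h n) * (n.+3%:R * h n)) by ring.
    rewrite mhT /B -(mulrA (psib * K) _ (delta n)).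
    apply: ler_wpM2l; first exact: mulr_ge0.
    have : 4 * c * T * (n.+3%:R * h n) <= 4 * c * T * (3 * delta n).
      by rewrite ler_wpM2l// !mulr_ge0// ltW.
    by have := h_delta n; lra.
  have e1 : 0 < eta / (B + 1) by rewrite divr_gt0//; lra.
  have arith y : y <= eta / (B + 1) -> 0 < y -> B * y <= eta.
    by rewrite ler_pdivlMr; lra.
  near=> n; apply: le_trans (bound n) _; apply: arith => //.
  by near: n; exact: delta_small.
- move=> n e cl e0.
  have v_le (i : 'I_(m n).+1) (j : 'I_n.+1.+2) s : arrival_cell (h n) i s ->
      v n i j <= fine (nu s (service_cell (delta n) n.+1 j)).
    exact: (service_weight_le c_gt0 (h_gt0 n) (cellD n)).
  apply: le_trans (in_class_ge cl (h_gt0 n) (serv e e0) (v0 n) v_le).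
  rewrite (arrival_counts (h_gt0 n) (pois e e0))//.
  + move=> s s0; have /andP[l0 _] := lambda_bounded s s0.
    by rewrite mulr_ge0//; case/andP: (f0K (s / e) (divr_ge0 s0 (ltW e0))).
  + move=> i; apply: (integrable_weighted mf f0K mlam lambda_bounded) => //.
    by rewrite mulr_ge0// ltW.
- move=> n cl.
  have -> : low n cl = (\prod_i (if cl i is Some j then v n i j else 1)) *
      \prod_(i < (m n).+1) (expR (- L n i) * (if cl i != None then L n i else 1)).
    rewrite -big_split/=; apply: eq_bigr => i _.
    by case: (cl i) => [j|] /=; [rewrite mulrA mulrC|rewrite mul1r].
  apply: cvgM; first exact: cvg_cst.
  apply: cvg_big => [|i _]; first exact: mul_continuous.
  apply: cvgM.
    apply: (@cvg_comp _ _ _ (fun e => - x n e i) expR); last exact: continuous_expR.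
    by apply: cvgN; exact: x_cvg.
  by case: ifP => _; [exact: x_cvg|exact: cvg_cst].
- move=> eps eps0; have e1 : 0 < eps / 10 by lra.
  near=> n; rewrite mulrC -ler_pdivlMr//; near: n; exact: delta_small.
- have mass y l : 0 < l -> (0 <= mean_measure psib lambda nu (event_strip (2 * T) y l) <=
      ((psib * K * (1 + (1 + c * (2 * T)) * 2)) * l)%:E)%E.
    move=> l0; apply/andP; split.
      apply: integral_ge0 => s; rewrite /= in_itv/= andbT => s0; apply: mule_ge0 => //.
      by rewrite lee_fin mulr_ge0//; case/andP: (lambda_bounded s s0).
    have T2 : 0 < 2 * T by rewrite mulr_gt0.
    apply: le_trans (mean_event_strip c_gt0 ccdf_lip lambda_bounded psib_ge0 y T2 l0) _.
    by rewrite lee_fin le_eqVlt; apply/orP; left; apply/eqP; ring.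
  have mass0 : 0 <= psib * K * (1 + (1 + c * (2 * T)) * 2).
    by rewrite !mulr_ge0// ?addr_ge0// ?mulr_ge0// ?addr_ge0// ?mulr_ge0// ltW.
  move=> eta eta0.
  have [l0 l0_gt0 hl] := separated_likely T_gt0 mass0 jobs_lim_poisson mass eta0.
  (* The closeness lemma is used with radius [5 * delta n], large enough since
     [h + delta <= 2 * delta], and it asks for separation three times that radius. Two members of a
     class are compared through the limit path, which doubles the radius to [10 * delta n]. *)
  have small n : delta n <= l0 / 15 -> 0 < 3 * (5 * delta n) <= l0.
    by have := delta_gt0 n; lra.
  have l15 : 0 < l0 / 15 by lra.
  have likely n : delta n <= l0 / 15 -> exists U, [/\ measurable U, (P U <= eta%:E)%E &
      forall w', ~ U w' -> exists2 cl : I n, E n cl w' &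
        forall p q, A n cl p -> A n cl q -> ball p (10 * delta n) q].
    move=> /small /hl[U [mU PU sepU]]; exists U; split => // w' Uw'.
    have sep := sepU w' Uw'.
    have hn := h_gt0 n; have dn := delta_gt0 n; have hd := h_delta n; have mhn := mh n.
    have hl' : h n < 3 * (5 * delta n) by lra.
    have mT : (m n).+1%:R * h n <= T + h n by lra.
    have [cl Ecl] := class_exists n.+1 hn dn hl' mT sep.
    exists cl => // p q [J [u [uJ ->]]] [J' [u' [uJ' ->]]].
    have close (K' : jobs Omega R) u'' : in_class (h n) (delta n) K' cl u'' ->
        skorohod_ball (queue_path jobs_lim T w') (5 * delta n) (queue_path K' T u'').
      have hdr : h n + delta n <= 5 * delta n / 2 by lra.
      have hTm : T < (m n).+1%:R * h n <= T + h n by lra.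
      have TM : T <= n.+1%:R * delta n by rewrite Md.
      exact: (in_class_close hn dn hdr hTm TM sep Ecl).
    have -> : 10 * delta n = 5 * delta n + 5 * delta n by ring.
    apply: skorohod_ball_triangle (close _ _ uJ').
    exact/skorohod_ball_sym/close.
  by near=> n; apply: likely; near: n; exact: delta_small.
Unshelve. all: by end_near. Qed.
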